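(* For every function $f\in L^{2}(\mathbb{R})$ and every $b\in\mathbb{R}$, $$\frac{1}{\pi}\int_{-\infty}^{\infty}\left[f^{2}(x)-\tilde f^{2}(x)\right]\ln\frac{1}{|x-b|}\,dx=-2\int_{-\infty}^{b}f(x)\tilde f(x)\,dx,$$ where $\tilde f$ is the Hilbert transform of $f$ and the integral on the left-hand side is understood via the $H^{1}$–$BMO(\mathbb{R})$ duality (the function $f^{2}-\tilde f^{2}$ belongs to $H^{1}(\mathbb{R})$).
   Context: The Hilbert transform of $f\in L^{p}(\mathbb{R})$, $1\le p<\infty$, is $Hf(x)=\tilde f(x)=\frac{1}{\pi}\,\mathrm{p.v.}\int_{-\infty}^{\infty}\frac{f(t)}{x-t}\,dt$ (defined for a.e. $x$). The real Hardy space $H^{1}(\mathbb{R})$ consists of all $f\in L^{1}(\mathbb{R})$ such that $\tilde f\in L^{1}(\mathbb{R})$, with norm $\|f\|_{L^1}+\|\tilde f\|_{L^1}$. Its dual is $BMO(\mathbb{R})$, the space of functions of bounded mean oscillation; for each $b$ the function $x\mapsto \ln\frac{1}{|x-b|}$ is in $BMO(\mathbb{R})$. For $\psi\in BMO(\mathbb{R})$ and $h\in H^{1}(\mathbb{R})$, the expression $\int h\psi\,dx$ ''via duality'' means the value at $h$ of the unique continuous linear functional on $H^{1}(\mathbb{R})$ which is given by the ordinary Lebesgue integral $\int h\psi\,dx$ on the dense subspace of bounded, compactly supported $h$ with $\int h=0$. *)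

(* Defs.v *)
From HB Require Import structures.
From mathcomp Require Import all_boot all_order all_algebra.
From mathcomp Require Import all_classical all_reals all_analysis.
Set Implicit Arguments.
Unset Strict Implicit.
Unset Printing Implicit Defensive.
Import Order.TTheory GRing.Theory Num.Theory.
Import numFieldNormedType.Exports.
Local Open Scope classical_set_scope.
Local Open Scope ring_scope.

Section Defs.
Context {R : realType}.
Local Notation mu := (@lebesgue_measure R).
Implicit Types (f h psi : R -> R).

Definition truncated_hilbert f (x eps : R) : R :=
  pi^-1 * Rintegral mu [set t | eps < `|x - t|] (fun t => f t / (x - t)).

(* For f in L^p, 1 <= p < oo, the truncations are absolutely convergent
   integrals and the limit exists for almost every x; where it does not exist,
   [lim] returns a default value. *)
Definition hilbert f (x : R) : R :=
  lim (truncated_hilbert f x eps @[eps --> 0^'+]).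

(* Elements are functions, not classes modulo a.e. equality. *)
Definition H1 : set (R -> R) :=
  [set h : R -> R | h \in Lfun mu 1 /\ hilbert h \in Lfun mu 1].

Definition H1_norm h : R :=
  Rintegral mu setT (fun x => `|h x|) +
  Rintegral mu setT (fun x => `|hilbert h x|).

Definition mean psi (a c : R) : R := (c - a)^-1 * Rintegral mu `[a, c] psi.

Definition BMO : set (R -> R) :=
  [set psi : R -> R | locally_integrable setT psi /\
     exists M : R, forall a c : R, a < c ->
       mean (fun x => `|psi x - mean psi a c|) a c <= M].

(* The dense subspace of H1 on which the pairing is an ordinary integral. *)
Definition H1_test : set (R -> R) :=
  [set h : R -> R | [/\ measurable_fun setT h,
               exists M : R, forall x, `|h x| <= M,
               compact (closure [set x | h x != 0]) &
               Rintegral mu setT h = 0]].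

(* Only the values of L on H1 are constrained. *)
Definition H1_BMO_functional psi : set ((R -> R) -> R) :=
  [set L | [/\ BMO psi,
    forall (a : R) (h1 h2 : R -> R), H1 h1 -> H1 h2 ->
      L (fun x => a * h1 x + h2 x) = a * L h1 + L h2,
    exists C : R, forall h : R -> R, H1 h -> `|L h| <= C * H1_norm h &
    forall h : R -> R, H1_test h -> L h = Rintegral mu setT (fun x => h x * psi x)]].

(* The value at h of the functional determined by psi.  Functionals in
   [H1_BMO_functional psi] agree on H1 because H1_test is dense there, so for
   psi in BMO and h in H1 the value does not depend on the choice; it is
   the default 0 when there is no such functional. *)
Definition H1_BMO_pairing psi h : R :=
  xget (fun=> 0) (H1_BMO_functional psi) h.

End Defs.

(* Main.v *)
Require Import Defs.
From HB Require Import structures.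
From mathcomp Require Import all_boot all_order all_algebra.
From mathcomp Require Import all_classical all_reals all_analysis.
From mathcomp Require Import measurable_realfun ring lra.
Set Implicit Arguments.
Unset Strict Implicit.
Unset Printing Implicit Defensive.
Import Order.TTheory GRing.Theory Num.Theory.
Import numFieldNormedType.Exports.
Local Open Scope classical_set_scope.
Local Open Scope ring_scope.

(* The function f + i Hf is the boundary value of an analytic function in the
   upper half-plane, and so is its square; hence H(f^2 - (Hf)^2) = 2 f Hf. Here
   analyticity enters only through the identity K(a) - K(b) = pi (b - a) K(a) K(b)
   for the kernel K(z) = 1 / (pi z).

   The functional h |-> - pi int_{-oo}^b Hh is bounded on H^1, and on test
   functions it is int h psi with psi(x) = ln (1 / |x - b|), because H is
   antisymmetric and the Hilbert transform of the indicator of [a, b] is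
   (1 / pi) ln |(t - a) / (t - b)|. Its value at f^2 - (Hf)^2 is the right-hand side.

   It is linear because the Hilbert transform of an integrable f exists almost
   everywhere: let K be the closed set where the Poisson maximal function of |f|
   is at most n, and spread the mass of f off K by Poisson kernels at the scale
   of the distance to K; the result is in L^2, and on K the error is dominated.

   Any other functional with the same values on test functions agrees with it at
   f^2 - (Hf)^2: approximate f in L^2 by conjugate Poisson integrals u of compactly
   supported functions. Then u^2 - (Hu)^2 has mean zero and decays like x^-2, and
   for such functions H commutes with multiplication by x, so that the H^1 norm is
   controlled by weighted L^2 norms and truncation converges in H^1. *)

(** * Integrals and square integrable functions on the line *)

(** [hilbert] is a raw [lim] with a default value, so even additivity on H^1 requires the
    truncations to converge almost everywhere; and the pairing is an unspecified choice among
    functionals, so every admissible functional has to be controlled, not only the one that is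
    constructed. Lebesgue points connect truncations and kernels: [Q y] minus the truncated kernel
    is odd and bounded by [P y], so at such points the conjugate Poisson integral and the truncation
    have the same limit. On L^2 the limit exists because the inner product of [Qc y f] and [Qc s f]
    is that of [f] with [Pc (s + y) f]: the family is Cauchy as the heights tend to 0, and the limit
    has the norm of [f]. On L^1 the spread mass lies in L^2 because Poisson kernels of different
    scales obey a quasi-triangle inequality, which bounds the squared norm by the interaction of the
    mass with its own spread; the maximal function bounds that interaction. For uniqueness, L^1
    norms are bounded by [la] times squared weighted L^2 norms plus [pi / la], with [la] free: the
    weighted norms tend to 0 first, then [la] tends to infinity. *)

Notation Int f := (Rintegral (@lebesgue_measure _) setT f).

Section Integral.
Context {R : realType}.
Local Notation mu := (@lebesgue_measure R).
Implicit Types (f g h : R -> R) (F G : R -> R -> R).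

Definition integ f := mu.-integrable setT (EFin \o f).
Definition L2 f := measurable_fun setT f /\ integ (fun x => f x ^+ 2).
Definition meas2 F := measurable_fun setT (fun p : R * R => F p.1 p.2).

Lemma aeS (P Q : R -> Prop) : (forall x, P x -> Q x) ->
  {ae mu, forall x, P x} -> {ae mu, forall x, Q x}.
Proof. by move=> h; exact: (@filterS _ _ (ae_filter_ringOfSetsType mu)). Qed.

Lemma aeS2 (P Q S : R -> Prop) : (forall x, P x -> Q x -> S x) ->
  {ae mu, forall x, P x} -> {ae mu, forall x, Q x} -> {ae mu, forall x, S x}.
Proof. by move=> h; exact: (@filterS2 _ _ (ae_filter_ringOfSetsType mu)). Qed.

Lemma aeS3 (P Q S U : R -> Prop) : (forall x, P x -> Q x -> S x -> U x) ->
  {ae mu, forall x, P x} -> {ae mu, forall x, Q x} -> {ae mu, forall x, S x} ->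
  {ae mu, forall x, U x}.
Proof. by move=> h; exact: (@filterS3 _ _ (ae_filter_ringOfSetsType mu)). Qed.

Lemma aeT (P : R -> Prop) : (forall x, P x) -> {ae mu, forall x, P x}.
Proof. by move=> h; exact: aeW. Qed.

Lemma integ_meas f : integ f -> measurable_fun setT f.
Proof. by move=> /measurable_int/measurable_EFinP. Qed.

Lemma integ_le f g : measurable_fun setT f -> integ g ->
  (forall x, `|f x| <= g x) -> integ f.
Proof.
move=> mf ig fg; apply: le_integrable ig => //; first exact/measurable_EFinP.
by move=> x _ /=; rewrite lee_fin (le_trans (fg x))// ler_norm.
Qed.

Lemma integ_abs f : integ f -> integ (fun x => `|f x|).
Proof.
move=> fi; apply: (le_integrable _ _ _ fi) => //.
  by apply/measurable_EFinP; apply: measurableT_comp => //; exact: integ_meas.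
by move=> x _ /=; rewrite normr_id.
Qed.

Lemma integ_add f g : integ f -> integ g -> integ (fun x => f x + g x).
Proof. by move=> fi gi; apply: (integrableD _ fi gi). Qed.

Lemma integ_scale k f : integ f -> integ (fun x => k * f x).
Proof. by move=> fi; apply: (integrableZl _ k fi). Qed.

Lemma integ_opp f : integ f -> integ (fun x => - f x).
Proof. by move=> fi; apply: (integrableN fi). Qed.

Lemma integ_sub f g : integ f -> integ g -> integ (fun x => f x - g x).
Proof. by move=> fi gi; apply: (integ_add fi (integ_opp gi)). Qed.

Lemma integ0 : integ (fun=> 0).
Proof. exact: (@integrable0 _ _ R mu setT). Qed.

Lemma integ_eq f g : f =1 g -> integ f -> integ g.
Proof. by move=> /funext ->. Qed.

Lemma Int_eq f g : f =1 g -> Int f = Int g.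
Proof. by move=> /funext ->. Qed.

Lemma Int_add f g : integ f -> integ g ->
  Int (fun x => f x + g x) = Int f + Int g.
Proof. by move=> fi gi; rewrite RintegralD. Qed.

Lemma Int_sub f g : integ f -> integ g ->
  Int (fun x => f x - g x) = Int f - Int g.
Proof. by move=> fi gi; rewrite RintegralB. Qed.

Lemma Int_scale k f : integ f -> Int (fun x => k * f x) = k * Int f.
Proof. by move=> fi; rewrite RintegralZl. Qed.

Lemma Int_opp f : integ f -> Int (fun x => - f x) = - Int f.
Proof.
by move=> fi; rewrite -mulN1r -Int_scale//; apply: Int_eq => x; rewrite mulN1r.
Qed.

Lemma Int0 : Int (fun _ : R => 0 : R) = 0.
Proof. by rewrite Rintegral_cst// mul0r. Qed.

Lemma Int_ge0 f : (forall x, 0 <= f x) -> 0 <= Int f.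
Proof. by move=> f0; apply: Rintegral_ge0. Qed.

Lemma Int_le f g : integ f -> integ g -> (forall x, f x <= g x) ->
  Int f <= Int g.
Proof. by move=> fi gi fg; apply: le_Rintegral. Qed.

Lemma Int_norm f : integ f -> `|Int f| <= Int (fun x => `|f x|).
Proof. by move=> fi; apply: le_normr_Rintegral. Qed.

Lemma Int_norm_le f g : measurable_fun setT f -> integ g ->
  (forall x, `|f x| <= g x) -> `|Int f| <= Int g.
Proof.
move=> mf gi fg; have fi := integ_le mf gi fg.
by apply: le_trans (Int_norm fi) _; apply: Int_le => //; exact: integ_abs.
Qed.

Lemma Int_ae f g : measurable_fun setT f -> measurable_fun setT g ->
  {ae mu, forall x, f x = g x} -> Int f = Int g.
Proof.
move=> mf mg fg; congr fine; apply: ae_eq_integral => //; try exact/measurable_EFinP.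
by apply: aeS fg => x /= -> _.
Qed.

Lemma integ_ae_le f g : measurable_fun setT f -> integ g ->
  {ae mu, forall x, `|f x| <= g x} -> integ f.
Proof.
move=> mf ig fg; have mg := integ_meas ig.
have [_ gi] := integrableP _ _ _ ig.
apply/integrableP; split; first exact/measurable_EFinP.
apply: le_lt_trans gi; apply: ae_ge0_le_integral => //.
- by apply/measurableT_comp => //; exact/measurable_EFinP.
- by apply/measurableT_comp => //; exact/measurable_EFinP.
by apply: aeS fg => x /= h _; rewrite lee_fin (le_trans h)// ler_norm.
Qed.

Lemma integ_ae f g : integ f -> measurable_fun setT g ->
  {ae mu, forall x, f x = g x} -> integ g.
Proof.
move=> fi mg fg; apply: (integ_ae_le mg (integ_abs fi)).
by apply: aeS fg => x ->.
Qed.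

Lemma Int_dct_ae (F : nat -> R -> R) f g :
  (forall n, measurable_fun setT (F n)) -> measurable_fun setT f -> integ g ->
  {ae mu, forall x, forall n, `|F n x| <= g x} ->
  {ae mu, forall x, F n x @[n --> \oo] --> f x} ->
  integ f /\ Int (F n) @[n --> \oo] --> Int f.
Proof.
move=> mF mf ig Fg Ff.
have [||||| fi _ cv] := @dominated_convergence _ _ R mu setT measurableT
    (fun n x => (F n x)%:E) (fun x => (f x)%:E) (fun x => (g x)%:E).
- by move=> n; apply: (measurable_EFinP setT (F n)).2.
- exact: (measurable_EFinP setT f).2.
- by apply: aeS Ff => x h _; apply/cvg_EFin => //; exact: nearW.
- exact: ig.
- by apply: aeS Fg => x h n _ /=; rewrite lee_fin.
split => //; apply: (@fine_cvg _ _ _ _ _ (Int f)).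
rewrite /Rintegral fineK//; exact: (integrable_fin_num measurableT fi).
Qed.

Lemma Int_dct (F : nat -> R -> R) f g :
  (forall n, measurable_fun setT (F n)) -> integ g ->
  (forall x n, `|F n x| <= g x) ->
  (forall x, F n x @[n --> \oo] --> f x) ->
  [/\ measurable_fun setT f, integ f & Int (F n) @[n --> \oo] --> Int f].
Proof.
move=> mF ig Fg Ff.
have mf : measurable_fun setT f by apply: measurable_fun_cvg mF _ => x _; exact: Ff.
by have [fi cv] := Int_dct_ae mF mf ig (aeT Fg) (aeT Ff).
Qed.

(** Dominated convergence with moving majorants [G n] whose integrals converge. The positive part
    [D n] of [g - (G n - F n)] stays below the fixed [g] and tends to 0, and [Int (F n)] is at most
    [Int (G n) - Int g + Int (D n)]. *)
Lemma Int_fdct (F G : nat -> R -> R) g :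
  (forall n, integ (F n)) -> (forall n, integ (G n)) -> integ g ->
  (forall n x, 0 <= F n x <= G n x) -> (forall x, 0 <= g x) ->
  {ae mu, forall x, F n x @[n --> \oo] --> 0} ->
  {ae mu, forall x, G n x @[n --> \oo] --> g x} ->
  Int (G n) @[n --> \oo] --> Int g ->
  Int (F n) @[n --> \oo] --> 0.
Proof.
move=> iF iG ig FG g0 F0 Gg IG.
pose D n x := Num.max (g x - (G n x - F n x)) 0.
have iH n : integ (fun x => g x - (G n x - F n x)).
  by apply: integ_sub => //; apply: integ_sub.
have mD n : measurable_fun setT (D n).
  by apply: measurable_maxr => //; exact: integ_meas.
have Dg n x : `|D n x| <= g x.
  rewrite ger0_norm; last by rewrite le_max lexx orbT.
  by rewrite ge_max g0 andbT; have := FG n x; lra.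
have iD n : integ (D n) by exact: (integ_le _ ig (Dg n)).
have [_ ID] := @Int_dct_ae D (fun=> 0) g mD (measurable_cst _) ig
  (aeT (fun x n => Dg n x)) ltac:(apply: aeS2 F0 Gg => x h1 h2;
   rewrite (_ : 0 = Num.max (g x - (g x - 0)) 0 :> R);
   [apply: (@cvg_comp _ _ _ (fun n => g x - (G n x - F n x)) (fun y => Num.max y 0) _ (nbhs (g x - (g x - 0))));
     [apply: cvgB; [exact: cvg_cst|exact: cvgB]|
      apply: (@continuous_max _ _ id (cst 0)); [exact: cvg_id|exact: cvg_cst]]
   | by rewrite subr0 subrr maxxx]).
have ub n : 0 <= Int (F n) <= Int (G n) - Int g + Int (D n).
  apply/andP; split; first by apply: Int_ge0 => x; have /andP[] := FG n x.
  rewrite -Int_sub// -Int_add//; last exact: integ_sub.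
  apply: Int_le => //; first by apply: integ_add => //; exact: integ_sub.
  move=> x; have : g x - (G n x - F n x) <= D n x by rewrite /D le_max lexx.
  by lra.
apply: (@squeeze_cvgr _ _ _ _ (cst 0) (fun n => Int (G n) - Int g + Int (D n))).
- by apply: nearW.
- exact: cvg_cst.
- rewrite (_ : 0 = Int g - Int g + Int (fun=> 0) :> R).
    by apply: cvgD => //; apply: cvgB => //; exact: cvg_cst.
  by rewrite subrr Int0 addr0.
Qed.

(** Monotone convergence with a real-valued result: the extended limit [E] has integral at most [M],
    so it is finite almost everywhere, and [fine \o E] is a majorant off a null set. *)
Lemma Int_mono_bound (F : nat -> R -> R) (M : R) :
  (forall n, integ (F n)) -> (forall n x, 0 <= F n x) ->
  (forall n x, F n x <= F n.+1 x) -> (forall n, Int (F n) <= M) ->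
  exists g, [/\ integ g, forall x, 0 <= g x, Int g <= M &
    {ae mu, forall x, forall n, F n x <= g x}].
Proof.
move=> iF F0 nd FM.
have ndn x : nondecreasing_seq (fun n => (F n x)%:E).
  by apply/nondecreasing_seqP => n; rewrite lee_fin.
pose E x := limn (fun n => (F n x)%:E).
have E0 x : (0 <= E x)%E.
  apply: lime_ge; first exact: ereal_nondecreasing_is_cvgn.
  by apply: nearW => n; rewrite lee_fin.
have mEF n : measurable_fun setT (fun x => (F n x)%:E).
  by apply/measurable_EFinP; exact: integ_meas.
have mE : measurable_fun setT E.
  apply: (emeasurable_fun_cvg (fun n x => (F n x)%:E) E mEF) => x _.
  exact: ereal_nondecreasing_is_cvgn.
have IE : (\int[mu]_x E x <= M%:E)%E.
  rewrite monotone_convergence//; last by move=> n x _; rewrite lee_fin.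
  apply: lime_le.
    apply: ereal_nondecreasing_is_cvgn => m n mn.
    apply: ge0_le_integral => //; try by move=> x _; rewrite lee_fin.
    - exact: mEF.
    - exact: mEF.
    - by move=> x _; exact: ndn.
  apply: nearW => n; have := FM n; rewrite /Rintegral -lee_fin fineK//.
  exact: (integrable_fin_num measurableT (iF n)).
have iE : mu.-integrable setT E.
  apply/integrableP; split => //; apply: le_lt_trans (ltry M).
  by under eq_integral do rewrite gee0_abs//.
have Efin := integrable_ae measurableT iE.
have gE : {ae mu, forall x, (fine (E x))%:E = E x}.
  by apply: aeS Efin => x /(_ I) /fineK.
have mg : measurable_fun setT (fine \o E) by apply: measurableT_comp.
have Ig : (\int[mu]_x (fine (E x))%:E = \int[mu]_x E x)%E.
  apply: ae_eq_integral => //; first exact/measurable_EFinP.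
  by apply: aeS gE => x + _.
exists (fine \o E); split.
- apply/integrableP; split; first exact/measurable_EFinP.
  rewrite (_ : (\int[mu]_x _)%E = \int[mu]_x E x)%E; last first.
    rewrite -Ig; apply: eq_integral => x _ /=; congr EFin.
    by rewrite ger0_norm// fine_ge0.
  exact: le_lt_trans IE (ltry M).
- by move=> x /=; exact: fine_ge0.
- rewrite /Rintegral Ig -lee_fin fineK//.
  exact: (integrable_fin_num measurableT iE).
- apply: aeS gE => x h n; rewrite -lee_fin /= h.
  apply: lime_ge; first exact: ereal_nondecreasing_is_cvgn.
  by near=> m; apply: ndn; near: m; exact: nbhs_infty_ge.
Unshelve. all: by end_near. Qed.

(** * Square integrable functions *)

Notation n2 f := (Int (fun x => f x ^+ 2)).

Lemma L2_mul f g : L2 f -> L2 g -> integ (fun x => f x * g x).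
Proof.
move=> [mf fi] [mg gi]; apply: (integ_le _ (integ_add fi gi)).
  exact: measurable_funM.
by move=> x; rewrite normrM -(real_normK (num_real (f x))) -(real_normK (num_real (g x))); nra.
Qed.

Lemma L2_abs f : L2 f -> L2 (fun x => `|f x|).
Proof.
move=> [mf fi]; split; first exact: measurableT_comp.
by apply: integ_eq fi => x; rewrite real_normK// num_real.
Qed.

Lemma L2_scale k f : L2 f -> L2 (fun x => k * f x).
Proof.
move=> [mf fi]; split; first exact: measurable_funM.
by apply: (integ_eq _ (integ_scale (k ^+ 2) fi)) => x; rewrite exprMn.
Qed.

Lemma L2_add f g : L2 f -> L2 g -> L2 (fun x => f x + g x).
Proof.
move=> fi gi; split; first by apply: measurable_funD; [case: fi|case: gi].
apply: (integ_eq _ (integ_add (integ_add fi.2 gi.2) (integ_scale 2 (L2_mul fi gi)))).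
by move=> x /=; ring.
Qed.

Lemma L2_opp f : L2 f -> L2 (fun x => - f x).
Proof.
move=> /(L2_scale (-1)) h; rewrite (_ : (fun x => _) = (fun x => -1 * f x))//.
by apply/funext => x; rewrite mulN1r.
Qed.

Lemma L2_sub f g : L2 f -> L2 g -> L2 (fun x => f x - g x).
Proof. by move=> fi gi; apply: (L2_add fi (L2_opp gi)). Qed.

Lemma L2_le f g : measurable_fun setT f -> L2 g ->
  (forall x, `|f x| <= `|g x|) -> L2 f.
Proof.
move=> mf gi fg; split => //; apply: (integ_le _ gi.2); first exact: measurable_funX.
by move=> x; rewrite normrX -(real_normK (num_real (g x))) lerXn2r// nnegrE.
Qed.

Lemma L2_ae f g : L2 f -> measurable_fun setT g ->
  {ae mu, forall x, f x = g x} -> L2 g.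
Proof.
move=> fi mg fg; split => //; apply: (integ_ae fi.2); first exact: measurable_funX.
by apply: aeS fg => x ->.
Qed.

Lemma n2_ge0 f : 0 <= n2 f.
Proof. by apply: Int_ge0 => x; exact: sqr_ge0. Qed.

Lemma n2_add f g : L2 f -> L2 g ->
  n2 (fun x => f x + g x) = n2 f + n2 g + 2 * Int (fun x => f x * g x).
Proof.
move=> fi gi; have fg := L2_mul fi gi.
rewrite -Int_scale// -Int_add//; [|exact: fi.2|exact: gi.2].
rewrite -Int_add//; [|by apply: integ_add; [exact: fi.2|exact: gi.2]|exact: integ_scale].
by apply: Int_eq => x; ring.
Qed.

Lemma n2_scale k f : L2 f -> n2 (fun x => k * f x) = k ^+ 2 * n2 f.
Proof.
by move=> fi; rewrite -Int_scale ?(fi.2)//; apply: Int_eq => x; rewrite exprMn.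
Qed.

Lemma n2_sub f g : L2 f -> L2 g ->
  n2 (fun x => f x - g x) = n2 f + n2 g - 2 * Int (fun x => f x * g x).
Proof.
move=> fi gi; have fg := L2_mul fi gi.
rewrite -Int_scale// -Int_add//; [|exact: fi.2|exact: gi.2].
rewrite -Int_sub//; [|by apply: integ_add; [exact: fi.2|exact: gi.2]|exact: integ_scale].
by apply: Int_eq => x; ring.
Qed.

Lemma n2_subC f g : n2 (fun x => f x - g x) = n2 (fun x => g x - f x).
Proof. by apply: Int_eq => x; ring. Qed.

Lemma n2_tri f g : L2 f -> L2 g ->
  n2 (fun x => f x + g x) <= 2 * n2 f + 2 * n2 g.
Proof.
move=> fi gi; rewrite -!Int_scale; [|exact: gi.2|exact: fi.2].
rewrite -Int_add; [|exact/integ_scale/fi.2|exact/integ_scale/gi.2].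
apply: Int_le; first exact: (L2_add fi gi).2.
  by apply: integ_add; [exact/integ_scale/fi.2|exact/integ_scale/gi.2].
by move=> x; have := sqr_ge0 (f x - g x); rewrite !expr2; nra.
Qed.

Lemma Cauchy_Schwarz f g : L2 f -> L2 g ->
  (Int (fun x => f x * g x)) ^+ 2 <= n2 f * n2 g.
Proof.
move=> fi gi; set B := Int _; set A := n2 f; set C := n2 g.
have key t : 0 <= t ^+ 2 * A + C + 2 * (t * B).
  have := n2_ge0 (fun x => t * f x + g x).
  rewrite n2_add//; last exact: L2_scale.
  rewrite n2_scale// -/A -/C (_ : Int _ = t * B)//.
  by rewrite -Int_scale ?L2_mul//; apply: Int_eq => x; rewrite mulrA.
have A0 : 0 <= A := n2_ge0 f.
have [A1|A1] := eqVneq A 0.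
  have [->|B0] := eqVneq B 0; first by rewrite expr0n/= mulr_ge0// n2_ge0.
  (* With [A = 0] the form is affine in [t], and this [t] would give it the value -1. *)
  have := key (- (C + 1) / (2 * B)); rewrite A1 mulr0 add0r.
  rewrite (_ : 2 * _ = - (C + 1)); last by field.
  by lra.
have {}A1 : 0 < A by rewrite lt_neqAle eq_sym A1.
have := key (- B / A).
rewrite (_ : _ + _ = (A * C - B ^+ 2) / A); last by field; rewrite gt_eqF.
by rewrite pmulr_lge0 ?invr_gt0// subr_ge0.
Qed.

Lemma L2_cvg0_pair (F : nat -> R -> R) f g : L2 g -> L2 f -> (forall n, L2 (F n)) ->
  n2 (fun x => F n x - f x) @[n --> \oo] --> 0 ->
  Int (fun x => F n x * g x) @[n --> \oo] --> Int (fun x => f x * g x).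
Proof.
move=> gi fi Fi F0; apply/cvgrPdist_lt => e e0.
have G0 : 0 <= n2 g := n2_ge0 g.
have d0 : 0 < e ^+ 2 / (n2 g + 1) by rewrite divr_gt0 ?exprn_gt0// ltr_wpDl.
move/cvgrPdist_lt: F0 => /(_ _ d0); apply: filterS => n.
rewrite sub0r normrN ger0_norm ?n2_ge0// => h.
rewrite distrC -Int_sub; [|exact: L2_mul|exact: L2_mul].
rewrite -(ltr_pXn2r (_ : 0 < 2)%N) ?nnegrE// ?(ltW e0)//.
rewrite real_normK ?num_real//.
rewrite (@Int_eq _ (fun x => (F n x - f x) * g x)); last by move=> x; rewrite mulrBl.
apply: le_lt_trans (Cauchy_Schwarz (L2_sub (Fi n) fi) gi) _.
move: h; rewrite ltr_pdivlMr ?ltr_wpDl//; have := n2_ge0 (fun x => F n x - f x).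
by nra.
Qed.

Lemma L2_cvg_norm (F : nat -> R -> R) f : L2 f -> (forall n, L2 (F n)) ->
  n2 (fun x => F n x - f x) @[n --> \oo] --> 0 ->
  n2 (F n) @[n --> \oo] --> n2 f.
Proof.
move=> fi Fi F0.
have h n : n2 (F n) = n2 (fun x => F n x - f x) + 2 * Int (fun x => F n x * f x) - n2 f.
  by rewrite n2_sub//; ring.
rewrite (_ : (fun n => n2 (F n)) = (fun n => n2 (fun x => F n x - f x) +
  2 * Int (fun x => F n x * f x) - n2 f)); last exact/funext.
rewrite [X in _ --> X](_ : _ = 0 + 2 * Int (fun x => f x * f x) - n2 f); last first.
  by rewrite (@Int_eq (fun x => f x * f x) (fun x => f x ^+ 2))//; ring.
apply: cvgB; last exact: cvg_cst.
apply: cvgD => //; apply: cvgMl_tmp; exact: L2_cvg0_pair.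
Qed.

(** * Parameter integrals and Fubini *)

Lemma measurable_Int F : meas2 F -> measurable_fun setT (fun x => Int (F x)).
Proof.
move=> mF; apply: measurableT_comp => //.
pose f (p : R * R) := (F p.1 p.2)%:E.
have mf : measurable_fun setT f by apply/measurable_EFinP.
rewrite (_ : (fun x => _) = (fun x => \int[mu]_y (f^\+ (x, y)) - \int[mu]_y (f^\- (x, y))))%E.
  apply: emeasurable_funB.
    apply: (measurable_fun_fubini_tonelli_F (m2 := mu) (f^\+)%E) => //.
    exact: measurable_funepos.
  apply: (measurable_fun_fubini_tonelli_F (m2 := mu) (f^\-)%E) => //.
  exact: measurable_funeneg.
apply/funext => x; rewrite integralE; congr (_ - _)%E; apply: eq_integral => y _;
  by rewrite /f ?funeposE ?funenegE.
Qed.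

(** Tonelli turns the iterated bound by [G] into integrability on the plane. Sections in the second
    variable are integrable only almost everywhere, and the real-valued integral has no meaning at
    the other points; [aei] shows that this does not affect the outer integral. *)
Lemma Int_fubini F (G : R -> R) : meas2 F -> (forall x, integ (F x)) -> integ G ->
  (forall x, Int (fun t => `|F x t|) <= G x) ->
  [/\ integ (fun x => Int (F x)),
      {ae mu, forall t, integ (F ^~ t)},
      integ (fun t => Int (F ^~ t)),
      integ (fun t => Int (fun x => `|F x t|)) &
      Int (fun x => Int (F x)) = Int (fun t => Int (F ^~ t))].
Proof.
move=> mF iF iG FG.
pose f (p : R * R) := (F p.1 p.2)%:E.
have mf : measurable_fun setT f by apply/measurable_EFinP.
have fi : (mu \x mu)%E.-integrable setT f.
  apply/(integrable12ltyP mu mu mf).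
  have [_ Gi] := integrableP _ _ _ iG.
  apply: le_lt_trans Gi; apply: ge0_le_integral => //.
  - by move=> x _; exact: integral_ge0.
  - apply: (measurable_fun_fubini_tonelli_F (m2 := mu) (abse \o f)) => //.
    + exact: measurableT_comp.
    + by move=> p; exact: abse_ge0.
  - by apply: measurableT_comp => //; exact: (measurable_int mu iG).
  - move=> x _; apply: (@le_trans _ _ (G x)%:E); last by rewrite lee_fin ler_norm.
    have := FG x; rewrite -lee_fin /Rintegral fineK//.
    exact: (integrable_fin_num measurableT (integ_abs (iF x))).
have fi' : (mu \x mu)%E.-integrable setT (abse \o f) by exact: integrable_abse.
have aei (h : R * R -> R) : (mu \x mu)%E.-integrable setT (EFin \o h) ->
   integ (fun t => Int (fun x => h (x, t))) /\
   (\int[mu]_t (Int (fun x => h (x, t)))%:E = \int[mu]_t \int[mu]_x (h (x, t))%:E)%E.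
  move=> ih.
  have ae2 : {ae mu, forall t, integ (fun x => h (x, t))} := ae_integrable2 ih.
  have mG : measurable_fun setT (fubini_G mu (EFin \o h)) := measurable_fubini_G ih.
  have i2 : mu.-integrable setT (fubini_G mu (EFin \o h)).
    apply/integrableP; split => //.
    apply: le_lt_trans ((integrable21ltyP mu mu (measurable_int _ ih)).1 ih).
    apply: ge0_le_integral => //.
    - exact: measurableT_comp.
    - apply: (measurable_fun_fubini_tonelli_G (m1 := mu) (abse \o (EFin \o h))) => //.
      + by apply: measurableT_comp => //; exact: (measurable_int _ ih).
      + by move=> p; exact: abse_ge0.
    - move=> t _; apply: le_abse_integral => //.
      exact: (measurableT_comp (measurable_int _ ih) (measurable_pair2 _)).
  have E : {ae mu, forall t, (\int[mu]_x (h (x, t))%:E = (Int (fun x => h (x, t)))%:E)%E}.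
    apply: aeS ae2 => t it; rewrite /Rintegral fineK//.
    exact: (integrable_fin_num measurableT it).
  have mI : measurable_fun setT (fun t => Int (fun x => h (x, t))).
    by apply: measurableT_comp => //; exact: mG.
  split; last first.
    apply: ae_eq_integral => //.
    - exact/measurable_EFinP.
    - by apply: aeS E => t -> _.
  apply/integrableP; split; first exact/measurable_EFinP.
  have [mi lt] := integrableP _ _ _ i2.
  rewrite (_ : (\int[mu]_x _)%E = \int[mu]_t `|fubini_G mu (EFin \o h) t|)%E//.
  apply: ae_eq_integral => //.
  - by apply: measurableT_comp => //; exact/measurable_EFinP.
  - by apply: measurableT_comp.
  - by apply: aeS E => t e _ /=; rewrite /fubini_G /= e.
have [a1 a2] := aei (fun p => F p.1 p.2) fi.
have [b1 _] := aei (fun p => `|F p.1 p.2|) fi'.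
have iIF : integ (fun x => Int (F x)).
  apply: integ_le iG _; first exact: measurable_Int.
  by move=> x; apply: le_trans (FG x); exact: Int_norm.
split; [exact: iIF|exact: (ae_integrable2 fi)|exact: a1|exact: b1|].
rewrite [in RHS]/Rintegral a2 -(@Fubini _ _ _ _ R mu mu f fi).
congr fine; apply: eq_integral => x _; rewrite /Rintegral fineK//.
exact: (integrable_fin_num measurableT (iF x)).
Qed.

Lemma meas2_mul F G : meas2 F -> meas2 G -> meas2 (fun x t => F x t * G x t).
Proof. exact: measurable_funM. Qed.

Lemma meas2_add F G : meas2 F -> meas2 G -> meas2 (fun x t => F x t + G x t).
Proof. exact: measurable_funD. Qed.

Lemma meas2_fst f : measurable_fun setT f -> meas2 (fun x _ => f x).
Proof. by move=> mf; apply: measurableT_comp. Qed.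

Lemma meas2_snd f : measurable_fun setT f -> meas2 (fun _ t => f t).
Proof. by move=> mf; apply: measurableT_comp. Qed.

Lemma meas2_comp f F : measurable_fun setT f -> meas2 F -> meas2 (fun x t => f (F x t)).
Proof. by move=> mf mF; apply: measurableT_comp. Qed.

Lemma meas2_swap F : meas2 F -> meas2 (fun x t => F t x).
Proof.
move=> mF; apply: (@measurableT_comp _ _ _ _ _ _ (fun p => F p.1 p.2) _ (fun p => (p.2, p.1))) => //.
exact: measurable_fun_pair.
Qed.

Lemma meas2_diff : meas2 (fun x t => x - t).
Proof. exact: measurable_funB. Qed.

(** * Completeness of L^2 *)

Lemma cvg_halves : (2^-1 : R) ^+ n @[n --> \oo] --> 0.
Proof. by apply: cvg_expr; rewrite ger0_norm; lra. Qed.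

(** [b n + 2 w 2^-n] decreases and [b n - 2 w 2^-n] increases; both have the limit of [b], which
    therefore lies between them. *)
Lemma geometric_cauchy_cvg (b : nat -> R) (w : R) : 0 <= w ->
  (forall n, `|b n.+1 - b n| <= w * 2^-1 ^+ n) ->
  cvgn b /\ forall n, `|b n - limn b| <= 2 * w * 2^-1 ^+ n.
Proof.
move=> w0 hb.
have e0 n : 0 <= (2^-1 : R) ^+ n by rewrite exprn_ge0// invr_ge0.
have hd n := hb n; pose c n := b n + 2 * w * 2^-1 ^+ n.
pose c' n := b n - 2 * w * 2^-1 ^+ n.
have nc : nonincreasing_seq c.
  apply/nonincreasing_seqP => n; rewrite /c exprS.
  by have := hb n; rewrite ler_norml => /andP[]; lra.
have nc' : nondecreasing_seq c'.
  apply/nondecreasing_seqP => n; rewrite /c' exprS.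
  by have := hb n; rewrite ler_norml => /andP[]; lra.
have c'c n : c' n <= c n by rewrite /c /c'; have := mulr_ge0 w0 (e0 n); lra.
have cc : cvgn c.
  apply: nonincreasing_is_cvgn => //; exists (c' 0%N) => _ [n _ <-].
  by apply: le_trans (c'c n); exact: nc'.
have z : 2 * w * 2^-1 ^+ n @[n --> \oo] --> 0.
  by rewrite -[X in _ --> X](mulr0 (2 * w)); apply: cvgMl_tmp; exact: cvg_halves.
have bc : b @ \oo --> limn c.
  rewrite -[X in _ --> X]subr0 (_ : b = fun n => c n - 2 * w * 2^-1 ^+ n).
    exact: cvgB.
  by apply/funext => n; rewrite /c; ring.
have c'l : c' @ \oo --> limn c.
  by rewrite -[X in _ --> X]subr0; apply: cvgB.
split; first by apply/cvg_ex; exists (limn c).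
move=> n; rewrite (cvg_lim _ bc)//.
have h1 : limn c <= c n := nonincreasing_cvgn_ge nc cc n.
have h2 : c' n <= limn c.
  rewrite -(cvg_lim _ c'l)//; apply: nondecreasing_cvgn_le => //.
  by apply/cvg_ex; exists (limn c).
by move: h1 h2; rewrite /c /c' ler_norml => h1 h2; apply/andP; split; lra.
Qed.

(** Riesz-Fischer: a fast subsequence [b] converges almost everywhere at a geometric rate governed
    by an integrable function [V], and the whole sequence follows by the Cauchy property. *)
Lemma L2_complete (a : nat -> R -> R) : (forall n, L2 (a n)) ->
  (forall e, 0 < e -> exists N, forall n m, (N <= n)%N -> (N <= m)%N ->
     n2 (fun x => a n x - a m x) <= e) ->
  exists2 g, L2 g & n2 (fun x => a n x - g x) @[n --> \oo] --> 0.
Proof.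
move=> La Ca.
(* The rate 1/16 leaves room for the weight [4 ^+ j] in [F]: the terms [4 ^+ j * n2 (d j)] still
   have a bounded sum, and pointwise [d j x ^+ 2] is at most [4^-j V x], so the increments are
   bounded by [w * 2^-j] with [w] the root of [V x]. *)
have e0 j : 0 < (16^-1 : R) ^+ j by rewrite exprn_gt0// invr_gt0.
have /choice[N hN] j := Ca _ (e0 j).
pose k := fix k j := if j is i.+1 then maxn (N i.+1) (k i).+1 else N 0%N.
have kN j : (N j <= k j)%N by case: j => //= j; rewrite leq_maxl.
have kS j : (k j < k j.+1)%N by rewrite /= leq_maxr.
have kj j : (j <= k j)%N by elim: j => // j ih; exact: leq_ltn_trans ih (kS j).
pose b j := a (k j); pose d j x := b j.+1 x - b j x.
have Ld j : L2 (d j) by apply: L2_sub; exact: La.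
have nd j : n2 (d j) <= 16^-1 ^+ j.
  by apply: hN; [apply: leq_trans (kN j) (ltnW (kS j))|exact: kN].
pose F n x := \sum_(j < n) 4 ^+ j * d j x ^+ 2.
have p4 j : 0 <= (4 : R) ^+ j by rewrite exprn_ge0.
have FS n x : F n.+1 x = F n x + 4 ^+ n * d n x ^+ 2 by rewrite /F big_ord_recr.
have F0 n x : 0 <= F n x by apply: sumr_ge0 => j _; rewrite mulr_ge0// sqr_ge0.
have iF n : integ (F n).
  elim: n => [|n ih]; first by apply: integ_eq integ0 => x; rewrite /F big_ord0.
  apply: integ_eq (integ_add ih (integ_scale (4 ^+ n) (Ld n).2)) => x.
  by rewrite FS.
have IF n : Int (F n) <= 2 - 2 * 4^-1 ^+ n.
  elim: n => [|n ih].
    rewrite expr0 mulr1 subrr (@Int_eq _ (fun=> 0)) ?Int0// => x.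
    by rewrite /F big_ord0.
  rewrite (@Int_eq _ (fun x => F n x + 4 ^+ n * d n x ^+ 2)); last exact: FS.
  rewrite Int_add//; last exact/integ_scale/(Ld n).2.
  rewrite Int_scale; last exact: (Ld n).2.
  have : 4 ^+ n * n2 (d n) <= 4 ^+ n * 16^-1 ^+ n by rewrite ler_wpM2l.
  rewrite -exprMn (_ : 4 * 16^-1 = 4^-1 :> R); last by field.
  have : 0 <= (4^-1 : R) ^+ n by rewrite exprn_ge0// invr_ge0.
  by rewrite exprS; lra.
have ndF n x : F n x <= F n.+1 x by rewrite FS lerDl mulr_ge0// sqr_ge0.
have IF2 n : Int (F n) <= 2.
  have : 0 <= (4^-1 : R) ^+ n by rewrite exprn_ge0// invr_ge0.
  by have := IF n; lra.
have [V [iV V0 _ FV]] := Int_mono_bound iF F0 ndF IF2.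
(* The upper limit is measurable whether or not the sequence converges, and it is the limit where it
   does. *)
pose g x := fine (limn_esup (fun n => (b n x)%:E)).
have mg : measurable_fun setT g.
  apply: measurableT_comp => //; apply: measurable_fun_limn_esup => n.
  by apply/measurable_EFinP; exact: (La _).1.
have bg : {ae mu, forall x, forall n, (b n x - g x) ^+ 2 <= 4 * 4^-1 ^+ n * V x}.
  apply: aeS FV => x FV.
  pose w := Num.sqrt (V x).
  have w0 : 0 <= w by exact: sqrtr_ge0.
  have bw n : `|b n.+1 x - b n x| <= w * 2^-1 ^+ n.
    rewrite -(ler_pXn2r (_ : 0 < 2)%N) ?nnegrE// ?mulr_ge0 ?exprn_ge0 ?invr_ge0//.
    rewrite real_normK ?num_real// exprMn sqr_sqrtr//.
    rewrite -exprM mulnC exprM (_ : 2^-1 ^+ 2 = 4^-1 :> R); last by field.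
    rewrite exprVn ler_pdivlMr ?exprn_gt0// mulrC.
    apply: le_trans (FV n.+1); rewrite FS lerDr; exact: F0.
  have [cb hb] := geometric_cauchy_cvg w0 bw.
  have gx : g x = limn (b ^~ x).
    have bE : (fun n => (b n x)%:E) @ \oo --> (limn (b ^~ x))%:E.
      by apply/cvg_EFin => //; exact: nearW.
    rewrite /g is_cvg_limn_esupE; last by apply/cvg_ex; exists (limn (b ^~ x))%:E.
    by rewrite (cvg_lim _ bE).
  move=> n; have := hb n; rewrite -gx => h.
  rewrite -(real_normK (num_real _)).
  apply: (@le_trans _ _ ((2 * w * 2^-1 ^+ n) ^+ 2)).
    by rewrite lerXn2r// nnegrE// ?mulr_ge0 ?exprn_ge0 ?invr_ge0.
  rewrite !exprMn sqr_sqrtr// -exprM mulnC exprM (_ : 2^-1 ^+ 2 = 4^-1 :> R); last by field.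
  by rewrite (_ : 2 ^+ 2 = 4); [rewrite mulrAC|ring].
have Lbg n : L2 (fun x => b n x - g x).
  have m : measurable_fun setT (fun x => b n x - g x).
    by apply: measurable_funB => //; exact: (La _).1.
  split => //; apply: (integ_ae_le _ (integ_scale (4 * 4^-1 ^+ n) iV)).
    exact: measurable_funX.
  by apply: aeS bg => x h; rewrite ger0_norm ?sqr_ge0.
have Lg : L2 g.
  apply: (L2_ae (L2_sub (La (k 0%N)) (Lbg 0%N))) => //.
  by apply: aeT => x; rewrite /b; ring.
exists g => //.
have nb n : n2 (fun x => b n x - g x) <= 4 * Int V * 4^-1 ^+ n.
  have -> : 4 * Int V * 4^-1 ^+ n = Int (fun x => 4 * 4^-1 ^+ n * V x).
    by rewrite Int_scale//; ring.
  rewrite /Rintegral; apply: fine_le.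
  - exact: (integrable_fin_num measurableT (Lbg n).2).
  - exact: (integrable_fin_num measurableT (integ_scale _ iV)).
  - apply: ae_ge0_le_integral => //.
    + by move=> x _; rewrite lee_fin sqr_ge0.
    + exact: (measurable_int mu (Lbg n).2).
    + by move=> x _; rewrite lee_fin !mulr_ge0// exprn_ge0// invr_ge0.
    + exact: (measurable_int mu (integ_scale _ iV)).
    + by apply: aeS bg => x h _; rewrite lee_fin.
have nb0 : 4 * Int V * 4^-1 ^+ n @[n --> \oo] --> 0.
  rewrite -[X in _ --> X](mulr0 (4 * Int V)); apply: cvgMl_tmp.
  by apply: cvg_expr; rewrite ger0_norm; lra.
apply/cvgrPdist_le => e e1.
have e4 : 0 < e / 4 by rewrite divr_gt0.
have [M hM] := Ca _ e4.
move/cvgrPdist_le: nb0 => /(_ _ e4) [j0 _ hj0].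
near=> n.
rewrite sub0r normrN ger0_norm ?n2_ge0//.
pose j := maxn M j0.
rewrite (@Int_eq _ (fun x => ((a n x - b j x) + (b j x - g x)) ^+ 2)); last first.
  by move=> x; congr (_ ^+ 2); ring.
apply: le_trans (n2_tri (L2_sub (La n) (La (k j))) (Lbg j)) _.
have h1 : n2 (fun x => a n x - a (k j) x) <= e / 4.
  apply: hM; first by near: n; exact: nbhs_infty_ge.
  by apply: leq_trans (kj j); rewrite leq_maxl.
have := hj0 j (leq_maxr _ _); rewrite sub0r normrN => /(le_trans (ler_norm _)) h2.
have arith (A B C : R) : A <= e / 4 -> B <= C -> C <= e / 4 -> 2 * A + 2 * B <= e.
  by clear; lra.
exact: arith h1 (nb j) h2.
Unshelve. all: by end_near. Qed.

End Integral.

(** * The Poisson kernel and its conjugate *)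

Notation n2 f := (Int (fun x => f x ^+ 2)).

Section Kernels.
Context {R : realType}.
Local Notation mu := (@lebesgue_measure R).
Implicit Types (f g h : R -> R) (F G : R -> R -> R) (x y t a s u : R).

Lemma indicE1 (A : set R) x : A x -> \1_A x = 1 :> R.
Proof. by move=> Ax; rewrite indicE mem_set. Qed.

Lemma indicE0 (A : set R) x : ~ A x -> \1_A x = 0 :> R.
Proof. by move=> Ax; rewrite indicE memNset. Qed.

Lemma indic_ge0 (A : set R) x : 0 <= \1_A x :> R.
Proof. by rewrite indicE. Qed.

Lemma indic_le1 (A : set R) x : \1_A x <= 1 :> R.
Proof. by rewrite indicE; case: (_ \in _). Qed.

Lemma norm_indicM (A : set R) x (y : R) : `|\1_A x * y| <= `|y|.
Proof.
by rewrite normrM ler_piMl// ger0_norm ?indic_ge0// indic_le1.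
Qed.

Lemma Int_on (A : set R) f : Rintegral mu A f = Int (fun x => \1_A x * f x).
Proof.
rewrite Rintegral_mkcond; apply: Int_eq => x; rewrite patchE indicE.
by case: (_ \in _); rewrite ?mul1r ?mul0r.
Qed.

Lemma integ_on (A : set R) f : measurable A -> integ f -> integ (fun x => \1_A x * f x).
Proof.
move=> mA fi; apply: (integ_le _ (integ_abs fi)) => [|x]; last exact: norm_indicM.
by apply: measurable_funM (integ_meas fi); exact: measurable_indic.
Qed.

Lemma L2_on (A : set R) f : measurable A -> L2 f -> L2 (fun x => \1_A x * f x).
Proof.
move=> mA fi; apply: (L2_le _ fi) => [|x]; last exact: norm_indicM.
by apply: measurable_funM fi.1; exact: measurable_indic.
Qed.

(** * Derivatives of the primitives and the fundamental theorem on the line *)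

Lemma is_derive_comp1 f g (x df dg : R) : is_derive x 1 g dg -> is_derive (g x) 1 f df ->
  is_derive x 1 (fun y => f (g y)) (dg * df).
Proof.
move=> [dg1 dg2] [df1 df2].
have g1 : differentiable g x := (derivable1_diffP g x).1 dg1.
have f1 : differentiable f (g x) := (derivable1_diffP f (g x)).1 df1.
have D : derivable (f \o g) x 1.
  by apply: diff_derivable; exact: differentiable_comp g1 f1.
apply: DeriveDef; first exact: D.
have E := derive1_comp dg1 df1.
rewrite [LHS](_ : _ = derive1 (f \o g) x); last by rewrite derive1E.
by rewrite E derive1E df2 derive1E dg2 mulrC.
Qed.

Lemma is_derive_continuous f (x df : R) : is_derive x 1 f df -> {for x, continuous f}.
Proof. by move=> [d _]; apply: differentiable_continuous; exact/derivable1_diffP. Qed.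

Lemma is_derive_lin f g (x k l df dg : R) : is_derive x 1 f df -> is_derive x 1 g dg ->
  is_derive x 1 (fun u => k * f u + l * g u) (k * df + l * dg).
Proof.
by move=> hf hg; exact: (is_deriveD (is_deriveZ k hf) (is_deriveZ l hg)).
Qed.

Lemma FTC_itv (phi Phi : R -> R) (a b : R) : a < b ->
  (forall x, {for x, continuous phi}) ->
  (forall x : R, is_derive x 1 Phi (phi x)) ->
  Int (fun x => \1_`[a, b] x * phi x) = Phi b - Phi a.
Proof.
move=> ab cphi dPhi; rewrite -Int_on /Rintegral (@continuous_FTC2 _ _ Phi)//.
- by apply: continuous_subspaceT => x; exact: cphi.
- have cPhi x := is_derive_continuous (dPhi x).
  split; last 2 first.
  + by apply: cvg_at_right_filter; exact: cPhi.
  + by apply: cvg_at_left_filter; exact: cPhi.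
  + by move=> x _; have [] := dPhi x.
- by move=> x _; rewrite derive1E; have [_ ->] := dPhi x.
Qed.

Lemma cvg_indic_itv (x : R) :
  \1_`[- n%:R, n%:R] x @[n --> \oo] --> (1 : R).
Proof.
apply: cvg_near_cst; near=> n.
rewrite indicE1//= in_itv/= -ler_norml.
by near: n; exact: nbhs_infty_ger.
Unshelve. all: by end_near. Qed.

Lemma Int_exhaust f : integ f ->
  Int (fun x => \1_`[- n%:R, n%:R] x * f x) @[n --> \oo] --> Int f.
Proof.
move=> fi.
have [] // := @Int_dct _ (fun n x => \1_`[- n%:R, n%:R] x * f x) f (fun x => `|f x|).
- by move=> n; apply: integ_meas; exact: integ_on.
- exact: integ_abs.
- by move=> x n; exact: norm_indicM.
- move=> x; rewrite -[X in _ --> X]mul1r; apply: cvgMr_tmp.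
  exact: cvg_indic_itv.
Qed.

Lemma FTC_R (phi Phi : R -> R) (l : R) : integ phi ->
  (forall x, {for x, continuous phi}) ->
  (forall x : R, is_derive x 1 Phi (phi x)) ->
  Phi n%:R - Phi (- n%:R) @[n --> \oo] --> l -> Int phi = l.
Proof.
move=> phi_i cphi dPhi lim.
apply: (cvg_unique (@Rhausdorff R) (Int_exhaust phi_i)).
apply: cvg_trans lim; apply: near_eq_cvg; near=> n.
rewrite (@FTC_itv _ Phi)// -subr_gt0 opprK addr_gt0//; near: n; exact: nbhs_infty_gtr.
Unshelve. all: by end_near. Qed.

Lemma den_gt0 (x y : R) : 0 < y -> 0 < x ^+ 2 + y ^+ 2.
Proof. by move=> y0; rewrite ltr_wpDl ?sqr_ge0// exprn_gt0. Qed.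

Lemma continuous_den (a y u : R) : {for u, continuous (fun u => (u - a) ^+ 2 + y ^+ 2)}.
Proof.
have h : {for u, continuous (fun u => u - a)} by apply: cvgB; [exact: cvg_id|exact: cvg_cst].
by apply: cvgD; [rewrite expr2; apply: cvgM|exact: cvg_cst].
Qed.

Lemma is_derive_atan_shift (a y u : R) : 0 < y ->
  is_derive u 1 (fun u => atan ((u - a) / y) / y) (((u - a) ^+ 2 + y ^+ 2)^-1).
Proof.
move=> y0; have D := den_gt0 (u - a) y0.
have h := @is_derive_comp1 (@atan R) (fun u => (u - a) / y) u _ y^-1 _ (is_derive1_atan _).
have h1 : is_derive u 1 (fun u => (u - a) / y) y^-1.
  rewrite (_ : (fun u => _) = y^-1 *: (id - cst a)); last first.
    by apply/funext => z /=; rewrite /GRing.scale /= mulrC.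
  by apply: is_derive_eq; rewrite subr0 /GRing.scale /= mulr1.
have h2 : is_derive u 1 (y^-1 *: (fun u => atan ((u - a) / y)))
   (y^-1 *: (y^-1 * (1 + ((u - a) / y) ^+ 2)^-1)).
  by apply: is_deriveZ; exact: h.
rewrite (_ : (fun u => _) = y^-1 *: (fun u => atan ((u - a) / y))); last first.
  by apply/funext => z /=; rewrite /GRing.scale /= mulrC.
apply: is_derive_eq; rewrite /GRing.scale /=; field.
by rewrite ?gt_eqF//= addrC gt_eqF// gt_eqF.
Qed.

Lemma is_derive_den (a y u : R) :
  is_derive u 1 (fun u => (u - a) ^+ 2 + y ^+ 2) (2 * (u - a)).
Proof.
rewrite (_ : (fun u => _) = (id - cst a) ^+ 2 + cst (y ^+ 2)); last by apply/funext.
by apply: is_derive_eq; rewrite /GRing.scale /= /cst/= subr0 addr0 expr1 mulr1 mulr_natl.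
Qed.

Lemma is_derive_ln_shift (a y u : R) : 0 < y ->
  is_derive u 1 (fun u => ln ((u - a) ^+ 2 + y ^+ 2)) (2 * (u - a) / ((u - a) ^+ 2 + y ^+ 2)).
Proof.
move=> y0; apply: (is_derive_comp1 (is_derive_den a y u)).
by apply: is_derive1_ln; exact: den_gt0.
Qed.

Lemma is_derive_inv_den (a y u : R) : 0 < y ->
  is_derive u 1 (fun u => ((u - a) ^+ 2 + y ^+ 2)^-1)
    (- (2 * (u - a)) / ((u - a) ^+ 2 + y ^+ 2) ^+ 2).
Proof.
move=> y0; have D := den_gt0 (u - a) y0.
have h := is_derive_den a y u.
have {}h := @is_deriveV R (fun u => (u - a) ^+ 2 + y ^+ 2) u _ _ (lt0r_neq0 D) h.
 apply: is_derive_eq; rewrite /GRing.scale /=; field; by rewrite gt_eqF.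
Qed.

Lemma cvg_natr_y : (n%:R : R) @[n --> \oo] --> +oo.
Proof. exact: cvgr_idn. Qed.

Lemma cvg_natr_inv (c : R) : c / n%:R @[n --> \oo] --> (0 : R).
Proof.
rewrite -[X in _ --> X](mulr0 c); apply: cvgMl_tmp.
by apply/gtr0_cvgV0; [near=> n; near: n; exact: nbhs_infty_gtr|exact: cvg_natr_y].
Unshelve. all: by end_near. Qed.

Lemma cvg_atan_y (u : nat -> R) : u @ \oo --> +oo -> atan (u n) @[n --> \oo] --> pi / 2.
Proof. by move=> h; apply: cvg_comp h (@cvgy_atan R). Qed.

Lemma cvg_atan_Ny (u : nat -> R) : u @ \oo --> -oo -> atan (u n) @[n --> \oo] --> - (pi / 2).
Proof.
move=> h; rewrite (_ : (fun n => _) = fun n => - atan (- u n)); last first.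
  by apply/funext => n; rewrite atanN opprK.
by apply: cvgN; apply: cvg_atan_y; apply/cvgNry.
Qed.

Lemma cvg_shift_y (a y : R) : 0 < y -> (n%:R - a) / y @[n --> \oo] --> +oo.
Proof.
move=> y0; apply/cvgryPge => A; near=> n.
rewrite ler_pdivlMr// lerBrDr; near: n; exact: nbhs_infty_ger.
Unshelve. all: by end_near. Qed.

Lemma cvg_shift_Ny (a y : R) : 0 < y -> (- n%:R - a) / y @[n --> \oo] --> -oo.
Proof.
move=> y0; rewrite (_ : (fun n => _) = fun n => - ((n%:R - (- a)) / y)); last first.
  by apply/funext => n; rewrite -mulNr; congr (_ / _); ring.
by apply/cvgNrNy; exact: cvg_shift_y.
Qed.

Lemma cvg_atan_shift (a y : R) : 0 < y ->
  atan ((n%:R - a) / y) / y - atan ((- n%:R - a) / y) / y @[n --> \oo] --> pi / y.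
Proof.
move=> y0; rewrite (_ : pi / y = pi / 2 / y - (- (pi / 2)) / y); last by field; rewrite gt_eqF.
apply: cvgB; apply: cvgMr_tmp.
  by apply: cvg_atan_y; exact: cvg_shift_y.
by apply: cvg_atan_Ny; exact: cvg_shift_Ny.
Qed.

Lemma cvg_eq_pos (v w : nat -> R) (l : R) : (forall n, 0 < n%:R :> R -> w n = v n) ->
  v @ \oo --> l -> w @ \oo --> l.
Proof.
move=> vw; apply: cvg_trans; apply: near_eq_cvg; near=> n; apply/esym/vw.
by near: n; exact: nbhs_infty_gtr.
Unshelve. all: by end_near. Qed.

Lemma cvg_mul_seq (v w : nat -> R) (k l : R) : v @ \oo --> k -> w @ \oo --> l ->
  (fun n => v n * w n) @ \oo --> k * l.
Proof. by move=> vk wl; exact: cvgM. Qed.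

Lemma cvg_inv_seq (v : nat -> R) (l : R) : l != 0 -> v @ \oo --> l ->
  (v n)^-1 @[n --> \oo] --> l^-1.
Proof. by move=> l0 vl; exact: cvgV. Qed.

Lemma cvg_ratio_shift (s a y : R) : s ^+ 2 = 1 ->
  ((s * n%:R - a) ^+ 2 + y ^+ 2) / n%:R ^+ 2 @[n --> \oo] --> (1 : R).
Proof.
move=> s1.
apply: (@cvg_trans _ ((fun n : nat => (s - a / n%:R) * (s - a / n%:R) + (y / n%:R) * (y / n%:R)) @ \oo)).
  apply: near_eq_cvg; near=> n; field.
  by rewrite gt_eqF//; near: n; exact: nbhs_infty_gtr.
have s2 : 1 = (s - 0) * (s - 0) + 0 * 0 by rewrite -s1; ring.
suff: (fun n : nat => (s - a / n%:R) * (s - a / n%:R) + y / n%:R * (y / n%:R)) @ \oo --> (s - 0) * (s - 0) + 0 * 0 by rewrite -s2.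
have h : s - a / n%:R @[n --> \oo] --> s - 0.
  by apply: cvgB; [exact: cvg_cst|exact: cvg_natr_inv].
apply: cvgD.
  exact: cvgM.
by apply: cvgM; exact: cvg_natr_inv.
Unshelve. all: by end_near. Qed.

(** Divided by [n ^+ 2], both arguments tend to 1, and the difference of logarithms is unchanged by
    the division. The sign [s] serves both ends of the line. *)
Lemma cvg_ln_ratio (s a b y z : R) : s ^+ 2 = 1 -> 0 < y -> 0 < z ->
  ln ((s * n%:R - a) ^+ 2 + y ^+ 2) - ln ((s * n%:R - b) ^+ 2 + z ^+ 2)
    @[n --> \oo] --> (0 : R).
Proof.
move=> s1 y0 z0.
pose r (a y : R) (n : nat) := ((s * n%:R - a) ^+ 2 + y ^+ 2) / n%:R ^+ 2.
apply: (@cvg_trans _ ((fun n : nat => ln (r a y n) - ln (r b z n)) @ \oo)).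
  apply: near_eq_cvg; near=> n.
  have n0 : 0 < n%:R :> R by near: n; exact: nbhs_infty_gtr.
  rewrite /r !ln_div ?posrE ?den_gt0 ?exprn_gt0//.
  by ring.
rewrite (_ : 0 = ln 1 - ln 1 :> R); last by rewrite subrr.
have L c v : ln (r c v n) @[n --> \oo] --> ln (1 : R).
  by apply: continuous_cvg; [exact: continuous_ln|exact: cvg_ratio_shift].
by apply: cvgB; exact: L.
Unshelve. all: by end_near. Qed.

(* The Poisson kernel of the upper half-plane and its conjugate:
   [1 / (pi (x + i y)) = Q y x - i P y x]. *)
Definition P (y x : R) := y / (pi * (x ^+ 2 + y ^+ 2)).
Definition Q (y x : R) := x / (pi * (x ^+ 2 + y ^+ 2)).

Let pi0 : 0 < pi :> R := pi_gt0 R.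
Let piN0 : pi != 0 :> R := lt0r_neq0 pi0.

Ltac gpi := have := piN0; move: (pi : R) => p pN0.

Lemma PN y x : P y (- x) = P y x.
Proof. by rewrite /P sqrrN. Qed.

Lemma QN y x : Q y (- x) = - Q y x.
Proof. by rewrite /Q sqrrN mulNr. Qed.

Lemma PC y x t : P y (x - t) = P y (t - x).
Proof. by rewrite -PN opprB. Qed.

Lemma QC y x t : Q y (x - t) = - Q y (t - x).
Proof. by rewrite -QN opprB. Qed.

Lemma P_gt0 y x : 0 < y -> 0 < P y x.
Proof. by move=> y0; rewrite /P divr_gt0// mulr_gt0// den_gt0. Qed.

Lemma P_ge0 y x : 0 < y -> 0 <= P y x.
Proof. by move=> y0; exact/ltW/P_gt0. Qed.

Lemma cont_PQ_aux (y a : R) (N : R -> R) : 0 < y -> (forall u, {for u, continuous N}) ->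
  forall u, {for u, continuous (fun u => N u / (pi * ((u - a) ^+ 2 + y ^+ 2)))}.
Proof.
move=> y0 cN u; apply: cvgM; first exact: cN.
apply: cvgV; first by rewrite mulf_neq0// gt_eqF// den_gt0.
by apply: cvgMl_tmp; exact: continuous_den.
Qed.

Lemma cont_P y a : 0 < y -> forall u, {for u, continuous (fun u => P y (u - a))}.
Proof. by move=> y0; apply: (@cont_PQ_aux y a (fun=> y) y0) => u; exact: cvg_cst. Qed.

Lemma cont_Q y a : 0 < y -> forall u, {for u, continuous (fun u => Q y (u - a))}.
Proof.
move=> y0; apply: (@cont_PQ_aux y a (fun u => u - a) y0) => u.
by apply: cvgB; [exact: cvg_id|exact: cvg_cst].
Qed.

Lemma cont_meas f : (forall u, {for u, continuous f}) -> measurable_fun setT f.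
Proof. by move=> cf; apply: continuous_measurable_fun => u; exact: cf. Qed.

Lemma meas_P y : 0 < y -> measurable_fun setT (P y).
Proof.
move=> y0; apply: cont_meas => u; have := @cont_P y 0 y0 u.
by rewrite (_ : (fun u => P y (u - 0)) = P y)//; apply/funext => z; rewrite subr0.
Qed.

Lemma meas_Q y : 0 < y -> measurable_fun setT (Q y).
Proof.
move=> y0; apply: cont_meas => u; have := @cont_Q y 0 y0 u.
by rewrite (_ : (fun u => Q y (u - 0)) = Q y)//; apply/funext => z; rewrite subr0.
Qed.

(** The primitive is an arctangent, so the integrals over [[-n-1, n+1]] are bounded by [pi / y], and
    monotone convergence gives integrability; [n.+1] keeps the intervals nondegenerate. *)
Lemma Int_cauchy_kernel a y : 0 < y ->
  integ (fun u => ((u - a) ^+ 2 + y ^+ 2)^-1) /\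
  Int (fun u => ((u - a) ^+ 2 + y ^+ 2)^-1) = pi / y.
Proof.
move=> y0.
have c u : {for u, continuous (fun u => ((u - a) ^+ 2 + y ^+ 2)^-1)}.
  by apply: cvgV; [rewrite gt_eqF// den_gt0|exact: continuous_den].
have p0 u : 0 <= ((u - a) ^+ 2 + y ^+ 2)^-1 by rewrite invr_ge0 ltW// den_gt0.
have i : integ (fun u => ((u - a) ^+ 2 + y ^+ 2)^-1).
  pose F n u := \1_`[- n.+1%:R, n.+1%:R] u * ((u - a) ^+ 2 + y ^+ 2)^-1.
  have nn (n : nat) : - (n.+1%:R : R) < n.+1%:R by rewrite -subr_gt0 opprK addr_gt0.
  have F0 n u : 0 <= F n u by rewrite mulr_ge0// indic_ge0.
  have mF n : measurable_fun setT (F n).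
    by apply: measurable_funM; [exact: measurable_indic|exact: cont_meas].
  have iF n : integ (F n).
    have : integ (\1_`[- n.+1%:R, n.+1%:R] : R -> R).
      by apply: integrable_indic_itv.
    move=> /(integ_scale ((y ^+ 2)^-1)) h.
    apply: (integ_le (mF n) h) => u.
    rewrite ger0_norm// [leRHS]mulrC ler_wpM2l ?indic_ge0//.
    by rewrite lef_pV2 ?posrE ?den_gt0 ?exprn_gt0// lerDr sqr_ge0.
  have IF n : Int (F n) <= pi / y.
    rewrite (FTC_itv (nn n) c (fun u => is_derive_atan_shift a u y0)) -mulrBl.
    rewrite ler_wpM2r ?invr_ge0 ?ltW//.
    have := atan_ltpi2 ((n.+1%:R - a) / y); have := atan_gtNpi2 ((- n.+1%:R - a) / y).
    by lra.
  have ndF n u : F n u <= F n.+1 u.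
    rewrite ler_wpM2r// !indicE ler_nat.
    case: (boolP (u \in `[- n.+1%:R, n.+1%:R]%classic)) => // /set_mem /=.
    rewrite in_itv/= => /andP[h1 h2].
    have nS : n.+1%:R <= n.+2%:R :> R by rewrite ler_nat.
    by rewrite mem_set//= in_itv/= (le_trans h2)// andbT (le_trans _ h1)// lerN2.
  have [g [ig _ _ hg]] := Int_mono_bound iF F0 ndF IF.
  apply: (integ_ae_le (cont_meas c) ig).
  apply: aeS hg => u hg; rewrite ger0_norm//.
  have := cvg_indic_itv u => /cvgrPdist_lt /(_ 1 ltr01) [N _ /(_ N.+1 (leqnSn N))].
  move=> /=; have := hg N; rewrite /F indicE; case: (u \in _) => /=; rewrite ?mul1r//.
  by rewrite subr0 normr1 ltxx.
split => //; apply: (FTC_R i c (fun u => is_derive_atan_shift a u y0)).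
exact: cvg_atan_shift.
Qed.

Lemma integ_P y x : 0 < y -> integ (fun t => P y (x - t)).
Proof.
move=> y0; have [i _] := Int_cauchy_kernel x y0.
apply: integ_eq (integ_scale (y / pi) i) => t; rewrite PC /P.
by gpi; field; rewrite pN0 gt_eqF// den_gt0.
Qed.

Lemma Int_P y x : 0 < y -> Int (fun t => P y (x - t)) = 1.
Proof.
move=> y0; have [i e] := Int_cauchy_kernel x y0.
rewrite (@Int_eq _ _ (fun t => y / pi * ((t - x) ^+ 2 + y ^+ 2)^-1)).
  by rewrite Int_scale// e; gpi; field; rewrite pN0 gt_eqF.
by move=> t; rewrite PC /P; gpi; field; rewrite pN0 gt_eqF// den_gt0.
Qed.

Lemma meas_Psub y x : 0 < y -> measurable_fun setT (fun t => P y (x - t)).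
Proof. by move=> y0; apply: integ_meas; exact: integ_P. Qed.

Lemma meas_Qsub y x : 0 < y -> measurable_fun setT (fun t => Q y (x - t)).
Proof.
move=> y0; rewrite (_ : (fun t => _) = (fun t => - Q y (t - x))); last first.
  by apply/funext => t; exact: QC.
by apply: measurable_funN; apply: cont_meas; exact: cont_Q.
Qed.

(** Both sides are the squared modulus of [1 / (pi (x + i y))]. Hence both squares are below a
    multiple of the integrable [P], which puts the two kernels in L^2. *)
Lemma PQ_sqr y x : 0 < y -> P y x ^+ 2 + Q y x ^+ 2 = P y x / (pi * y).
Proof.
move=> y0; rewrite /P /Q; gpi; field.
by rewrite pN0 (gt_eqF y0)/= gt_eqF// den_gt0.
Qed.

Lemma L2_P y x : 0 < y -> L2 (fun t => P y (x - t)).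
Proof.
move=> y0; split; first exact: meas_Psub.
apply: (integ_le _ (integ_scale (pi * y)^-1 (integ_P x y0))).
  by apply: measurable_funX; exact: meas_Psub.
move=> t; rewrite ger0_norm ?sqr_ge0// mulrC -PQ_sqr//.
by rewrite lerDl sqr_ge0.
Qed.

Lemma L2_Q y x : 0 < y -> L2 (fun t => Q y (x - t)).
Proof.
move=> y0; split; first exact: meas_Qsub.
apply: (integ_le _ (integ_scale (pi * y)^-1 (integ_P x y0))).
  by apply: measurable_funX; exact: meas_Qsub.
move=> t; rewrite ger0_norm ?sqr_ge0// mulrC -PQ_sqr//.
by rewrite lerDr sqr_ge0.
Qed.

Lemma n2_Q_le y x : 0 < y -> n2 (fun t => Q y (x - t)) <= (pi * y)^-1.
Proof.
move=> y0; rewrite -[leRHS]mulr1 -(Int_P x y0) -Int_scale; last exact: integ_P.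
apply: Int_le; first exact: (L2_Q x y0).2.
  by apply: integ_scale; exact: integ_P.
by move=> t; rewrite [leRHS]mulrC -PQ_sqr// lerDr sqr_ge0.
Qed.

(* A primitive is a combination of the two arctangents and of the logarithm of
   the ratio of the two denominators, which vanishes at both ends. *)
Lemma Int_partial_fraction (x t s y al be be' : R) (phi : R -> R) :
  0 < s -> 0 < y -> integ phi -> (forall u, {for u, continuous phi}) ->
  (forall u, phi u = (al * (u - t) + be) / ((u - t) ^+ 2 + y ^+ 2) +
                     (- al * (u - x) + be') / ((u - x) ^+ 2 + s ^+ 2)) ->
  Int phi = pi * (be / y + be' / s).
Proof.
move=> s0 y0 iphi cphi phiE.
pose Phi u := 1 * ((al / 2) * ln ((u - t) ^+ 2 + y ^+ 2) +
   (- (al / 2)) * ln ((u - x) ^+ 2 + s ^+ 2)) +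
   1 * (be * (atan ((u - t) / y) / y) + be' * (atan ((u - x) / s) / s)).
have dPhi u : is_derive u 1 Phi (phi u).
  rewrite phiE.
  have h := is_derive_lin 1 1
    (is_derive_lin (al / 2) (- (al / 2)) (is_derive_ln_shift t u y0) (is_derive_ln_shift x u s0))
    (is_derive_lin be be' (is_derive_atan_shift t u y0) (is_derive_atan_shift x u s0)).
  apply: (is_derive_eq h); move: (den_gt0 (u - t) y0) (den_gt0 (u - x) s0).
  move: (_ ^+ 2 + _) (_ ^+ 2 + _) => A B A0 B0.
  by field; rewrite !gt_eqF.
apply: (FTC_R iphi cphi dPhi).
have one : (1 : R) ^+ 2 = 1 by rewrite expr1n.
have mone : (-1 : R) ^+ 2 = 1 by rewrite sqrrN expr1n.
have L1 := cvg_ln_ratio t x one y0 s0.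
have L2 := cvg_ln_ratio t x mone y0 s0.
have L3 := cvg_atan_shift t y0.
have L4 := cvg_atan_shift x s0.
rewrite (_ : pi * _ = (al / 2 * 0 - al / 2 * 0 + be * (pi / y)) + be' * (pi / s)); last first.
  by gpi; field; rewrite !gt_eqF.
rewrite (_ : (fun n => _) = fun n : nat =>
  al / 2 * (ln ((1 * n%:R - t) ^+ 2 + y ^+ 2) - ln ((1 * n%:R - x) ^+ 2 + s ^+ 2)) -
  al / 2 * (ln ((-1 * n%:R - t) ^+ 2 + y ^+ 2) - ln ((-1 * n%:R - x) ^+ 2 + s ^+ 2)) +
  be * (atan ((n%:R - t) / y) / y - atan ((- n%:R - t) / y) / y) +
  be' * (atan ((n%:R - x) / s) / s - atan ((- n%:R - x) / s) / s)); last first.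
  apply/funext => n; rewrite /Phi !mul1r !mulN1r.
  move: (ln _) (ln _) (ln _) (ln _) (atan _) (atan _) (atan _) (atan _).
  by move=> *; ring.
by apply: cvgD; [apply: cvgD; [apply: cvgB|]|]; apply: cvgMl_tmp.
Qed.

(** These are the squared distances from the pole [t + i y] to the poles [x + i s] and [x - i s].
    Only the first can vanish, when two poles coincide, and then partial fractions break down. *)
Lemma conv_disc_neq0 (x t s y : R) : 0 < s -> 0 < y -> ~~ ((x == t) && (s == y)) ->
  (x - t) ^+ 2 + (s - y) ^+ 2 != 0 /\ (x - t) ^+ 2 + (s + y) ^+ 2 != 0.
Proof.
move=> s0 y0 h; split; last by rewrite gt_eqF// den_gt0// addr_gt0.
apply: contra h; rewrite paddr_eq0 ?sqr_ge0// !sqrf_eq0 !subr_eq0 => /andP[] /eqP-> /eqP->.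
by rewrite !eqxx.
Qed.

Lemma cvg_invden a y (s : R) : s ^+ 2 = 1 -> 0 < y ->
  ((s * n%:R - a) ^+ 2 + y ^+ 2)^-1 @[n --> \oo] --> (0 : R).
Proof.
move=> s1 y0.
have h := cvg_ratio_shift a y s1.
have h1 := cvg_inv_seq (oner_neq0 R) h.
have h2 := cvg_natr_inv (1 : R).
have := cvg_mul_seq h1 (cvg_mul_seq h2 h2); rewrite mulr0 mulr0; apply: cvg_eq_pos => n n0.
by rewrite /=; field; rewrite !gt_eqF ?den_gt0.
Qed.

(** The semigroup law: heights add. Partial fractions prove it when the poles are distinct; for a
    double pole ([x = t] and [s = y]) the integrand has a multiple of [1 / ((u - x)^2 + y^2)] as
    primitive. *)
Lemma PQ_conv (x t s y : R) : 0 < s -> 0 < y ->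
  Int (fun u => P s (x - u) * Q y (u - t)) = Q (s + y) (x - t).
Proof.
move=> s0 y0.
have i : integ (fun u => P s (x - u) * Q y (u - t)).
  have h := L2_mul (L2_P x s0) (L2_opp (L2_Q t y0)).
  by apply: integ_eq h => u; rewrite -QC.
have c u : {for u, continuous (fun u => P s (x - u) * Q y (u - t))}.
  rewrite (_ : (fun u => _) = fun u => P s (u - x) * Q y (u - t)).
    by apply: cvgM; [exact: cont_P|exact: cont_Q].
  by apply/funext => v; rewrite PC.
have [/andP[/eqP xt /eqP sy]|ne] := boolP ((x == t) && (s == y)).
  subst s t; rewrite subrr {2}/Q mul0r.
  have d u := is_derive_inv_den x u y0.
  pose k := - (y / (2 * pi ^+ 2)).
  have dk u : is_derive u 1 (fun u => k * ((u - x) ^+ 2 + y ^+ 2)^-1 + 0 * 0) (P y (x - u) * Q y (u - x)).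
    apply: (is_derive_eq (is_derive_lin k 0 (d u) (is_derive_cst (0 : R) u 1))).
    rewrite PC /P /Q /k; move: (den_gt0 (u - x) y0); move: (_ ^+ 2 + _) => A A0.
    by gpi; field; rewrite pN0 gt_eqF.
  apply: (FTC_R i c dk).
  rewrite (_ : (fun n => _) = (fun n : nat =>
     k * ((1 * n%:R - x) ^+ 2 + y ^+ 2)^-1 - k * ((-1 * n%:R - x) ^+ 2 + y ^+ 2)^-1)); last first.
    by apply/funext => n; rewrite !mul1r mulN1r mul0r !addr0.
  rewrite (_ : 0 = k * 0 - k * 0); last by ring.
  apply: cvgB; apply: cvgMl_tmp; apply: cvg_invden => //.
    by rewrite expr1n.
  by rewrite sqrrN expr1n.
have [D1 D2] := conv_disc_neq0 s0 y0 ne.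
(* [D] is the resultant of the two quadratic denominators; [al], [be], [be'] are the partial
   fraction coefficients. *)
pose D := ((x - t) ^+ 2 + (s - y) ^+ 2) * ((x - t) ^+ 2 + (s + y) ^+ 2).
pose al := s * ((x - t) ^+ 2 + s ^+ 2 - y ^+ 2) / (pi ^+ 2 * D).
pose be := - s * (2 * (x - t) * y ^+ 2) / (pi ^+ 2 * D).
pose be' := s * (x - t) * ((x - t) ^+ 2 + s ^+ 2 + y ^+ 2) / (pi ^+ 2 * D).
rewrite (@Int_partial_fraction x t s y al be be' _ s0 y0 i c) => [|u].
  rewrite /al /be /be' /D /Q; gpi; field.
  by rewrite pN0 D1 D2 !gt_eqF.
rewrite PC /P /Q /al /be /be' /D; gpi; field.
by rewrite pN0 D1 D2 !gt_eqF ?den_gt0.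
Qed.

(** Conjugation squares to -1 while the heights add. The method is that of [PQ_conv], but here the
    double pole leaves an arctangent in the primitive. *)
Lemma QQ_conv (x t s y : R) : 0 < s -> 0 < y ->
  Int (fun u => Q s (x - u) * Q y (u - t)) = - P (s + y) (x - t).
Proof.
move=> s0 y0.
have i : integ (fun u => Q s (x - u) * Q y (u - t)).
  have h := L2_mul (L2_Q x s0) (L2_opp (L2_Q t y0)).
  by apply: integ_eq h => u; rewrite -QC.
have c u : {for u, continuous (fun u => Q s (x - u) * Q y (u - t))}.
  rewrite (_ : (fun u => _) = fun u => (- Q s (u - x)) * Q y (u - t)).
    by apply: cvgM; [apply: cvgN; exact: cont_Q|exact: cont_Q].
  by apply/funext => v; rewrite -QC.
have [/andP[/eqP xt /eqP sy]|ne] := boolP ((x == t) && (s == y)).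
  subst s t; rewrite subrr.
  have d u := is_derive_inv_den x u y0.
  pose k : R := (2 * pi ^+ 2)^-1.
  pose Phi u := k * ((u - x) * ((u - x) ^+ 2 + y ^+ 2)^-1) +
    (- k) * (atan ((u - x) / y) / y).
  have dPhi u : is_derive u 1 Phi (Q y (x - u) * Q y (u - x)).
    have d2 := is_derive_atan_shift x u y0.
    have d1 : is_derive u 1 (fun u => u - x) 1.
      by apply: (is_derive_eq (is_deriveB (is_derive_id u 1) (is_derive_cst x u 1))); rewrite subr0.
    apply: (is_derive_eq (is_derive_lin k (- k) (is_deriveM d1 (d u)) d2)).
    rewrite QC /Q /k /GRing.scale /= !mulr1; move: (den_gt0 (u - x) y0).
    move: (_ ^+ 2 + _) => A A0.
    by gpi; field; rewrite pN0 gt_eqF.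
  apply: (FTC_R i c dPhi).
  pose G (s : R) (n : nat) := (s * n%:R - x) / ((s * n%:R - x) ^+ 2 + y ^+ 2).
  have G0 (s : R) : s ^+ 2 = 1 -> G s @ \oo --> (0 : R).
    move=> s1; have h1 := cvg_inv_seq (oner_neq0 R) (cvg_ratio_shift x y s1).
    have h2 := cvg_natr_inv (1 : R).
    have h3 : s - x / n%:R @[n --> \oo] --> s - 0.
      by apply: cvgB; [exact: cvg_cst|exact: cvg_natr_inv].
    have := cvg_mul_seq (cvg_mul_seq h1 h3) h2; rewrite mulr0; apply: cvg_eq_pos => n n0.
    by rewrite /G /=; field; rewrite !gt_eqF ?den_gt0.
  rewrite (_ : (fun n => _) = (fun n : nat => k * (G 1 n - G (-1) n -
    (atan ((n%:R - x) / y) / y - atan ((- n%:R - x) / y) / y)))); last first.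
    by apply/funext => n; rewrite /Phi /G mul1r mulN1r; move: (atan _) (atan _) => *; ring.
  rewrite (_ : - P _ _ = k * (0 - 0 - pi / y)); last first.
    rewrite /P /k; gpi; field; rewrite pN0 (gt_eqF y0) /=.
    by rewrite gt_eqF// addr_gt0.
  apply: cvgMl_tmp; apply: cvgB; last exact: cvg_atan_shift.
  by apply: cvgB; apply: G0; rewrite ?sqrrN expr1n.
have [D1 D2] := conv_disc_neq0 s0 y0 ne.
pose D := ((x - t) ^+ 2 + (s - y) ^+ 2) * ((x - t) ^+ 2 + (s + y) ^+ 2).
pose al := (x - t) * ((x - t) ^+ 2 + s ^+ 2 + y ^+ 2) / (pi ^+ 2 * D).
pose be := - y ^+ 2 * ((x - t) ^+ 2 + y ^+ 2 - s ^+ 2) / (pi ^+ 2 * D).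
pose be' := - s ^+ 2 * ((x - t) ^+ 2 + s ^+ 2 - y ^+ 2) / (pi ^+ 2 * D).
rewrite (@Int_partial_fraction x t s y al be be' _ s0 y0 i c) => [|u].
  rewrite /al /be /be' /D /P; gpi; field.
  by rewrite pN0 D1 D2 !gt_eqF.
rewrite QC /P /Q /al /be /be' /D; gpi; field.
by rewrite pN0 D1 D2 !gt_eqF ?den_gt0.
Qed.

End Kernels.

(** * Poisson integrals and truncated Hilbert transforms *)

Section LebesguePoints.
Context {R : realType}.
Local Notation mu := (@lebesgue_measure R).
Implicit Types (f g h k : R -> R) (F G : R -> R -> R) (x y t a s u r : R).

Lemma ler_halves (a b c d : R) : a <= d / 2 -> b <= c -> a + b + d / 2 <= c + d.
Proof. by lra. Qed.

Let pi0 : 0 < pi :> R := pi_gt0 R.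
Let piN0 : pi != 0 :> R := lt0r_neq0 pi0.
Let pi1 : 1 <= pi :> R. Proof. by have := pi_ge2 R; lra. Qed.

Lemma meas_reflect (c : R) : measurable_fun setT (fun t => c - t).
Proof. by apply: measurable_funB. Qed.

Lemma Int_reflect (c : R) f : integ f -> Int (fun t => f (c - t)) = Int f.
Proof.
move=> fi; have mf := integ_meas fi; have [mEf ioo] := integrableP _ _ _ fi.
pose phi : measurableTypeR R -> measurableTypeR R := fun t => c - t.
have mphi : measurable_fun setT phi := meas_reflect c.
pose phim : {mfun measurableTypeR R >-> measurableTypeR R} :=
  HB.pack phi (isMeasurableFun.Build _ _ _ _ phi mphi).
have muE (A : set (measurableTypeR R)) : measurable A -> mu A = pushforward mu phim A.
  move=> mA; apply: lebesgue_measure_unique => //= _ [[a b]] _ <-.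
  rewrite /pushforward (_ : _ @^-1` _ = `[c - b, c - a[%classic).
    rewrite !lebesgue_measure_itv/= !lte_fin ltrD2l ltrN2.
    by case: ifP => // _; rewrite -!EFinB; congr EFin; ring.
  apply/seteqP; split => t; rewrite /phi/= !in_itv/= => /andP[h1 h2]; apply/andP.
    by split; [rewrite lerBlDr -lerBlDl|rewrite ltrBrDr -ltrBrDl].
  by split; [rewrite ltrBrDr -ltrBrDl|rewrite lerBlDr -lerBlDl].
have E (g : R -> \bar R) : (\int[pushforward mu phim]_x g x = \int[mu]_x g x)%E.
  by apply: eq_measure_integral => //= A mA _; rewrite -muE.
have i2 : mu.-integrable (phim @^-1` setT) ((EFin \o f) \o phim).
  rewrite preimage_setT; apply/integrableP; split; first exact: measurableT_comp.
  rewrite -E in ioo; apply: le_lt_trans ioo.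
  rewrite (ge0_integral_pushforward mphi) //.
  by apply: measurableT_comp.
have := integral_pushforward mphi mEf i2 measurableT.
by rewrite E preimage_setT /Rintegral => ->.
Qed.

Lemma Int_odd x f : integ f -> (forall t, f (2 * x - t) = - f t) -> Int f = 0.
Proof.
move=> fi fo; have := Int_reflect (2 * x) fi.
rewrite (@Int_eq _ _ (fun t => - f t))// Int_opp// => /eqP.
by rewrite eqNr => /eqP.
Qed.

(* On [W] the truncated Hilbert transforms and the conjugate Poisson integrals
   are absolutely convergent, on [V] the Poisson integrals are. *)
Definition W f := measurable_fun setT f /\ integ (fun t => `|f t| / (1 + `|t|)).
Definition V f := measurable_fun setT f /\ integ (fun t => `|f t| / (1 + t ^+ 2)).

Lemma W_mulr f k (c : R) : W f -> measurable_fun setT k ->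
  (forall t, `|k t| <= c / (1 + `|t|)) -> integ (fun t => k t * f t).
Proof.
move=> [mf fi] mk kc; apply: (integ_le _ (integ_scale c fi)).
  exact: measurable_funM.
move=> t; rewrite normrM (_ : c * _ = c / (1 + `|t|) * `|f t|); last by ring.
by rewrite ler_wpM2r.
Qed.

Lemma V_mulr f k (c : R) : V f -> measurable_fun setT k ->
  (forall t, `|k t| <= c / (1 + t ^+ 2)) -> integ (fun t => k t * f t).
Proof.
move=> [mf fi] mk kc; apply: (integ_le _ (integ_scale c fi)).
  exact: measurable_funM.
move=> t; rewrite normrM (_ : c * _ = c / (1 + t ^+ 2) * `|f t|); last by ring.
by rewrite ler_wpM2r.
Qed.

Lemma norm1_gt0 t : 0 < 1 + `|t|.
Proof. by rewrite ltr_pwDl. Qed.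

Lemma sqr1_gt0 t : 0 < 1 + t ^+ 2.
Proof. by rewrite ltr_pwDl// sqr_ge0. Qed.

Lemma meas_norm1 : measurable_fun setT (fun t => (1 + `|t|)^-1).
Proof.
apply: cont_meas => u; apply: cvgV; first by rewrite gt_eqF// norm1_gt0.
by apply: cvgD; [exact: cvg_cst|exact: norm_continuous].
Qed.

Lemma meas_sqr1 : measurable_fun setT (fun t => (1 + t ^+ 2)^-1).
Proof.
apply: cont_meas => u; apply: cvgV; first by rewrite gt_eqF// sqr1_gt0.
by apply: cvgD; [exact: cvg_cst|exact: exprn_continuous].
Qed.

Lemma integ_sqr1 : integ (fun t => (1 + t ^+ 2)^-1).
Proof.
have [i _] := Int_cauchy_kernel (0 : R) ltr01.
by apply: integ_eq i => t; rewrite subr0 expr1n addrC.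
Qed.

Lemma Int_sqr1 : Int (fun t => (1 + t ^+ 2)^-1) = pi.
Proof.
have [_ i] := Int_cauchy_kernel (0 : R) ltr01.
by rewrite divr1 in i; rewrite -i; apply: Int_eq => t; rewrite subr0 expr1n addrC.
Qed.

Lemma L2_norm1 : L2 (fun t => (1 + `|t|)^-1).
Proof.
split; first exact: meas_norm1.
apply: (integ_le _ integ_sqr1) => [|t]; first by apply: measurable_funX; exact: meas_norm1.
rewrite ger0_norm ?sqr_ge0// exprVn lef_pV2 ?posrE ?exprn_gt0 ?norm1_gt0 ?sqr1_gt0//.
by rewrite -(real_normK (num_real t)); have := normr_ge0 t; nra.
Qed.

Lemma W_L1 f : integ f -> W f.
Proof.
move=> fi; have mf := integ_meas fi; split => //.
apply: (integ_le _ (integ_abs fi)) => [|t].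
  by apply: measurable_funM; [exact: measurableT_comp|exact: meas_norm1].
rewrite normrM normr_id ler_piMr// normfV invf_le1 ?normr_gt0 ?gt_eqF ?norm1_gt0//.
by rewrite ger0_norm ?lerDl// ltW// norm1_gt0.
Qed.

Lemma W_L2 f : L2 f -> W f.
Proof. by move=> fi; split; [case: fi|exact: (L2_mul (L2_abs fi) L2_norm1)]. Qed.

Lemma W_V f : W f -> V f.
Proof.
move=> [mf fi]; split => //; apply: (integ_le _ (integ_scale 2 fi)) => [|t].
  by apply: measurable_funM; [exact: measurableT_comp|exact: meas_sqr1].
rewrite ger0_norm; last by rewrite divr_ge0// ltW// sqr1_gt0.
rewrite mulrCA ler_wpM2l// -ler_pdivrMl// -invfM lef_pV2 ?posrE ?mulr_gt0 ?norm1_gt0 ?sqr1_gt0//.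
by rewrite -(real_normK (num_real t)); have := sqr_ge0 (`|t| - 1); nra.
Qed.

Lemma V_cst (c : R) : V (fun=> c).
Proof.
split => //; apply: (integ_eq _ (integ_scale `|c| integ_sqr1)) => t.
by [].
Qed.

Lemma V_add f g : V f -> V g -> V (fun t => f t + g t).
Proof.
move=> [mf fi] [mg gi]; have m := measurable_funD mf mg; split => //.
apply: (integ_le _ (integ_add fi gi)) => [|t].
  by apply: measurable_funM; [exact: measurableT_comp|exact: meas_sqr1].
rewrite ger0_norm; last by rewrite divr_ge0// ltW// sqr1_gt0.
by rewrite -mulrDl ler_wpM2r ?ler_normD// invr_ge0 ltW// sqr1_gt0.
Qed.

Lemma V_le f g : measurable_fun setT f -> V g -> (forall t, `|f t| <= `|g t|) -> V f.
Proof.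
move=> mf [mg gi] fg; split => //; apply: (integ_le _ gi) => [|t].
  by apply: measurable_funM; [exact: measurableT_comp|exact: meas_sqr1].
rewrite ger0_norm; last by rewrite divr_ge0// ltW// sqr1_gt0.
by rewrite ler_wpM2r// invr_ge0 ltW// sqr1_gt0.
Qed.

Lemma W_add f g : W f -> W g -> W (fun t => f t + g t).
Proof.
move=> [mf fi] [mg gi]; have m := measurable_funD mf mg; split => //.
apply: (integ_le _ (integ_add fi gi)) => [|t].
  by apply: measurable_funM; [exact: measurableT_comp|exact: meas_norm1].
rewrite ger0_norm; last by rewrite divr_ge0// ltW// norm1_gt0.
by rewrite -mulrDl ler_wpM2r ?ler_normD// invr_ge0 ltW// norm1_gt0.
Qed.

Lemma W_scale (c : R) f : W f -> W (fun t => c * f t).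
Proof.
move=> [mf fi]; split; first exact: measurable_funM.
by apply: (integ_eq _ (integ_scale `|c| fi)) => t; rewrite normrM mulrA.
Qed.

Lemma Q_norm1 y x : 0 < y ->
  exists c : R, forall t, `|Q y (x - t)| <= c / (1 + `|t|).
Proof.
move=> y0; exists ((1 + `|x|) / (2 * y) + 1) => t.
have tx : 1 + `|t| <= 1 + `|x| + `|x - t|.
  by rewrite -addrA lerD2l -{1}(subKr x t) (le_trans (ler_normB _ _)).
rewrite /Q; move: (x - t) tx => v tx.
have D := den_gt0 v y0.
rewrite normrM normfV (ger0_norm (_ : 0 <= pi * _)); last by rewrite ltW// mulr_gt0.
rewrite ler_pdivlMr ?norm1_gt0// mulrAC ler_pdivrMr ?mulr_gt0//.
apply: (@le_trans _ _ (((1 + `|x|) / (2 * y) + 1) * (v ^+ 2 + y ^+ 2))); last first.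
  rewrite ler_wpM2l ?addr_ge0 ?divr_ge0 ?addr_ge0 ?mulr_ge0 ?(ltW y0)//.
  by rewrite ler_peMl// ltW.
rewrite -(real_normK (num_real v)); move: (normr_ge0 v) (normr_ge0 x) tx.
move: `|v| `|x| `|t| => w z q w0 z0 tx.
apply: (@le_trans _ _ (w * (1 + z + w))); first by rewrite ler_wpM2l.
have h : w <= (w ^+ 2 + y ^+ 2) / (2 * y).
  by rewrite ler_pdivlMr ?mulr_gt0//; have := sqr_ge0 (w - y); nra.
rewrite mulrDl mul1r [leRHS](_ : _ = (1 + z) * ((w ^+ 2 + y ^+ 2) / (2 * y)) + (w ^+ 2 + y ^+ 2)); last by ring.
rewrite mulrDr mulrC lerD//; first by rewrite ler_wpM2l// addr_ge0.
by rewrite -expr2 lerDl sqr_ge0.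
Qed.

Lemma sqr1_shift x t : 1 + t ^+ 2 <= 1 + 2 * x ^+ 2 + 2 * (x - t) ^+ 2.
Proof. by have := sqr_ge0 (2 * x - t); nra. Qed.

Lemma P_sqr1 y x : 0 < y -> exists c : R, forall t, `|P y (x - t)| <= c / (1 + t ^+ 2).
Proof.
move=> y0; exists (y * (2 + (1 + 2 * x ^+ 2) / y ^+ 2)) => t.
have tx := sqr1_shift x t.
rewrite ger0_norm ?P_ge0// /P; move: (x - t) tx => v tx.
have D := den_gt0 v y0.
rewrite ler_pdivlMr ?sqr1_gt0// mulrAC ler_pdivrMr ?mulr_gt0// -mulrA.
rewrite ler_wpM2l ?(ltW y0)//; apply: (le_trans tx).
apply: (@le_trans _ _ ((2 + (1 + 2 * x ^+ 2) / y ^+ 2) * (v ^+ 2 + y ^+ 2))); last first.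
  have c0 : 0 <= 2 + (1 + 2 * x ^+ 2) / y ^+ 2.
    by rewrite addr_ge0// divr_ge0 ?sqr_ge0// addr_ge0// mulr_ge0// sqr_ge0.
  by rewrite ler_wpM2l// ler_peMl// ltW.
rewrite [leRHS](_ : _ = 2 * v ^+ 2 + 2 * y ^+ 2 + (1 + 2 * x ^+ 2) / y ^+ 2 * v ^+ 2 + (1 + 2 * x ^+ 2)); last first.
  by field; rewrite gt_eqF.
have h : 0 <= (1 + 2 * x ^+ 2) / y ^+ 2 * v ^+ 2.
  by rewrite mulr_ge0 ?sqr_ge0// divr_ge0 ?sqr_ge0// addr_ge0// mulr_ge0// sqr_ge0.
by have := sqr_ge0 y; lra.
Qed.

Definition Pc y f x := Int (fun t => P y (x - t) * f t).
Definition Qc y f x := Int (fun t => Q y (x - t) * f t).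

Lemma integ_Pf y f x : 0 < y -> V f -> integ (fun t => P y (x - t) * f t).
Proof.
by move=> y0 Vf; have [c hc] := P_sqr1 x y0; apply: V_mulr Vf _ hc; exact: meas_Psub.
Qed.

Lemma integ_Qf y f x : 0 < y -> W f -> integ (fun t => Q y (x - t) * f t).
Proof.
by move=> y0 Vf; have [c hc] := Q_norm1 x y0; apply: W_mulr Vf _ hc; exact: meas_Qsub.
Qed.

Lemma meas2_Psub y : 0 < y -> meas2 (fun x t => P y (x - t)).
Proof. by move=> y0; apply: (meas2_comp (meas_P y0)); exact: meas2_diff. Qed.

Lemma meas2_Qsub y : 0 < y -> meas2 (fun x t => Q y (x - t)).
Proof. by move=> y0; apply: (meas2_comp (meas_Q y0)); exact: meas2_diff. Qed.

Lemma meas_Pc y f : 0 < y -> measurable_fun setT f -> measurable_fun setT (Pc y f).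
Proof.
move=> y0 mf; apply: measurable_Int; apply: meas2_mul; first exact: meas2_Psub.
exact: meas2_snd.
Qed.

Lemma meas_Qc y f : 0 < y -> measurable_fun setT f -> measurable_fun setT (Qc y f).
Proof.
move=> y0 mf; apply: measurable_Int; apply: meas2_mul; first exact: meas2_Qsub.
exact: meas2_snd.
Qed.

(** * Lebesgue points and Poisson averages *)

Lemma integ_ball f x r : V f -> integ (fun t => \1_(ball x r) t * f t).
Proof.
move=> Vf; apply: (V_mulr (c := 1 + 2 * x ^+ 2 + 2 * r ^+ 2) Vf).
  by apply: measurable_indic; exact: measurable_ball.
move=> t; rewrite ger0_norm ?indic_ge0// ler_pdivlMr ?sqr1_gt0//.
rewrite indicE; case: (boolP (t \in _)) => [/set_mem|] /=; last first.
  by move=> _; have := sqr_ge0 x; have := sqr_ge0 r; lra.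
rewrite /ball/= => h; rewrite mul1r (le_trans (sqr1_shift x t))// lerD2l ler_wpM2l//.
rewrite -(real_normK (num_real (x - t))) lerXn2r ?nnegrE ?(ltW h)//.
exact/ltW/(le_lt_trans (normr_ge0 _) h).
Qed.

(** Lebesgue points, with the bound against [r] instead of the measure [2 r] of the ball, the form
    that is summed over dyadic shells. *)
Definition Lpt f x := forall d, 0 < d -> exists2 r0, 0 < r0 &
  forall r, 0 < r <= r0 -> Int (fun t => \1_(ball x r) t * `|f t - f x|) <= d * r.

Lemma V_dist f x : V f -> V (fun t => `|f t - f x|).
Proof.
move=> Vf; have V1 := V_add Vf (V_cst (- f x)).
by apply: (V_le _ V1) => [|t]; rewrite ?normr_id//; apply: measurableT_comp => //; case: V1.
Qed.

Lemma integral_on (A : set R) h :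
  (\int[mu]_(x in A) (h x)%:E = \int[mu]_x (\1_A x * h x)%:E)%E.
Proof.
rewrite integral_mkcond (_ : _ \_ A = fun x => (\1_A x * h x)%:E)//.
by apply/funext => t; rewrite patchE indicE; case: (_ \in _); rewrite ?mul1r ?mul0r.
Qed.

Lemma locally_integrable_balls f : measurable_fun setT f ->
  (forall r, integ (fun t => \1_(ball 0 r) t * `|f t|)) -> locally_integrable setT f.
Proof.
move=> mf bf; split; [by []|exact: openT|move=> K _ cK].
have mK : measurable K by exact: compact_measurable.
have [M [_ hM]] := compact_bounded cK.
have i := bf (`|M| + 2).
have [_ ioo] := integrableP _ _ _ i.
apply: le_lt_trans ioo; rewrite (integral_on K (fun t => `|f t|)).
apply: ge0_le_integral => //.
- apply/measurable_EFinP; apply: measurable_funM; last exact: measurableT_comp.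
  exact: measurable_indic.
- by apply: measurableT_comp => //; exact: (measurable_int mu i).
- move=> t _; rewrite lee_fin /= normrM normr_id ger0_norm ?indic_ge0// ler_wpM2r//.
  rewrite indicE; case: (boolP (t \in K)) => [/set_mem Kt|_]; last exact: indic_ge0.
  rewrite indicE1// /ball/= sub0r normrN.
  have /= := hM (`|M| + 1) _ t Kt; rewrite (le_lt_trans (ler_norm _)) ?ltrDl// => /(_ isT) h.
  by rewrite (le_lt_trans h)// ltrD2l ltr1n.
Qed.

Lemma W_locally_integrable f : W f -> locally_integrable setT f.
Proof.
move=> Wf; have Vf := W_V Wf; apply: locally_integrable_balls; first by case: Vf.
move=> r; apply: integ_ball; apply: (V_le _ Vf) => [|t]; rewrite ?normr_id//.
by apply: measurableT_comp => //; case: Vf.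
Qed.

Lemma ae_Lpt f : W f -> {ae mu, forall x, Lpt f x}.
Proof.
move=> Wf; apply: aeS (lebesgue_differentiation (W_locally_integrable Wf)) => x.
rewrite /lebesgue_pt => /fine_cvgP[_ /cvgrPdist_le h] d d0.
have d2 : 0 < d / 2 by rewrite divr_gt0.
have [e /= e0 he] := h _ d2.
exists (e / 2) => [|r /andP[r0 re]]; first by rewrite divr_gt0.
have := he r; rewrite /= sub0r normrN ger0_norm ?(ltW r0)// r0 => /(_ _ isT).
rewrite (le_lt_trans re) ?ltr_pdivrMr ?ltr_pMr ?ltr1n// => /(_ isT).
rewrite sub0r normrN => /(le_trans (ler_norm _)).
rewrite /davg /iavg lebesgue_measure_ball ?(ltW r0)//.
have i := integ_ball x r (V_dist x (W_V Wf)).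
have E : (\int[mu]_(y in ball x r) `|((center (f x) \o f) y)%:E| =
   (Int (fun t => \1_(ball x r) t * `|f t - f x|))%:E)%E.
  rewrite /Rintegral fineK; last exact: (integrable_fin_num measurableT i).
  exact: (integral_on (ball x r) (fun t => `|f t - f x|)).
rewrite E inver gt_eqF ?pmulrn_lgt0//.
rewrite -EFinM /= mulrC ler_pdivrMr ?pmulrn_lgt0// => H; apply: (le_trans H).
by rewrite -mulr_natr; lra.
Qed.

(** Dyadic shells. The ball of radius [y] contributes at most [d], as [P y] is at most [1 / y];
    between the radii [2^n y] and [2^(n+1) y] the kernel is at most [1 / (4^n y)], which contributes
    [2 d / 2^n]. The sum [d (5 - 4 / 2^n)] is the bound proved by induction. *)
Lemma ball_Poisson_le f x y d K : 0 < y -> V f -> (forall t, 0 <= f t) -> 0 <= d ->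
  (forall i, (i <= K)%N ->
     Int (fun t => \1_(ball x (2 ^+ i * y)) t * f t) <= d * (2 ^+ i * y)) ->
  Int (fun t => \1_(ball x (2 ^+ K * y)) t * (P y (x - t) * f t)) <= 5 * d.
Proof.
move=> y0 Vf f0 d0; pose B (i : nat) : set R := ball x (2 ^+ i * y); rewrite -/(B K).
have mB i : measurable (B i) by exact: measurable_ball.
have iPf := integ_Pf x y0 Vf.
have e0 (n : nat) : 0 < (2 : R) ^+ n by rewrite exprn_gt0.
have iB n : integ (fun t => \1_(B n) t * f t) by exact: integ_ball.
have iBP n : integ (fun t => \1_(B n) t * (P y (x - t) * f t)).
  exact: (integ_on (mB n) iPf).
suff H n : (n <= K)%N -> (forall i, (i <= n)%N ->
     Int (fun t => \1_(B i) t * f t) <= d * (2 ^+ i * y)) ->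
   Int (fun t => \1_(B n) t * (P y (x - t) * f t)) <= d * (5 - 4 * (2 ^+ n)^-1).
  move=> h; apply: (le_trans (H K (leqnn K) h)).
  by rewrite mulrC ler_wpM2r// gerBl mulr_ge0// invr_ge0 ltW.
elim: n => [_ h|n ih nK h].
  have -> : d * (5 - 4 * (2 ^+ 0)^-1) = y^-1 * (d * (2 ^+ 0 * y)).
    by rewrite expr0; field; rewrite gt_eqF.
  apply: (@le_trans _ _ (y^-1 * Int (fun t => \1_(B 0%N) t * f t))); last first.
    by rewrite ler_wpM2l ?invr_ge0 ?(ltW y0)// h.
  rewrite -Int_scale//; apply: Int_le => //; first exact: integ_scale.
  move=> t; rewrite [leRHS]mulrCA ler_wpM2l ?indic_ge0// ler_wpM2r//.
  have D := den_gt0 (x - t) y0.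
  rewrite /P ler_pdivrMr ?mulr_gt0// -ler_pdivrMl ?invr_gt0// invrK -expr2.
  by apply: (@le_trans _ _ ((x - t) ^+ 2 + y ^+ 2)); [rewrite lerDr sqr_ge0|rewrite ler_peMl// ltW].
have -> : d * (5 - 4 * (2 ^+ n.+1)^-1) =
    d * (5 - 4 * (2 ^+ n)^-1) + (4 ^+ n * y)^-1 * (d * (2 ^+ n.+1 * y)).
  have -> : (4 : R) ^+ n = 2 ^+ n * 2 ^+ n by rewrite -exprMn; congr (_ ^+ _); ring.
  by rewrite exprS; move: (2 ^+ n) (e0 n) => z z0; field; rewrite !gt_eqF.
apply: (@le_trans _ _ (Int (fun t => \1_(B n) t * (P y (x - t) * f t)) +
   (4 ^+ n * y)^-1 * Int (fun t => \1_(B n.+1) t * f t))); last first.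
  apply: lerD; first by apply: ih => [|i ni]; [exact: ltnW|apply: h; exact: leqW].
  by rewrite ler_wpM2l ?h// invr_ge0 mulr_ge0 ?exprn_ge0// ltW.
rewrite -Int_scale// -Int_add//; last exact: integ_scale.
apply: Int_le => //; first by apply: integ_add => //; exact: integ_scale.
move=> t; rewrite [in X in X <= _]indicE [\1_(B n.+1) t]indicE.
have Pf0 : 0 <= P y (x - t) * f t by rewrite mulr_ge0// P_ge0.
case: (boolP (t \in B n.+1)) => [|_]; last first.
  by rewrite mul0r addr_ge0// ?mulr0 ?mul0r ?mulr0// mulr_ge0// indic_ge0.
rewrite !mul1r => _; rewrite indicE; case: (boolP (t \in B n)) => [_|].
  by rewrite mul1r lerDl mulr_ge0// invr_ge0 mulr_ge0 ?exprn_ge0// ltW.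
rewrite mul0r add0r => /negP nB; rewrite ler_wpM2r//.
have hv : 2 ^+ n * y <= `|x - t|.
  by rewrite leNgt; apply/negP => hlt; apply: nB; rewrite inE.
have D := den_gt0 (x - t) y0.
rewrite /P ler_pdivrMr ?mulr_gt0// -ler_pdivrMl ?invr_gt0 ?mulr_gt0 ?exprn_gt0// invrK.
have -> : 4 ^+ n * y * y = (2 ^+ n * y) ^+ 2.
  have -> : (4 : R) ^+ n = 2 ^+ n * 2 ^+ n by rewrite -exprMn; congr (_ ^+ _); ring.
  by ring.
apply: (@le_trans _ _ ((x - t) ^+ 2 + y ^+ 2)); last by rewrite ler_peMl// ltW.
rewrite -(real_normK (num_real (x - t))) ler_wpDr ?sqr_ge0// lerXn2r// nnegrE ?mulr_ge0 ?exprn_ge0// ltW//.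
Qed.

Lemma ex_dyadic y r : 0 < y -> y <= r ->
  exists K, 2 ^+ K * y <= r /\ r < 2 ^+ K.+1 * y.
Proof.
move=> y0 yr.
have [n hn] : exists n, r < 2 ^+ n * y.
  exists (Num.bound (r / y)); rewrite -ltr_pdivrMr//.
  have /= h := archi_boundP (divr_ge0 (le_trans (ltW y0) yr) (ltW y0)).
  by apply: (lt_trans h); rewrite -natrX ltr_nat ltn_expl.
have /ex_minnP[m hm min] : exists n, r < 2 ^+ n * y by exists n.
case: m hm min => [|K] hm min; first by move: hm; rewrite expr0 mul1r ltNge yr.
exists K; split => //; rewrite leNgt; apply/negP => h.
by have := min K h; rewrite ltnn.
Qed.

Lemma Poisson_Lpt f x : W f -> Lpt f x ->
  Int (fun t => P y (x - t) * `|f t - f x|) @[y --> 0^'+] --> 0.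
Proof.
move=> Wf Lx; have Vg := V_dist x (W_V Wf).
set g := fun t => `|f t - f x|.
have g0 t : 0 <= g t by exact: normr_ge0.
apply/cvgrPdist_le => e e0.
(* [ball_Poisson_le] multiplies by 5, and half of [e] is kept for the tail. *)
have d0 : 0 < e / 10 by rewrite divr_gt0.
have [r0 r00 hr0] := Lx _ d0.
pose M := Int (fun t => `|g t| / (1 + t ^+ 2)).
have M0 : 0 <= M by apply: Int_ge0 => t; rewrite divr_ge0// ltW// sqr1_gt0.
(* Off the ball [|x - t|] is at least [r0 / 2], and [C] is chosen so that [1 + t^2 <= C (x - t)^2]
   there. *)
pose C := 2 + (1 + 2 * x ^+ 2) * 4 / r0 ^+ 2.
have C0 : 0 < C.
  by rewrite ltr_pwDl// divr_ge0 ?sqr_ge0// mulr_ge0// addr_ge0// mulr_ge0// sqr_ge0.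
have CM : 0 < C * M + 1 by rewrite ltr_wpDl// mulr_ge0// ltW.
near=> y.
have y0 : 0 < y by near: y; exact: nbhs_right_gt.
have yr : y <= r0 by near: y; exact: nbhs_right_le.
have yC : y <= (e / 2) / (C * M + 1).
  by near: y; apply: nbhs_right_le; rewrite !divr_gt0.
have iPg := integ_Pf x y0 Vg.
rewrite sub0r normrN ger0_norm; last by apply: Int_ge0 => t; rewrite mulr_ge0// P_ge0.
have [K [K1 K2]] := ex_dyadic y0 yr.
set B := ball x (2 ^+ K * y).
have mB : measurable B by exact: measurable_ball.
have H1 : Int (fun t => \1_B t * (P y (x - t) * g t)) <= 5 * (e / 10).
  apply: ball_Poisson_le => // [|i iK]; first exact: ltW.
  apply: hr0; rewrite mulr_gt0 ?exprn_gt0//= (le_trans _ K1)// ler_wpM2r ?(ltW y0)//.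
  by rewrite ler_weXn2l// ler1n.
have H2 : Int (fun t => \1_(~` B) t * (P y (x - t) * g t)) <= y * C * M.
  rewrite -Int_scale; last exact: Vg.2.
  apply: Int_le; [exact: (integ_on (measurableC mB) iPg)|exact: (integ_scale _ Vg.2)|].
  move=> t; rewrite indicE; case: (boolP (t \in _)) => [|_]; last first.
    rewrite mul0r mulr_ge0//; first by rewrite mulr_ge0// ltW.
    by rewrite divr_ge0// ltW// sqr1_gt0.
  rewrite inE/= => nB; rewrite mul1r (ger0_norm (g0 t)).
  have hv : r0 / 2 <= `|x - t|.
    rewrite leNgt; apply/negP => hlt; apply: nB; rewrite /B /ball/=.
    by apply: (lt_le_trans hlt); move: K2; rewrite exprS; lra.
  have hv2 : (r0 / 2) ^+ 2 <= (x - t) ^+ 2.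
    rewrite -(real_normK (num_real (x - t))) lerXn2r// nnegrE ?normr_ge0//.
    by rewrite divr_ge0// ltW.
  have := sqr1_shift x t; move: (x - t) hv2 => v hv2 tx.
  have D := den_gt0 v y0.
  have v0 : 0 < v ^+ 2 by apply: lt_le_trans hv2; rewrite exprn_gt0// divr_gt0.
  rewrite mulrA [leRHS]mulrAC ler_wpM2r// /P ler_pdivrMr ?mulr_gt0//.
  rewrite mulrAC ler_pdivlMr ?sqr1_gt0// -!mulrA ler_wpM2l ?(ltW y0)//.
  apply: (le_trans tx); apply: (@le_trans _ _ (C * v ^+ 2)); last first.
    rewrite ler_wpM2l ?(ltW C0)//; apply: (@le_trans _ _ (v ^+ 2 + y ^+ 2)).
      by rewrite lerDl sqr_ge0.
    by rewrite ler_peMl// ltW.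
  rewrite [leLHS]addrC [leRHS](_ : _ = 2 * v ^+ 2 + (1 + 2 * x ^+ 2) * 4 / r0 ^+ 2 * v ^+ 2).
    rewrite lerD2l.
    have -> : (1 + 2 * x ^+ 2) * 4 / r0 ^+ 2 * v ^+ 2 = (1 + 2 * x ^+ 2) * (v ^+ 2 / (r0 / 2) ^+ 2).
      by field; rewrite gt_eqF.
    rewrite ler_peMr//; first by have := sqr_ge0 x; lra.
    by rewrite ler_pdivlMr ?mul1r// exprn_gt0// divr_gt0.
  by rewrite /C; ring.
have -> : Int (fun t => P y (x - t) * g t) =
   Int (fun t => \1_B t * (P y (x - t) * g t)) + Int (fun t => \1_(~` B) t * (P y (x - t) * g t)).
  rewrite -Int_add; [|exact: (integ_on mB iPg)|exact: (integ_on (measurableC mB) iPg)].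
  by apply: Int_eq => t; rewrite -mulrDl !indicE in_setC; case: (_ \in _); rewrite ?addr0 ?add0r mul1r.
have H3 : y * C * M <= e / 2.
  apply: (@le_trans _ _ (y * (C * M + 1))); first by rewrite -mulrA ler_wpM2l ?lerDl ?(ltW y0).
  by rewrite -ler_pdivlMr.
have arith (A1 A2 D : R) : A1 <= 5 * (e / 10) -> A2 <= D -> D <= e / 2 -> A1 + A2 <= e.
  by clear; lra.
exact: arith H1 H2 H3.
Unshelve. all: by end_near. Qed.

Lemma cvg_right_ext f g (l : R) : (forall y, 0 < y -> f y = g y) ->
  f y @[y --> 0^'+] --> l -> g y @[y --> 0^'+] --> l.
Proof.
move=> fg; apply: cvg_trans; apply: near_eq_cvg; near=> y; apply: fg.
by near: y; exact: nbhs_right_gt.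
Unshelve. all: by end_near. Qed.

Lemma cvg_right_seq f (l : R) : f y @[y --> 0^'+] --> l ->
  f n.+1%:R^-1 @[n --> \oo] --> l.
Proof.
move=> /cvg_at_rightP; apply; split; last exact: cvg_harmonic.
by move=> n; rewrite invr_gt0.
Qed.

Lemma cvg_right_lin f g (c k l : R) : f y @[y --> 0^'+] --> k -> g y @[y --> 0^'+] --> l ->
  c * f y + g y @[y --> 0^'+] --> c * k + l.
Proof. by move=> fk gl; apply: cvgD => //; exact: cvgMl_tmp. Qed.

Lemma Pc_Lpt f x : W f -> Lpt f x -> Pc y f x @[y --> 0^'+] --> f x.
Proof.
move=> Wf Lx; have := Poisson_Lpt Wf Lx => /cvgrPdist_le h.
apply/cvgrPdist_le => e e0; near=> y.
have y0 : 0 < y by near: y; exact: nbhs_right_gt.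
have Vf := W_V Wf.
rewrite distrC -[X in _ - X]mul1r -(Int_P x y0) mulrC -Int_scale; last exact: integ_P.
rewrite -Int_sub; [|exact: integ_Pf|exact/integ_scale/integ_P].
have H : Int (fun t => P y (x - t) * `|f t - f x|) <= e.
  have : `|0 - Int (fun t => P y (x - t) * `|f t - f x|)| <= e by near: y; exact: h.
  by rewrite sub0r normrN => /(le_trans (ler_norm _)).
apply: le_trans H; apply: Int_norm_le.
- apply: measurable_funB; first by apply: integ_meas; exact: integ_Pf.
  by apply: integ_meas; apply: integ_scale; exact: integ_P.
- by apply: integ_Pf => //; exact: V_dist.
- move=> t; rewrite (_ : _ - _ = P y (x - t) * (f t - f x)); last by ring.
  by rewrite normrM ger0_norm// P_ge0.
Unshelve. all: by end_near. Qed.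

(** * Truncated kernels *)

Definition T y x := if y < `|x| then (pi * x)^-1 else 0.

Lemma TN y x : T y (- x) = - T y x.
Proof. by rewrite /T normrN; case: ifP; rewrite ?oppr0// mulrN invrN. Qed.

Lemma meas_T y : measurable_fun setT (T y).
Proof.
rewrite (_ : T y = fun x => \1_[set z | y < `|z|] x * (pi * x)^-1).
  apply: measurable_funM.
    apply: measurable_indic; rewrite -[X in measurable X]setTI.
    have m : measurable_fun setT (fun z : R => `|z|) by exact: measurableT_comp.
    rewrite (_ : [set z | y < `|z|] = (fun z : R => `|z|) @^-1` `]y, +oo[).
      exact: m.
    by apply/seteqP; split => z /=; rewrite in_itv/= andbT.
  (* [1 / (pi x)] is the limit of [Q] as the height tends to 0, also at [x = 0], where both are
     0. *)
  apply: (@measurable_fun_cvg _ _ _ setT (fun n => Q n.+1%:R^-1)).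
    by move=> n; apply: meas_Q; rewrite invr_gt0.
  move=> x _; have [->|x0] := eqVneq x 0.
    rewrite mulr0 invr0; apply: cvg_near_cst; apply: nearW => n.
    by rewrite /Q mul0r.
  rewrite (_ : (pi * x)^-1 = x / (pi * (x ^+ 2 + 0 ^+ 2))); last first.
    by rewrite expr0n/= addr0; have := piN0; move: (pi : R) => p pN0; field; rewrite x0.
  apply: cvgMl_tmp; apply: cvg_inv_seq.
    by rewrite expr0n/= addr0 mulf_neq0// expf_neq0.
  apply: cvgMl_tmp; apply: cvgD; first exact: cvg_cst.
  by rewrite expr2; apply: cvg_mul_seq; exact: cvg_harmonic.
apply/funext => x; rewrite /T; case: ifPn => h; first by rewrite indicE1// mul1r.
by rewrite indicE0 ?mul0r//; exact/negP.
Qed.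

Lemma T_norm1 y x : 0 < y -> exists c : R, forall t, `|T y (x - t)| <= c / (1 + `|t|).
Proof.
move=> y0; exists ((1 + `|x|) / y + 1) => t.
have tx : 1 + `|t| <= 1 + `|x| + `|x - t|.
  by rewrite -addrA lerD2l -{1}(subKr x t) (le_trans (ler_normB _ _)).
rewrite /T; case: ifPn => h; last first.
  by rewrite normr0 divr_ge0 ?addr_ge0 ?divr_ge0 ?addr_ge0 ?(ltW y0).
move: (x - t) tx h => v tx h.
have v0 : 0 < `|v| by exact: lt_trans h.
rewrite normfV normrM (gtr0_norm pi0) ler_pdivlMr ?norm1_gt0// mulrC ler_pdivrMr ?mulr_gt0//.
apply: (le_trans tx); apply: (@le_trans _ _ (((1 + `|x|) / y + 1) * `|v|)).
  rewrite mulrDl mul1r lerD2r mulrAC -mulrA ler_peMr ?addr_ge0//.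
  by rewrite ler_pdivlMr// mul1r ltW.
rewrite ler_wpM2l ?addr_ge0 ?divr_ge0 ?addr_ge0 ?(ltW y0)//.
by rewrite ler_peMl.
Qed.

Lemma meas_Tsub y x : measurable_fun setT (fun t => T y (x - t)).
Proof. by apply: (measurableT_comp (meas_T y)); exact: meas_reflect. Qed.

Lemma integ_Tf y f x : 0 < y -> W f -> integ (fun t => T y (x - t) * f t).
Proof.
by move=> y0 Wf; have [c hc] := T_norm1 x y0; apply: W_mulr Wf _ hc; exact: meas_Tsub.
Qed.

Lemma truncE f x y : 0 < y -> W f ->
  truncated_hilbert f x y = Int (fun t => T y (x - t) * f t).
Proof.
move=> y0 Wf; rewrite /truncated_hilbert Int_on.
have E t : T y (x - t) * f t = pi^-1 * (\1_[set t | y < `|x - t|] t * (f t / (x - t))).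
  rewrite /T; case: ifPn => h; first by rewrite indicE1// invfM; ring.
  by rewrite indicE0 ?mul0r ?mulr0//; exact/negP.
rewrite (Int_eq E) Int_scale//.
have := integ_scale pi (integ_Tf x y0 Wf); apply: integ_eq => t.
by rewrite E mulrA divff// mul1r.
Qed.

Lemma Q_T_le y x : 0 < y -> `|Q y x - T y x| <= P y x.
Proof.
move=> y0; have D := den_gt0 x y0; rewrite /T; case: ifPn => h.
  have x0 : x != 0 by rewrite -normr_gt0; exact: lt_trans h.
  rewrite (_ : _ - _ = - (y ^+ 2 / (x * (pi * (x ^+ 2 + y ^+ 2))))); last first.
    by rewrite /Q; have := piN0; move: (pi : R) => p pN0; field; rewrite x0 pN0 gt_eqF.
  rewrite normrN normrM (ger0_norm (sqr_ge0 _)) normfV normrM.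
  rewrite (gtr0_norm (_ : 0 < pi * _)) ?mulr_gt0//.
  rewrite /P expr2 -mulrA ler_wpM2l ?(ltW y0)// invfM mulrA.
  rewrite ler_piMl ?invr_ge0 ?mulr_ge0 ?(ltW D)// ?(ltW pi0)//.
  by rewrite ler_pdivrMr ?mul1r ?(ltW h)// (lt_trans _ h).
rewrite subr0 /Q normrM normfV (gtr0_norm (_ : 0 < pi * _)) ?mulr_gt0//.
by rewrite ler_wpM2r ?invr_ge0 ?mulr_ge0 ?(ltW D) ?(ltW pi0)// leNgt.
Qed.

(** [k], the difference of the kernels [Q y] and [T y], is odd about [x], so its integral is 0 and
    [f t] may be replaced by [f t - f x]; by [Q_T_le] what remains is dominated by the Poisson
    average of [|f t - f x|]. *)
Lemma Qc_trunc_Lpt f x : W f -> Lpt f x ->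
  Qc y f x - truncated_hilbert f x y @[y --> 0^'+] --> 0.
Proof.
move=> Wf Lx; have := Poisson_Lpt Wf Lx => /cvgrPdist_le h.
apply/cvgrPdist_le => e e0; near=> y.
have y0 : 0 < y by near: y; exact: nbhs_right_gt.
have Vf := W_V Wf.
have H : Int (fun t => P y (x - t) * `|f t - f x|) <= e.
  have : `|0 - Int (fun t => P y (x - t) * `|f t - f x|)| <= e by near: y; exact: h.
  by rewrite sub0r normrN => /(le_trans (ler_norm _)).
apply: le_trans H; rewrite sub0r normrN truncE//.
pose k t := Q y (x - t) - T y (x - t).
have mk : measurable_fun setT k.
  by apply: measurable_funB; [exact: meas_Qsub|exact: meas_Tsub].
have kP t : `|k t| <= P y (x - t) by exact: Q_T_le.
have ik : integ k := integ_le mk (integ_P x y0) kP.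
have k0 : Int k = 0.
  apply: (Int_odd (x := x)) ik _ => t.
  by rewrite /k (_ : x - (2 * x - t) = - (x - t)) ?QN ?TN; ring.
rewrite -Int_sub; [|exact: integ_Qf|exact: integ_Tf].
rewrite -[X in `|X|]subr0 -(mulr0 (f x)) -k0 -Int_scale//.
have ikf : integ (fun t => Q y (x - t) * f t - T y (x - t) * f t).
  by apply: integ_sub; [exact: integ_Qf|exact: integ_Tf].
rewrite -Int_sub//; last exact: integ_scale.
apply: Int_norm_le.
- by apply: measurable_funB; apply: integ_meas => //; exact: integ_scale.
- by apply: integ_Pf => //; exact: V_dist.
- move=> t; rewrite (_ : _ - _ = k t * (f t - f x)); last by rewrite /k; ring.
  by rewrite normrM ler_wpM2r.
Unshelve. all: by end_near. Qed.

Definition Hlim f x (l : R) := truncated_hilbert f x y @[y --> 0^'+] --> l.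

Lemma Hlim_hilbert f x l : Hlim f x l -> hilbert f x = l.
Proof. by move=> h; rewrite /hilbert; apply/cvg_lim. Qed.

Lemma Hlim_Lpt f x (l : R) : W f -> Lpt f x -> Qc y f x @[y --> 0^'+] --> l -> Hlim f x l.
Proof.
move=> Wf Lx Ql; have := cvg_right_lin (c := -1) (Qc_trunc_Lpt Wf Lx) Ql.
by rewrite mulr0 add0r; apply: cvg_right_ext => y _; ring.
Qed.

Lemma Hlim_add (c : R) f g x (k l : R) : W f -> W g -> Hlim f x k -> Hlim g x l ->
  Hlim (fun t => c * f t + g t) x (c * k + l).
Proof.
move=> Wf Wg hf hg; have := cvg_right_lin (c := c) hf hg.
apply: cvg_right_ext => y y0; rewrite !truncE//; last by apply: W_add => //; exact: W_scale.
rewrite -Int_scale; last exact: integ_Tf.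
rewrite -Int_add; [|exact/integ_scale/integ_Tf|exact: integ_Tf].
by apply: Int_eq => t; ring.
Qed.

Lemma meas_trunc f y : 0 < y -> W f -> measurable_fun setT (fun x => truncated_hilbert f x y).
Proof.
move=> y0 Wf; rewrite (_ : (fun x => _) = fun x => Int (fun t => T y (x - t) * f t)).
  apply: measurable_Int; apply: meas2_mul; last by apply: meas2_snd; case: Wf.
  by apply: (meas2_comp (meas_T y)); exact: meas2_diff.
by apply/funext => x; exact: truncE.
Qed.

(** The inequality in [T] is strict, so the kernel vanishes where [|x - t| = y], and [T z] tends to
    [T y] pointwise as [z] decreases to [y]. *)
Lemma trunc_right_cont f x y : 0 < y -> W f ->
  truncated_hilbert f x z @[z --> y^'+] --> truncated_hilbert f x y.
Proof.
move=> y0 Wf; apply/cvg_at_rightP => v [vy vc].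
have v0 n : 0 < v n by exact: lt_trans (vy n).
rewrite truncE//; rewrite (_ : (fun n => _) = fun n => Int (fun t => T (v n) (x - t) * f t)); last first.
  by apply/funext => n; rewrite truncE.
have [] // := @Int_dct _ (fun n t => T (v n) (x - t) * f t) (fun t => T y (x - t) * f t)
  (fun t => `|T y (x - t) * f t|).
- by move=> n; apply: integ_meas; exact: integ_Tf.
- by apply: integ_abs; exact: integ_Tf.
- move=> t n; rewrite !normrM ler_wpM2r// /T; case: ifPn => [h|_]; last by rewrite normr0.
  by rewrite (lt_trans (vy n) h).
- move=> t; apply: cvgMr_tmp; rewrite {2}/T; case: ifPn => h; last first.
    apply: cvg_near_cst; near=> n; rewrite /T ifF//; apply/negbTE.
    by rewrite -leNgt (le_trans _ (ltW (vy n)))// leNgt.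
  apply: cvg_near_cst; near=> n; rewrite /T ifT//.
  by near: n; apply: (cvgr_lt y).
Unshelve. all: by end_near. Qed.

(** * Measurability of the Hilbert transform *)

Let ra (a b : nat) : R := a.+1%:R / b.+1%:R.

Let ra_gt0 (a b : nat) : 0 < ra a b. Proof. by rewrite divr_gt0. Qed.

Let ra_dense u (v : R) : 0 < u -> u < v -> exists a b : nat, u < ra a b < v.
Proof.
move=> u0 uv; have vu : 0 < v - u by rewrite subr_gt0.
pose b := Num.bound (v - u)^-1; exists (Num.truncn (u * b.+1%:R)), b.
have vui : 0 <= (v - u)^-1 by rewrite invr_ge0 ltW.
have hb : (v - u)^-1 < b.+1%:R.
  by apply: lt_trans (archi_boundP vui) _; rewrite ltr_nat.
have ub : 0 <= u * b.+1%:R by rewrite mulr_ge0// ltW.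
have /andP[h1 h2] := truncn_itv ub.
rewrite /ra ltr_pdivlMr// h2/= ltr_pdivrMr//.
rewrite -natr1; apply: (@le_lt_trans _ _ (u * b.+1%:R + 1)); first by rewrite lerD2r.
have : 1 < (v - u) * b.+1%:R by rewrite -ltr_pdivrMl// mulr1.
by lra.
Qed.

(* By right continuity of the truncations in the truncation parameter, the
   Cauchy criterion may be tested on a countable dense set of parameters. *)
Let conv_set f : set R := \bigcap_(i : nat) \bigcup_(n : nat)
  \bigcap_(a : nat) \bigcap_(b : nat) \bigcap_(c : nat) \bigcap_(d : nat)
  [set x | ra a b < n.+1%:R^-1 -> ra c d < n.+1%:R^-1 ->
    `|truncated_hilbert f x (ra a b) - truncated_hilbert f x (ra c d)| <= i.+1%:R^-1].

Let meas_conv_set f : W f -> measurable (conv_set f).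
Proof.
move=> Wf; apply: bigcapT_measurable => i; apply: bigcupT_measurable => n.
apply: bigcapT_measurable => a; apply: bigcapT_measurable => b.
apply: bigcapT_measurable => c; apply: bigcapT_measurable => d.
have [h1|h1] := boolP (ra a b < n.+1%:R^-1); last first.
  by rewrite (_ : [set _ | _] = setT)//; apply/seteqP; split => z // _.
have [h2|h2] := boolP (ra c d < n.+1%:R^-1); last first.
  by rewrite (_ : [set _ | _] = setT)//; apply/seteqP; split => z // _.
pose D z := `|truncated_hilbert f z (ra a b) - truncated_hilbert f z (ra c d)|.
have mD : measurable_fun setT D.
  by apply: measurableT_comp => //; apply: measurable_funB; exact: meas_trunc.
rewrite (_ : [set _ | _] = D @^-1` `]-oo, i.+1%:R^-1]).
  by rewrite -[X in measurable X]setTI; exact: mD.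
apply/seteqP; split => z /=; rewrite in_itv/=; first by apply.
by move=> h _ _.
Qed.

Let conv_setP f x : W f -> conv_set f x <-> cvg (truncated_hilbert f x y @[y --> 0^'+]).
Proof.
move=> Wf; split.
  move=> cx; apply: R_complete; apply/cauchy_ballP => e e0.
  have [i hi] : exists i : nat, i.+1%:R^-1 < e.
    exists (Num.bound e^-1); rewrite invf_plt ?posrE//.
    have ei : 0 <= e^-1 by rewrite invr_ge0 ltW.
    by apply: lt_trans (archi_boundP ei) _; rewrite ltr_nat.
  have [n _ hn] := cx i I.
  have n0 : (0 : R) < n.+1%:R^-1 by rewrite invr_gt0.
  have key p q : 0 < p < n.+1%:R^-1 -> 0 < q < n.+1%:R^-1 ->
      `|truncated_hilbert f x p - truncated_hilbert f x q| <= i.+1%:R^-1.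
    move=> /andP[p0 pn] /andP[q0 qn]; apply/ler_addgt0Pr => d d0.
    have d2 : 0 < d / 2 by rewrite divr_gt0.
    have near_ra (z : R) : 0 < z -> z < n.+1%:R^-1 -> exists a b : nat, ra a b < n.+1%:R^-1 /\
        `|truncated_hilbert f x z - truncated_hilbert f x (ra a b)| <= d / 2.
      move=> z0 zn; have := @trunc_right_cont f x z z0 Wf.
      move=> /cvgrPdist_le /(_ _ d2) [r /= r0 hr].
      have [|a [b /andP[h1 h2]]] := @ra_dense z (Num.min (z + r) n.+1%:R^-1) z0.
        by rewrite lt_min zn ltrDl r0.
      exists a, b; move: h2; rewrite lt_min => /andP[h2 h3]; split => //.
      by apply: hr => //=; rewrite ltr0_norm ?subr_lt0// opprB ltrBlDl.
    have [a [b [hab h1]]] := near_ra p p0 pn.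
    have [c [d' [hcd h2]]] := near_ra q q0 qn.
    have h3 := hn a I b I c I d' I hab hcd.
    rewrite (_ : _ - _ = (truncated_hilbert f x p - truncated_hilbert f x (ra a b)) +
       (truncated_hilbert f x (ra a b) - truncated_hilbert f x (ra c d')) -
       (truncated_hilbert f x q - truncated_hilbert f x (ra c d'))); last by ring.
    apply: le_trans (ler_normB _ _) _; apply: le_trans (lerD (ler_normD _ _) h2) _.
    exact: ler_halves h1 h3.
  exists ((fun y => truncated_hilbert f x y) @` [set y | 0 < y < n.+1%:R^-1],
          (fun y => truncated_hilbert f x y) @` [set y | 0 < y < n.+1%:R^-1]) => /=.
    have NB : \forall y \near 0^'+, [set truncated_hilbert f x y | y in [set y | 0 < y < n.+1%:R^-1]]
        (truncated_hilbert f x y).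
      near=> y; exists y => //=; have -> : 0 < y by near: y; exact: nbhs_right_gt.
      by near: y; exact: nbhs_right_lt.
    by split; exact: NB.
  move=> [_ _] /= [[p hp <-] [q hq <-]].
  by rewrite /ball/=; apply: le_lt_trans hi; exact: key.
move=> /cvg_ex[l /cvgrPdist_le cl] i _.
have i2 : (0 : R) < i.+1%:R^-1 / 2 by rewrite divr_gt0// invr_gt0.
have [r /= r0 hr] := cl _ i2.
exists (Num.bound r^-1) => // a _ b _ c _ d _ /=.
have ri : 0 <= r^-1 by rewrite invr_ge0 ltW.
have hb z : 0 < z -> z < (Num.bound r^-1).+1%:R^-1 -> `|l - truncated_hilbert f x z| <= i.+1%:R^-1 / 2.
  move=> z0 hz; apply: hr => //=; rewrite sub0r normrN gtr0_norm// (lt_trans hz)//.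
  rewrite invf_plt ?posrE//.
  by apply: lt_trans (archi_boundP ri) _; rewrite ltr_nat.
move=> /(hb _ (ra_gt0 a b)) h1 /(hb _ (ra_gt0 c d)) h2.
rewrite (_ : _ - _ = (l - truncated_hilbert f x (ra c d)) - (l - truncated_hilbert f x (ra a b))); last by ring.
by apply: le_trans (ler_normB _ _) _; rewrite [leRHS]splitr; exact: lerD.
Unshelve. all: by end_near. Qed.

(** Where the truncations converge, the value is the upper limit along [1 / (n + 1)]; elsewhere
    [lim] returns the constant [point]. Both pieces and the set of convergence are measurable. *)
Lemma meas_hilbert f : W f -> measurable_fun setT (hilbert f).
Proof.
move=> Wf.
pose g x := fine (limn_esup (fun n => (truncated_hilbert f x n.+1%:R^-1)%:E)).
have n0 (n : nat) : (0 : R) < n.+1%:R^-1 by rewrite invr_gt0.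
have mg : measurable_fun setT g.
  apply: measurableT_comp => //; apply: measurable_fun_limn_esup => n.
  by apply/measurable_EFinP; exact: meas_trunc.
rewrite (_ : hilbert f = fun x => \1_(conv_set f) x * g x + \1_(~` conv_set f) x * (point : R)).
  have m := meas_conv_set Wf.
  apply: measurable_funD; apply: measurable_funM => //; apply: measurable_indic => //.
  exact: measurableC.
apply/funext => x; have [cx|ncx] := pselect (conv_set f x); last first.
  rewrite (indicE0 ncx) (@indicE1 _ (~` conv_set f))// mul0r add0r mul1r /hilbert dvgP//.
  by move=> h; apply: ncx; exact/conv_setP.
rewrite (indicE1 cx) (@indicE0 _ (~` conv_set f)); last by move=> /(_ cx).
rewrite mul0r addr0 mul1r.
have /cvg_ex[l cl] := (conv_setP x Wf).1 cx.
rewrite (Hlim_hilbert cl) /g.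
have bE : (fun n => (truncated_hilbert f x n.+1%:R^-1)%:E) @ \oo --> l%:E.
  apply/cvg_EFin; first exact: nearW.
  by move/cvg_at_rightP : cl; apply; split => //; exact: cvg_harmonic.
rewrite is_cvg_limn_esupE; last by apply/cvg_ex; exists l%:E.
by rewrite (cvg_lim _ bE).
Qed.

End LebesguePoints.

(** * The Hilbert transform on L^2 *)

Section L2Theory.
Context {R : realType}.
Local Notation mu := (@lebesgue_measure R).
Implicit Types (f g h k : R -> R) (F G : R -> R -> R) (x y t a s u r : R).

Let pi0 : 0 < pi :> R := pi_gt0 R.
Let piN0 : pi != 0 :> R := lt0r_neq0 pi0.

Lemma integ_P_swap y t : 0 < y -> integ (fun x => P y (x - t)).
Proof. by move=> y0; apply: integ_eq (integ_P t y0) => x; rewrite PC. Qed.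

Lemma Int_P_swap y t : 0 < y -> Int (fun x => P y (x - t)) = 1.
Proof. by move=> y0; rewrite -(Int_P t y0); apply: Int_eq => x; rewrite PC. Qed.

Lemma L2_Q_swap y t : 0 < y -> L2 (fun x => Q y (x - t)).
Proof.
by move=> y0; rewrite (_ : (fun x => _) = fun x => - Q y (t - x));
  [exact/L2_opp/L2_Q|apply/funext => x; exact: QC].
Qed.

Lemma n2_Q_swap y t : n2 (fun x => Q y (x - t)) = n2 (fun x => Q y (t - x)).
Proof. by apply: Int_eq => x; rewrite QC sqrrN. Qed.

Lemma Int_mul_le f g : L2 f -> L2 g -> Int (fun x => `|f x * g x|) <= n2 f + n2 g.
Proof.
move=> fi gi; rewrite -Int_add; [|exact: fi.2|exact: gi.2].
apply: Int_le; [exact/integ_abs/L2_mul|by apply: integ_add; [exact: fi.2|exact: gi.2]|].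
move=> x; rewrite normrM -(real_normK (num_real (f x))) -(real_normK (num_real (g x))).
by have := sqr_ge0 (`|f x| - `|g x|); have := sqr_ge0 (`|f x| + `|g x|); nra.
Qed.

Lemma Pc_L1 y g : 0 < y -> integ g -> integ (Pc y g) /\ Int (Pc y g) = Int g.
Proof.
move=> y0 ig; pose F t x := g t * P y (x - t).
have mF : meas2 F.
  apply: meas2_mul; first (apply: meas2_fst; exact: integ_meas).
  by apply: (@meas2_swap _ (fun x t => P y (x - t))); exact: meas2_Psub.
have iF t : integ (F t) by exact/integ_scale/integ_P_swap.
have FG t : Int (fun x => `|F t x|) <= `|g t|.
  rewrite (@Int_eq _ _ (fun x => `|g t| * P y (x - t))).
    by rewrite Int_scale ?Int_P_swap ?mulr1//; exact: integ_P_swap.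
  by move=> x; rewrite /F normrM (ger0_norm (P_ge0 _ y0)).
have [_ _ h1 _ h2] := Int_fubini mF iF (integ_abs ig) FG.
have E x : Int (F ^~ x) = Pc y g x by apply: Int_eq => t; rewrite /F mulrC.
split; first exact: integ_eq h1.
rewrite -(Int_eq E) -h2; apply: Int_eq => t.
by rewrite (Int_scale (g t) (integ_P_swap t y0)) (Int_P_swap t y0) mulr1.
Qed.

(** Jensen's inequality: expand the nonnegative integral of [P y (x - t) * (f t - m) ^+ 2], where
    [P y] has mass 1. *)
Lemma Pc_sqr_le y f x : 0 < y -> L2 f -> (Pc y f x) ^+ 2 <= Pc y (fun t => f t ^+ 2) x.
Proof.
move=> y0 fi; set m := Pc y f x.
have V1 := W_V (W_L2 fi); have V2 := W_V (W_L1 fi.2).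
have i1 := integ_Pf x y0 V1; have i2 := integ_Pf x y0 V2; have i3 := integ_P x y0.
have : 0 <= Int (fun t => (P y (x - t) * f t ^+ 2 + m ^+ 2 * P y (x - t)) -
    (2 * m) * (P y (x - t) * f t)).
  apply: Int_ge0 => t; rewrite (_ : _ - _ = P y (x - t) * (f t - m) ^+ 2); last by ring.
  by rewrite mulr_ge0 ?sqr_ge0// P_ge0.
rewrite Int_sub; [|by apply: integ_add => //; exact: integ_scale|exact: integ_scale].
rewrite Int_add//; last exact: integ_scale.
have E1 : Int (fun t => m ^+ 2 * P y (x - t)) = m ^+ 2 by rewrite Int_scale// Int_P// mulr1.
have E2 : Int (fun t => 2 * m * (P y (x - t) * f t)) = 2 * m * m by rewrite Int_scale.
by rewrite E1 E2 -/(Pc y (fun t => f t ^+ 2) x); lra.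
Qed.

Lemma Pc_L2 y f : 0 < y -> L2 f -> L2 (Pc y f).
Proof.
move=> y0 fi; have [i _] := Pc_L1 y0 fi.2; have m := meas_Pc y0 fi.1.
split => //; apply: (integ_le _ i) => [|x]; first exact: measurable_funX.
by rewrite ger0_norm ?sqr_ge0//; exact: Pc_sqr_le.
Qed.

Lemma cvg_sqr0 (v : nat -> R) : v @ \oo --> (0 : R) -> v n ^+ 2 @[n --> \oo] --> (0 : R).
Proof. by move=> h; have := cvg_mul_seq h h; rewrite mulr0. Qed.

(** Convergence holds at Lebesgue points of [f] and of its square. The majorants [G n] vary with
    [n], but they all have integral [4 * n2 f], so [Int_fdct] applies. *)
Lemma Pc_cvg_L2 (v : nat -> R) f : (forall n, 0 < v n) -> v @ \oo --> (0 : R) -> L2 f ->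
  n2 (fun x => Pc (v n) f x - f x) @[n --> \oo] --> (0 : R).
Proof.
move=> v0 vc fi.
have vr g x (l : R) : Pc y g x @[y --> 0^'+] --> l -> Pc (v n) g x @[n --> \oo] --> l.
  by move=> H; have /cvg_at_rightP := H; apply; split.
have [W1 W2] := (W_L2 fi, W_L1 fi.2).
pose G n x := 2 * Pc (v n) (fun t => f t ^+ 2) x + 2 * f x ^+ 2.
have iG n : integ (G n).
  by apply: integ_add; apply: integ_scale; [exact: (Pc_L1 (v0 n) fi.2).1|exact: fi.2].
have L n := L2_sub (Pc_L2 (v0 n) fi) fi.
apply: (@Int_fdct _ (fun n x => (Pc (v n) f x - f x) ^+ 2) G (fun x => 4 * f x ^+ 2)).
- by move=> n; exact: (L n).2.
- exact: iG.
- exact/integ_scale/fi.2.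
- move=> n x; rewrite sqr_ge0/= /G.
  have := Pc_sqr_le x (v0 n) fi; have := sqr_ge0 (Pc (v n) f x + f x).
  by rewrite !expr2; nra.
- by move=> x; rewrite mulr_ge0// sqr_ge0.
- apply: aeS (ae_Lpt W1) => x Lx; apply: cvg_sqr0.
  have h : Pc (v n) f x - f x @[n --> \oo] --> 0.
    by rewrite -(subrr (f x)); apply: cvgB; [exact/vr/Pc_Lpt|exact: cvg_cst].
  exact: h.
- apply: aeS (ae_Lpt W2) => x Lx.
  rewrite (_ : 4 * _ = 2 * f x ^+ 2 + 2 * f x ^+ 2); last by ring.
  by apply: cvgD; [apply: cvgMl_tmp; exact: (vr _ _ _ (Pc_Lpt W2 Lx))|exact: cvg_cst].
- rewrite Int_scale; last exact: fi.2.
  apply: cvg_near_cst; apply: nearW => n; rewrite /G Int_add ?Int_scale.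
  all: try (by apply: integ_scale; [exact: (Pc_L1 (v0 n) fi.2).1]);
    try exact: (Pc_L1 (v0 n) fi.2).1; try exact: fi.2; try (by apply: integ_scale; exact: fi.2).
  by rewrite (Pc_L1 (v0 n) fi.2).2; ring.
Qed.

Lemma Q_bound y x : 0 < y -> `|Q y x| <= y^-1.
Proof.
move=> y0; have D := den_gt0 x y0.
rewrite /Q normrM normfV (gtr0_norm (_ : 0 < pi * _)) ?mulr_gt0//.
rewrite ler_pdivrMr ?mulr_gt0// -ler_pdivrMl ?invr_gt0// invrK.
have p1 : 1 <= pi :> R by have := pi_ge2 R; lra.
apply: (@le_trans _ _ (x ^+ 2 + y ^+ 2)); last by rewrite ler_peMl// ltW.
by rewrite -(real_normK (num_real x)); have := sqr_ge0 (`|x| - y); nra.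
Qed.

Lemma meas_sqrt : measurable_fun setT (@Num.sqrt R).
Proof. by apply: cont_meas => u; exact: sqrt_continuous. Qed.

(** Cauchy-Schwarz for the measure [|f t| dt]: the product [|Q| |f|] is split into [A] and [B], and
    then [|f t| Q (x - t)^2] is integrated in [x] first. *)
Lemma Qc_L2_of_L1 y f : 0 < y -> integ f -> L2 (Qc y f).
Proof.
move=> y0 fi; have mf := integ_meas fi; have fa := integ_abs fi.
have mQ := meas_Qc y0 mf.
pose F t x := `|f t| * Q y (x - t) ^+ 2.
have mF : meas2 F.
  apply: meas2_mul; first (apply: meas2_fst; exact: integ_meas).
  apply: (@meas2_swap _ (fun x t => Q y (x - t) ^+ 2)).
  rewrite (_ : (fun x t => _) = (fun x t => Q y (x - t) * Q y (x - t))).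
    by apply: meas2_mul; exact: meas2_Qsub.
  by apply/funext => x; apply/funext => t; rewrite expr2.
have iF t : integ (F t) by exact/integ_scale/(L2_Q_swap t y0).2.
have FG t : Int (fun x => `|F t x|) <= (pi * y)^-1 * `|f t|.
  rewrite (@Int_eq _ _ (F t)); last by move=> x; rewrite ger0_norm// mulr_ge0// sqr_ge0.
  rewrite Int_scale; last exact: (L2_Q_swap t y0).2.
  by rewrite mulrC ler_wpM2r// n2_Q_swap; exact: n2_Q_le.
have [_ _ h1 _ _] := Int_fubini mF iF (integ_scale (pi * y)^-1 fa) FG.
split => //; apply: (integ_le _ (integ_scale (Int (fun t => `|f t|)) h1)) => [|x].
  exact: measurable_funX.
rewrite ger0_norm ?sqr_ge0//.
pose A t := `|Q y (x - t)| * Num.sqrt `|f t|; pose B t := Num.sqrt `|f t|.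
have ms : measurable_fun setT B.
  by apply: (measurableT_comp meas_sqrt); exact: measurableT_comp.
have B2 t : B t ^+ 2 = `|f t| by rewrite sqr_sqrtr.
have LB : L2 B by split => //; apply: integ_eq fa => t; rewrite B2.
have LA : L2 A.
  apply: (L2_le _ (L2_scale y^-1 LB)) => [|t].
    apply: measurable_funM => //; apply: measurableT_comp => //; exact: meas_Qsub.
  rewrite /A normrM [leRHS]normrM normr_id (ger0_norm (_ : 0 <= y^-1)) ?invr_ge0 ?(ltW y0)//.
  by apply: ler_wpM2r => //; exact: Q_bound.
have CS := Cauchy_Schwarz LA LB.
have E1 : n2 B = Int (fun t => `|f t|) by apply: Int_eq.
have E2 : n2 A = Int (F ^~ x).
  by apply: Int_eq => t; rewrite exprMn B2 real_normK ?num_real// mulrC.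
rewrite E1 E2 mulrC in CS; apply: le_trans CS.
rewrite -(real_normK (num_real (Qc y f x))) lerXn2r// ?nnegrE ?normr_ge0//.
  by apply: Int_ge0 => t; rewrite /A /B !mulr_ge0// sqrtr_ge0.
apply: Int_norm_le.
- by apply: measurable_funM => //; exact: meas_Qsub.
- exact: L2_mul.
- move=> t; have -> : A t * B t = `|Q y (x - t)| * B t ^+ 2 by rewrite /A /B expr2 mulrA.
  by rewrite B2 normrM.
Qed.

Lemma Pc_Qc s y f x : 0 < s -> 0 < y -> L2 f -> Pc s (Qc y f) x = Qc (s + y) f x.
Proof.
move=> s0 y0 fi; pose F u t := P s (x - u) * (Q y (u - t) * f t).
have mF : meas2 F.
  apply: meas2_mul; first (apply: meas2_fst; exact: meas_Psub).
  by apply: meas2_mul; [exact: meas2_Qsub|(apply: meas2_snd; exact: fi.1)].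
have iQ u : integ (fun t => Q y (u - t) * f t) by apply: L2_mul => //; exact: L2_Q.
have iF u : integ (F u) by exact: integ_scale.
have FG u : Int (fun t => `|F u t|) <= ((pi * y)^-1 + n2 f) * P s (x - u).
  rewrite (@Int_eq _ _ (fun t => P s (x - u) * `|Q y (u - t) * f t|)); last first.
    by move=> t; rewrite /F normrM (ger0_norm (P_ge0 _ s0)).
  rewrite Int_scale; last exact: integ_abs.
  rewrite [leRHS]mulrC ler_wpM2l ?P_ge0//; apply: le_trans (Int_mul_le (L2_Q u y0) fi) _.
  by rewrite lerD2r; exact: n2_Q_le.
have [_ _ _ _ h] := Int_fubini mF iF (integ_scale _ (integ_P x s0)) FG.
have -> : Pc s (Qc y f) x = Int (fun u => Int (F u)).
  by apply: Int_eq => u; rewrite /F Int_scale.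
rewrite h; apply: Int_eq => t; rewrite -(PQ_conv x t s0 y0) mulrC.
have <- : Int (fun u => f t * (P s (x - u) * Q y (u - t))) = f t * Int (fun u => P s (x - u) * Q y (u - t)).
  by apply: Int_scale; apply: L2_mul; [exact: L2_P|exact: L2_Q_swap].
by apply: Int_eq => u; rewrite /F mulrA mulrC.
Qed.

Lemma Qc_Qc s y f x : 0 < s -> 0 < y -> integ f -> Qc s (Qc y f) x = - Pc (s + y) f x.
Proof.
move=> s0 y0 fi; pose F t u := f t * (Q s (x - u) * Q y (u - t)).
have mf := integ_meas fi.
have mF : meas2 F.
  apply: meas2_mul; first exact: meas2_fst.
  apply: meas2_mul; first (apply: meas2_snd; exact: meas_Qsub).
  by apply: (@meas2_swap _ (fun x t => Q y (x - t))); exact: meas2_Qsub.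
have iQ t : integ (fun u => Q s (x - u) * Q y (u - t)).
  by apply: L2_mul; [exact: L2_Q|exact: L2_Q_swap].
have iF t : integ (F t) by exact: integ_scale.
have FG t : Int (fun u => `|F t u|) <= ((pi * s)^-1 + (pi * y)^-1) * `|f t|.
  rewrite (@Int_eq _ _ (fun u => `|f t| * `|Q s (x - u) * Q y (u - t)|)); last first.
    by move=> u; rewrite /F normrM.
  rewrite Int_scale; last exact: integ_abs.
  rewrite [leRHS]mulrC ler_wpM2l//.
  apply: le_trans (Int_mul_le (L2_Q x s0) (L2_Q_swap t y0)) _.
  by rewrite lerD// ?n2_Q_swap; exact: n2_Q_le.
have [_ _ _ _ h] := Int_fubini mF iF (integ_scale _ (integ_abs fi)) FG.
have -> : Qc s (Qc y f) x = Int (fun u => Int (F ^~ u)).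
  apply: Int_eq => u; have <- : Int (fun t => Q s (x - u) * (Q y (u - t) * f t)) = Q s (x - u) * Qc y f u.
    exact: (Int_scale (Q s (x - u)) (integ_Qf u y0 (W_L1 fi))).
  by apply: Int_eq => t; rewrite /F mulrA mulrC.
have ip : integ (fun t => P (s + y) (x - t) * f t).
  by apply: integ_Pf; [exact: addr_gt0|exact/W_V/W_L1].
rewrite -h /Pc -(Int_opp ip); apply: Int_eq => t.
have -> : Int (F t) = f t * Int (fun u => Q s (x - u) * Q y (u - t)) by exact: Int_scale.
by rewrite (QQ_conv x t s0 y0) mulrN mulrC.
Qed.

Lemma Qc_adj s h f : 0 < s -> L2 h -> integ f ->
  Int (fun x => h x * Qc s f x) = - Int (fun t => f t * Qc s h t).
Proof.
move=> s0 Lh fi; pose F t x := f t * (h x * Q s (x - t)).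
have mf := integ_meas fi.
have mF : meas2 F.
  apply: meas2_mul; first exact: meas2_fst.
  apply: meas2_mul; first (apply: meas2_snd; exact: Lh.1).
  by apply: (@meas2_swap _ (fun x t => Q s (x - t))); exact: meas2_Qsub.
have iQ t : integ (fun x => h x * Q s (x - t)).
  by apply: L2_mul => //; exact: L2_Q_swap.
have iF t : integ (F t) by exact: integ_scale.
have FG t : Int (fun x => `|F t x|) <= (n2 h + (pi * s)^-1) * `|f t|.
  rewrite (@Int_eq _ _ (fun x => `|f t| * `|h x * Q s (x - t)|)); last first.
    by move=> x; rewrite /F normrM.
  rewrite Int_scale; last exact: integ_abs.
  rewrite [leRHS]mulrC ler_wpM2l//.
  apply: le_trans (Int_mul_le Lh (L2_Q_swap t s0)) _.
  by rewrite lerD2l n2_Q_swap; exact: n2_Q_le.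
have [i1 _ _ _ e] := Int_fubini mF iF (integ_scale _ (integ_abs fi)) FG.
have -> : Int (fun x => h x * Qc s f x) = Int (fun x => Int (F ^~ x)).
  apply: Int_eq => x; have <- : Int (fun t => h x * (Q s (x - t) * f t)) = h x * Qc s f x.
    exact: (Int_scale (h x) (integ_Qf x s0 (W_L1 fi))).
  by apply: Int_eq => t; rewrite /F mulrA mulrC.
have E t : Int (F t) = - (f t * Qc s h t).
  have -> : Int (F t) = f t * Int (fun x => h x * Q s (x - t)) by exact: Int_scale.
  rewrite -mulrN; congr (_ * _); rewrite /Qc -(Int_opp (integ_Qf t s0 (W_L2 Lh))).
  by apply: Int_eq => x; rewrite QC mulrN mulrC.
have i2 : integ (fun t => - (f t * Qc s h t)) := integ_eq E i1.
rewrite -e -(Int_opp (integ_eq (fun t => opprK _) (integ_opp i2))).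
exact: Int_eq.
Qed.

(** Antisymmetry moves one [Q] to the other side, and two of them compose to minus a [P]. Because
    only [s + y] enters, [Qc y f] is a Cauchy family in L^2 as [y] tends to 0. *)
Lemma Qc_Qc_pair y s f : 0 < y -> 0 < s -> integ f -> L2 f ->
  Int (fun x => Qc y f x * Qc s f x) = Int (fun t => f t * Pc (s + y) f t).
Proof.
move=> y0 s0 fi fi2; have Vf := W_V (W_L2 fi2).
have sy : 0 < s + y by exact: addr_gt0.
have i1 : integ (fun t => f t * Pc (s + y) f t) by apply: L2_mul => //; exact: Pc_L2.
have h := Qc_adj s0 (Qc_L2_of_L1 y0 fi) fi; apply: (etrans h).
have -> : Int (fun t => f t * Qc s (Qc y f) t) = - Int (fun t => f t * Pc (s + y) f t).
  by rewrite -(Int_opp i1); apply: Int_eq => t; rewrite (Qc_Qc t s0 y0 fi) mulrN.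
exact: opprK.
Qed.

Lemma Q_mono y r x : 0 < y -> 0 <= r -> `|Q (y + r) x| <= `|Q y x|.
Proof.
move=> y0 r0; have yr : 0 < y + r by rewrite ltr_pwDl.
rewrite /Q !normrM ler_wpM2l// !normfV lef_pV2 ?posrE ?normr_gt0 ?gt_eqF ?mulr_gt0 ?den_gt0//.
rewrite !gtr0_norm ?mulr_gt0 ?den_gt0// ler_pM2l// lerD2l lerXn2r ?nnegrE ?(ltW y0) ?(ltW yr)//.
by rewrite lerDl.
Qed.

Lemma P_mono y r x : 0 < y -> 0 <= r <= 1 -> `|P (y + r) x| <= (y + 1) / y * P y x.
Proof.
move=> y0 /andP[r0 r1]; have yr : 0 < y + r by rewrite ltr_pwDl.
rewrite ger0_norm ?P_ge0// /P mulrA divfK ?gt_eqF//.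
apply: ler_pM; rewrite ?invr_ge0 ?mulr_ge0 ?(ltW pi0) ?(ltW (den_gt0 _ _)) ?(ltW yr)//.
  by rewrite lerD2l.
rewrite lef_pV2 ?posrE ?mulr_gt0 ?den_gt0// ler_pM2l// lerD2l lerXn2r ?nnegrE ?(ltW y0) ?(ltW yr)//.
by rewrite lerDl.
Qed.

Lemma cvg_seq_unique (v : nat -> R) (k l : R) : v @ \oo --> k -> v @ \oo --> l -> k = l.
Proof. by move=> vk vl; rewrite -(cvg_lim (@Rhausdorff R) vk); exact/cvg_lim. Qed.

(** * Continuity in the height, and conjugate functions in L^2 *)

Let e_ (n : nat) : R := n.+1%:R^-1.
Let e_gt0 n : 0 < e_ n. Proof. by rewrite invr_gt0. Qed.
Let e_le1 n : e_ n <= 1. Proof. by rewrite invf_le1// ler1n. Qed.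
Let e_cvg : e_ @ \oo --> (0 : R). Proof. exact: cvg_harmonic. Qed.

Lemma cvg_den_shift y x : pi * (x ^+ 2 + (y + e_ n) ^+ 2) @[n --> \oo] --> pi * (x ^+ 2 + y ^+ 2).
Proof.
have h : y + e_ n @[n --> \oo] --> y.
  by rewrite -[X in _ --> X]addr0; apply: cvgD => //; exact: cvg_cst.
by apply: cvgMl_tmp; apply: cvgD; [exact: cvg_cst|rewrite expr2; exact: cvg_mul_seq].
Qed.

Lemma Qc_cont y f x : 0 < y -> W f -> Qc (y + e_ n) f x @[n --> \oo] --> Qc y f x.
Proof.
move=> y0 Wf; have ye n : 0 < y + e_ n by exact: addr_gt0.
have [] // := @Int_dct _ (fun n t => Q (y + e_ n) (x - t) * f t) (fun t => Q y (x - t) * f t)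
  (fun t => `|Q y (x - t) * f t|).
- by move=> n; apply: integ_meas; exact: integ_Qf.
- by apply: integ_abs; exact: integ_Qf.
- by move=> t n; rewrite [leLHS]normrM [leRHS]normrM ler_wpM2r//; apply: Q_mono => //; exact: ltW.
- move=> t; apply: cvgMr_tmp; apply: cvgMl_tmp; apply: cvg_inv_seq; last exact: cvg_den_shift.
  by rewrite gt_eqF// mulr_gt0// den_gt0.
Qed.

Lemma Pc_cont y f x : 0 < y -> W f -> Pc (y + e_ n) f x @[n --> \oo] --> Pc y f x.
Proof.
move=> y0 Wf; have ye n : 0 < y + e_ n by exact: addr_gt0.
have Vf := W_V Wf.
have [] // := @Int_dct _ (fun n t => P (y + e_ n) (x - t) * f t) (fun t => P y (x - t) * f t)
  (fun t => (y + 1) / y * `|P y (x - t) * f t|).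
- by move=> n; apply: integ_meas; exact: integ_Pf.
- by apply: integ_scale; apply: integ_abs; exact: integ_Pf.
- move=> t n; rewrite [leLHS]normrM (normrM (P y _)) mulrA ler_wpM2r// (ger0_norm (P_ge0 (x - t) y0)).
  by apply: P_mono => //; rewrite e_le1 ltW.
- move=> t; apply: cvgMr_tmp; apply: cvg_mul_seq.
    by rewrite -[X in _ --> X]addr0; apply: cvgD => //; exact: cvg_cst.
  apply: cvg_inv_seq; last exact: cvg_den_shift.
  by rewrite gt_eqF// mulr_gt0// den_gt0.
Qed.

(* [g] is the conjugate of [f]: the boundary values of [Pc y f + i Qc y f],
   analytic in the upper half-plane, are [f + i g]. *)
Definition conj_pair f g := [/\ L2 f, L2 g & forall y x, 0 < y ->
  Pc y g x = Qc y f x /\ Qc y g x = - Pc y f x].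

Lemma Pc_L2cvg (b : nat -> R -> R) g y x : 0 < y -> (forall n, L2 (b n)) -> L2 g ->
  n2 (fun x => b n x - g x) @[n --> \oo] --> (0 : R) ->
  Pc y (b n) x @[n --> \oo] --> Pc y g x.
Proof.
move=> y0 Lb Lg bg; have := L2_cvg0_pair (L2_P x y0) Lg Lb bg.
rewrite (_ : Pc y g x = Int (fun t => g t * P y (x - t))).
  by rewrite (_ : (fun n => Pc y (b n) x) = fun n => Int (fun t => b n t * P y (x - t)))//;
    apply/funext => n; apply: Int_eq => t; rewrite mulrC.
by apply: Int_eq => t; rewrite mulrC.
Qed.

Lemma Qc_L2cvg (b : nat -> R -> R) g y x : 0 < y -> (forall n, L2 (b n)) -> L2 g ->
  n2 (fun x => b n x - g x) @[n --> \oo] --> (0 : R) ->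
  Qc y (b n) x @[n --> \oo] --> Qc y g x.
Proof.
move=> y0 Lb Lg bg; have := L2_cvg0_pair (L2_Q x y0) Lg Lb bg.
rewrite (_ : Qc y g x = Int (fun t => g t * Q y (x - t))).
  by rewrite (_ : (fun n => Qc y (b n) x) = fun n => Int (fun t => b n t * Q y (x - t)))//;
    apply/funext => n; apply: Int_eq => t; rewrite mulrC.
by apply: Int_eq => t; rewrite mulrC.
Qed.

Lemma conj_pair_closed (a b : nat -> R -> R) f g : (forall n, conj_pair (a n) (b n)) ->
  L2 f -> L2 g ->
  n2 (fun x => a n x - f x) @[n --> \oo] --> (0 : R) ->
  n2 (fun x => b n x - g x) @[n --> \oo] --> (0 : R) -> conj_pair f g.
Proof.
move=> ab Lf Lg af bg; split => // y x y0.
have La n : L2 (a n) by case: (ab n).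
have Lb n : L2 (b n) by case: (ab n).
have E n : Pc y (b n) x = Qc y (a n) x /\ Qc y (b n) x = - Pc y (a n) x.
  by have [_ _] := ab n; exact.
split.
  have H : Pc y (b n) x @[n --> \oo] --> Qc y f x.
    rewrite (_ : (fun n => _) = fun n => Qc y (a n) x); first exact: Qc_L2cvg.
    by apply/funext => n; case: (E n).
  have c1 := @Pc_L2cvg _ _ _ x y0 Lb Lg bg; exact: (@cvg_seq_unique (fun n => Pc y (b n) x) _ _ c1 H).
have H : Qc y (b n) x @[n --> \oo] --> - Pc y f x.
  rewrite (_ : (fun n => Qc y (b n) x) = fun n => - Pc y (a n) x).
    by apply: cvgN; exact: Pc_L2cvg.
  by apply/funext => n; case: (E n).
have c1 := @Qc_L2cvg _ _ _ x y0 Lb Lg bg; exact: (@cvg_seq_unique (fun n => Qc y (b n) x) _ _ c1 H).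
Qed.

Lemma Pc_lin (c : R) f g y x : 0 < y -> W f -> W g ->
  Pc y (fun t => c * f t + g t) x = c * Pc y f x + Pc y g x.
Proof.
move=> y0 Wf Wg; have [Vf Vg] := (W_V Wf, W_V Wg).
rewrite /Pc -Int_scale; last exact: integ_Pf.
rewrite -Int_add; [|exact/integ_scale/integ_Pf|exact: integ_Pf].
by apply: Int_eq => t; ring.
Qed.

Lemma Qc_lin (c : R) f g y x : 0 < y -> W f -> W g ->
  Qc y (fun t => c * f t + g t) x = c * Qc y f x + Qc y g x.
Proof.
move=> y0 Wf Wg; rewrite /Qc -Int_scale; last exact: integ_Qf.
rewrite -Int_add; [|exact/integ_scale/integ_Qf|exact: integ_Qf].
by apply: Int_eq => t; ring.
Qed.

Lemma conj_pair_lin (c : R) f g f' g' : conj_pair f f' -> conj_pair g g' ->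
  conj_pair (fun t => c * f t + g t) (fun t => c * f' t + g' t).
Proof.
move=> [Lf Lf' hf] [Lg Lg' hg]; split; try by apply: L2_add => //; exact: L2_scale.
move=> y x y0; have [f1 f2] := hf y x y0; have [g1 g2] := hg y x y0.
by rewrite !Pc_lin ?Qc_lin//; try exact: W_L2; rewrite f1 f2 g1 g2; split => //; ring.
Qed.

(** Since [Qc y f = Pc y g], it converges at Lebesgue points of [g]; Lebesgue points of [f] pass the
    limit on to the truncations. *)
Lemma conj_pair_ae f g : conj_pair f g -> {ae mu, forall x, Hlim f x (g x)}.
Proof.
move=> [Lf Lg h]; apply: aeS2 (ae_Lpt (W_L2 Lf)) (ae_Lpt (W_L2 Lg)) => x Lfx Lgx.
apply: Hlim_Lpt => //; first exact: W_L2.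
apply: cvg_right_ext (Pc_Lpt (W_L2 Lg) Lgx) => y y0.
by have [] := h y x y0.
Qed.

Lemma Hlim_unique f x (k l : R) : Hlim f x k -> Hlim f x l -> k = l.
Proof. by move=> /Hlim_hilbert <- /Hlim_hilbert. Qed.

Lemma conj_pair_norm_unique f g g' : conj_pair f g -> conj_pair f g' -> n2 g = n2 g'.
Proof.
move=> h h'; have [_ Lg _] := h; have [_ Lg' _] := h'.
apply: Int_ae; [(apply: measurable_funX; exact: Lg.1)|(apply: measurable_funX; exact: Lg'.1)|].
apply: aeS2 (conj_pair_ae h) (conj_pair_ae h') => x h1 h2.
by rewrite (Hlim_unique h1 h2).
Qed.

(** The squared distance of [b n] and [b m] is [p (2 e_n) + p (2 e_m) - 2 p (e_m + e_n)], which
    tends to 0 because [p] has a limit at 0. The limit [g] inherits the two conjugacy identities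
    from the semigroup laws at height [y + e_ n]. *)
Lemma conj_exists_L1 f : integ f -> L2 f -> exists2 g, conj_pair f g & n2 g = n2 f.
Proof.
move=> fi Lf; have Wf := W_L1 fi.
pose b n := Qc (e_ n) f.
have Lb n : L2 (b n) by exact: Qc_L2_of_L1.
pose p y := Int (fun t => f t * Pc y f t).
have pc : p y @[y --> 0^'+] --> n2 f.
  apply/cvg_at_rightP => v [v0 vc].
  rewrite (_ : (fun n => p (v n)) = fun n => Int (fun t => Pc (v n) f t * f t)); last first.
    by apply/funext => n; apply: Int_eq => t; rewrite mulrC.
  rewrite (_ : n2 f = Int (fun t => f t * f t)); last by apply: Int_eq => t; rewrite expr2.
  apply: L2_cvg0_pair => //; first by move=> n; exact: Pc_L2.
  exact: Pc_cvg_L2.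
have nbb n : n2 (b n) = p (e_ n + e_ n).
  by rewrite /p -Qc_Qc_pair//; apply: Int_eq => x; rewrite expr2.
have nb n m : n2 (fun x => b n x - b m x) = p (e_ n + e_ n) + p (e_ m + e_ m) - 2 * p (e_ m + e_ n).
  have h3 : Int (fun x => b n x * b m x) = p (e_ m + e_ n).
    exact: (Qc_Qc_pair (e_gt0 n) (e_gt0 m) fi Lf).
  have h1 := nbb n; have h2 := nbb m; have h := n2_sub (Lb n) (Lb m).
  by rewrite h1 h2 h3 in h.
clearbody p.
have [|g Lg bg] := @L2_complete _ b Lb.
  move=> e e0; have e4 : 0 < e / 4 by rewrite divr_gt0.
  move/cvgrPdist_le : pc => /(_ _ e4) [r /= r0 hr].
  have r2 : 0 < r / 2 by rewrite divr_gt0.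
  move/cvgrPdist_lt : e_cvg => /(_ _ r2) [N _ hN].
  exists N => n m Nn Nm; rewrite nb.
  have ee i j : (N <= i)%N -> (N <= j)%N -> n2 f - e / 4 <= p (e_ i + e_ j) <= n2 f + e / 4.
    move=> Ni Nj; rewrite -ler_distlC; apply: hr => /=; last exact: addr_gt0.
    rewrite sub0r normrN gtr0_norm ?addr_gt0//.
    have := hN i Ni; have := hN j Nj; rewrite /= !sub0r !normrN !gtr0_norm//.
    by move=> h1 h2; rewrite (splitr r); exact: ltrD.
  have /andP[h1 h2] := ee n n Nn Nn; have /andP[h3 h4] := ee m m Nm Nm.
  by have /andP[h5 h6] := ee m n Nm Nn; lra.
exists g.
  split => // y x y0.
  have c1 := @Pc_L2cvg _ _ _ x y0 Lb Lg bg.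
  have c2 := @Qc_L2cvg _ _ _ x y0 Lb Lg bg.
  split.
    apply: (cvg_seq_unique c1).
    rewrite (_ : (fun n => _) = fun n => Qc (y + e_ n) f x); first exact: Qc_cont.
    by apply/funext => n; rewrite Pc_Qc.
  apply: (cvg_seq_unique c2).
  rewrite (_ : (fun n => _) = fun n => - Pc (y + e_ n) f x).
    by apply: cvgN; exact: Pc_cont.
  by apply/funext => n; rewrite Qc_Qc.
have H : n2 (b n) @[n --> \oo] --> n2 f.
  rewrite (_ : (fun n => _) = fun n => p (e_ n + e_ n)); last exact/funext.
  move/cvg_at_rightP : pc; apply; split; first by move=> n; exact: addr_gt0.
  by rewrite -[X in _ --> X](addr0 0); exact: cvgD.
have c1 := L2_cvg_norm Lg Lb bg; exact: (@cvg_seq_unique (fun n => n2 (b n)) _ _ c1 H).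
Qed.

Lemma L2_exhaust f : L2 f ->
  n2 (fun x => \1_`[- n%:R, n%:R] x * f x - f x) @[n --> \oo] --> (0 : R).
Proof.
move=> Lf.
have [] // := @Int_dct _ (fun n x => (\1_`[- n%:R, n%:R] x * f x - f x) ^+ 2) (fun=> 0)
  (fun x => f x ^+ 2).
- by move=> n; apply/measurable_funX/measurable_funB; [apply: (L2_on _ Lf).1|exact: Lf.1].
- exact: Lf.2.
- move=> x n; rewrite ger0_norm ?sqr_ge0// indicE; case: (_ \in _) => /=.
    by rewrite mul1r subrr expr0n/= sqr_ge0.
  by rewrite mul0r sub0r sqrrN.
- move=> x; have h : \1_`[- n%:R, n%:R] x * f x - f x @[n --> \oo] --> 0.
    rewrite -(subrr (f x)); apply: cvgB; last exact: cvg_cst.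
    by rewrite -[X in _ --> X]mul1r; apply: cvgMr_tmp; exact: cvg_indic_itv.
  exact: cvg_sqr0 h.
by move=> _ _; rewrite Int0.
Qed.

Lemma L2_exhaust_integ f (n : nat) : L2 f -> integ (fun x => \1_`[- n%:R, n%:R] x * f x).
Proof.
move=> Lf; apply: L2_mul => //; split; first exact: measurable_indic.
have : integ (\1_`[- n%:R, n%:R] : R -> R) by exact: integrable_indic_itv.
by apply: integ_eq => x; rewrite indicE; case: (_ \in _) => /=; rewrite ?expr1n ?expr0n.
Qed.

(** The conjugates of the truncations [a n] differ by a conjugate of [a n - a m], which has the same
    norm as the one given by [conj_exists_L1]; so they are Cauchy along with [a n]. *)
Lemma conj_exists f : L2 f -> exists2 g, conj_pair f g & n2 g = n2 f.
Proof.
move=> Lf; pose a n x := \1_`[- n%:R, n%:R] x * f x.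
have La n : L2 (a n) by exact: L2_on.
have ia n : integ (a n) by exact: L2_exhaust_integ.
have af := L2_exhaust Lf.
have /choice[b hb] (n : nat) : exists b, conj_pair (a n) b /\ n2 b = n2 (a n).
  by have [b h1 h2] := conj_exists_L1 (ia n) (La n); exists b.
have Lb n : L2 (b n) by case: (hb n) => -[].
have nab n m : n2 (fun x => b n x - b m x) = n2 (fun x => a n x - a m x).
  have iam : integ (fun x => a n x - a m x) by exact: integ_sub.
  have Lam : L2 (fun x => a n x - a m x) by exact: L2_sub.
  have [g hg <-] := conj_exists_L1 iam Lam.
  have h := conj_pair_lin (-1) (hb m).1 (hb n).1.
  have E : (fun t => -1 * a m t + a n t) = (fun x => a n x - a m x).
    by apply/funext => t; ring.
  rewrite E in h; rewrite -(conj_pair_norm_unique h hg).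
  by apply: Int_eq => x; congr (_ ^+ 2); ring.
have [|g Lg bg] := @L2_complete _ b Lb.
  move=> e e0; have e4 : 0 < e / 4 by rewrite divr_gt0.
  move/cvgrPdist_le : af => /(_ _ e4) [N _ hN].
  exists N => n m Nn Nm; rewrite nab.
  have := hN n Nn; have := hN m Nm; rewrite /= !sub0r !normrN !ger0_norm ?n2_ge0//.
  move=> h1 h2; have := n2_tri (L2_sub (La n) Lf) (L2_sub Lf (La m)).
  rewrite (n2_subC f (a m)).
  rewrite (@Int_eq _ _ (fun x => (a n x - a m x) ^+ 2)); last by move=> x; congr (_ ^+ 2); ring.
  move=> h3; apply: (le_trans h3).
  by rewrite /a; lra.
have Hfg : conj_pair f g by apply: (conj_pair_closed (fun n => (hb n).1)).
exists g => //.
have H : n2 (b n) @[n --> \oo] --> n2 f.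
  rewrite (_ : (fun n => _) = fun n => n2 (a n)); first exact: L2_cvg_norm.
  by apply/funext => n; case: (hb n).
have c1 := L2_cvg_norm Lg Lb bg; exact: (@cvg_seq_unique (fun n => n2 (b n)) _ _ c1 H).
Qed.

(** [hilbert f] is measurable and equals the conjugate [g] almost everywhere; all properties of [g]
    are expressed by integrals or hold almost everywhere, so they transfer. *)
Lemma hilbert_L2 f : L2 f -> [/\ conj_pair f (hilbert f), n2 (hilbert f) = n2 f &
  {ae mu, forall x, Hlim f x (hilbert f x)}].
Proof.
move=> Lf; have [g Hg ng] := conj_exists Lf; have [_ Lg hg] := Hg.
have ae1 := conj_pair_ae Hg; have mh := meas_hilbert (W_L2 Lf).
have gh : {ae mu, forall x, g x = hilbert f x}.
  by apply: aeS ae1 => x /Hlim_hilbert.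
have Lh := L2_ae Lg mh gh.
have E k : measurable_fun setT k -> Int (fun t => k t * g t) = Int (fun t => k t * hilbert f t).
  move=> mk; apply: Int_ae; [exact: measurable_funM mk Lg.1|exact: measurable_funM|].
  by apply: aeS gh => t ->.
split.
- split => // y x y0; have [<- <-] := hg y x y0.
  by rewrite /Pc /Qc -!E//; [exact: meas_Qsub|exact: meas_Psub].
- rewrite -ng; apply: Int_ae; [exact: measurable_funX|(apply: measurable_funX; exact: Lg.1)|].
  by apply: aeS gh => t ->.
- by apply: aeS2 ae1 gh => x h1 <-.
Qed.

Lemma Qc_hilbert f x : L2 f -> Lpt (hilbert f) x -> Qc y f x @[y --> 0^'+] --> hilbert f x.
Proof.
move=> Lf lx; have [[_ Lh h] _ _] := hilbert_L2 Lf.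
by apply: cvg_right_ext (Pc_Lpt (W_L2 Lh) lx) => y y0; have [] := h y x y0.
Qed.

End L2Theory.

(** * The square of an analytic function *)

Section Bilinear.
Context {R : realType}.
Local Notation mu := (@lebesgue_measure R).
Implicit Types (f g h k : R -> R) (F G : R -> R -> R) (x y t a s u r : R).

Let pi0 : 0 < pi :> R := pi_gt0 R.
Let piN0 : pi != 0 :> R := lt0r_neq0 pi0.

(** Multiplication of [f + i g] by [- i]: the Hilbert transform squares to -1. *)
Lemma conj_pair_opp f g : conj_pair f g -> conj_pair g (fun t => - f t).
Proof.
move=> [Lf Lg h]; split => //; first exact: L2_opp.
move=> y x y0; have [-> ->] := h y x y0.
have E1 : Pc y (fun t => - f t) x = - Pc y f x.
  by rewrite /Pc -(Int_opp (integ_Pf x y0 (W_V (W_L2 Lf)))); apply: Int_eq => t; rewrite mulrN.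
have E2 : Qc y (fun t => - f t) x = - Qc y f x.
  by rewrite /Qc -(Int_opp (integ_Qf x y0 (W_L2 Lf))); apply: Int_eq => t; rewrite mulrN.
by split.
Qed.

Lemma L2_bound g k (c : R) : L2 g -> measurable_fun setT k -> (forall t, `|k t| <= c) ->
  L2 (fun t => g t * k t).
Proof.
move=> Lg mk kc; apply: (L2_le _ (L2_scale c Lg)) => [|t].
  by apply: measurable_funM => //; exact: Lg.1.
by rewrite normrM [leRHS]normrM mulrC ler_wpM2r// (le_trans (kc t))// ler_norm.
Qed.

(* Real part of the resolvent identity
   [1 / z - 1 / w = (w - z) / (z w)] for [z = x - s + i y], [w = x - t + i y]. *)
Lemma Q_sub_Q y x s t e : 0 < y -> 0 < e ->
  Q e (s - t) * (Q y (x - t) - Q y (x - s)) =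
  (s - t) ^+ 2 / ((s - t) ^+ 2 + e ^+ 2) *
    (P y (x - s) * P y (x - t) - Q y (x - s) * Q y (x - t)).
Proof.
move=> y0 e0; have h1 := den_gt0 (s - t) e0.
have h2 := den_gt0 (x - s) y0; have h3 := den_gt0 (x - t) y0.
rewrite /P /Q; have := piN0; move: (pi : R) => p pN0.
by field; rewrite pN0 !gt_eqF.
Qed.

Lemma cvg_cutoff u : u != 0 ->
  u ^+ 2 / (u ^+ 2 + n.+1%:R^-1 ^+ 2) @[n --> \oo] --> (1 : R).
Proof.
move=> u0.
have u2 : u ^+ 2 != 0 by rewrite sqrf_eq0.
rewrite -[X in _ --> X](divff u2); apply: cvg_mul_seq; first exact: cvg_cst.
apply: cvg_inv_seq => //; rewrite -[X in _ --> X]addr0; apply: cvgD; first exact: cvg_cst.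
by apply: cvg_sqr0; exact: cvg_harmonic.
Qed.

Lemma meas_cutoff (e : R) x : 0 < e ->
  measurable_fun setT (fun t => (x - t) ^+ 2 / ((x - t) ^+ 2 + e ^+ 2)).
Proof.
move=> e0; rewrite (_ : (fun t => _) = fun t => pi * ((x - t) * Q e (x - t))); last first.
  apply/funext => t; have := den_gt0 (x - t) e0; rewrite /Q => d.
  by have := piN0; move: (pi : R) => p pN0; field; rewrite pN0 gt_eqF.
apply: measurable_funM => //; apply: measurable_funM; last exact: meas_Qsub.
exact: measurable_funB.
Qed.

Lemma cutoff_le1 (e : R) u : 0 < e -> `|u ^+ 2 / (u ^+ 2 + e ^+ 2)| <= 1.
Proof.
move=> e0; have d := den_gt0 u e0.
rewrite ger0_norm; last by rewrite divr_ge0 ?sqr_ge0// ltW.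
by rewrite ler_pdivrMr// mul1r lerDl sqr_ge0.
Qed.

(* Integrate both sides of [Q_sub_Q] against [f s * g t] and let [e] tend to 0:
   on the right the cutoff disappears, and on the left Fubini moves [Q e] onto
   [g] and [f], where it becomes [P e] of their conjugates. *)
Lemma conj_pair_mul f f' g g' y x : 0 < y -> conj_pair f f' -> conj_pair g g' ->
  Pc y f x * Pc y g x - Qc y f x * Qc y g x =
  - Qc y (fun t => f t * g' t + g t * f' t) x.
Proof.
move=> y0 cf cg; have [Lf Lf' hf] := cf; have [Lg Lg' hg] := cg.
pose p t := P y (x - t); pose q t := Q y (x - t).
have Lp : L2 p by exact: L2_P.
have Lq : L2 q by exact: L2_Q.
have qb t : `|q t| <= y^-1 by exact: Q_bound.
have mq : measurable_fun setT q by exact: meas_Qsub.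
pose e (n : nat) : R := n.+1%:R^-1.
have e0 n : 0 < e n by rewrite invr_gt0.
have ec : e @ \oo --> (0 : R) by exact: cvg_harmonic.
have Lgq := L2_bound Lg mq qb; have Lfq := L2_bound Lf mq qb.
have igq : integ (fun t => g t * q t) by exact: L2_mul.
(* [J n s] is [f s] times the commutator of [Q (e n)] with multiplication by [q], applied to [g].
   [JE] rewrites it with the cutoff [w], which gives one limit; the commutator form gives the
   other. *)
pose J n s := f s * (Qc (e n) (fun t => g t * q t) s - q s * Qc (e n) g s).
pose N s t := p s * p t - q s * q t.
pose w n u := u ^+ 2 / (u ^+ 2 + e n ^+ 2).
have w01 n u : `|w n u| <= 1 := cutoff_le1 u (e0 n).
have JE n s : J n s = f s * Int (fun t => w n (s - t) * (g t * N s t)).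
  congr (_ * _).
  have i1 := integ_Qf s (e0 n) (W_L1 igq).
  have i2 := integ_Qf s (e0 n) (W_L2 Lg).
  rewrite -(Int_scale (q s) i2) -(Int_sub i1 (integ_scale (q s) i2)).
  apply: Int_eq => t; have h := Q_sub_Q x s t y0 (e0 n).
  transitivity (g t * (Q (e n) (s - t) * (Q y (x - t) - Q y (x - s)))).
    by rewrite /q; move: (Q (e n) _) (Q y (x - s)) (Q y (x - t)) (g t) => A B C D; ring.
  by rewrite h mulrCA.
have igp : integ (fun t => `|g t * p t|) by apply: integ_abs; exact: L2_mul.
have iga : integ (fun t => `|g t * q t|) by exact: integ_abs.
have ifp : integ (fun t => `|f t * p t|) by apply: integ_abs; exact: L2_mul.
have ifa : integ (fun t => `|f t * q t|) by apply: integ_abs; exact: L2_mul.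
pose D s t := `|p s| * `|g t * p t| + `|q s| * `|g t * q t|.
have iD s : integ (D s) by apply: integ_add; exact: integ_scale.
have mgN n s : measurable_fun setT (fun t => w n (s - t) * (g t * N s t)).
  apply: measurable_funM; first exact: meas_cutoff.
  apply: measurable_funM; first exact: Lg.1.
  by apply: measurable_funB; apply: measurable_funM => //; exact: Lp.1.
have bD n s t : `|w n (s - t) * (g t * N s t)| <= D s t.
  rewrite normrM; apply: (@le_trans _ _ (`|g t * N s t|)); first by rewrite ler_piMl.
  rewrite (_ : g t * N s t = p s * (g t * p t) - q s * (g t * q t)); last by rewrite /N; ring.
  by rewrite /D -!normrM; exact: ler_normB.
have mN s : measurable_fun setT (fun t => g t * N s t).
  apply: measurable_funM; first exact: Lg.1.
  by apply: measurable_funB; apply: measurable_funM => //; exact: Lp.1.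
have lim1 s : Int (fun t => w n (s - t) * (g t * N s t)) @[n --> \oo] -->
    p s * Pc y g x - q s * Qc y g x.
  have -> : p s * Pc y g x - q s * Qc y g x = Int (fun t => g t * N s t).
    have i1 := integ_Pf x y0 (W_V (W_L2 Lg)); have i2 := integ_Qf x y0 (W_L2 Lg).
    rewrite /Pc /Qc -(Int_scale (p s) i1) -(Int_scale (q s) i2).
    rewrite -(Int_sub (integ_scale (p s) i1) (integ_scale (q s) i2)).
    by apply: Int_eq => t; rewrite /N /p /q; ring.
  apply: (@Int_dct_ae _ _ _ (D s) _ _ _ _ _).2 => //; first exact: aeT.
  (* The cutoff fails to tend to 1 only at [t = s]. *)
  exists [set s]; split; [exact: measurable_set1|exact: lebesgue_measure_set1|].
  move=> t /= h; apply: contrapT => ts; apply: h.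
  rewrite -[X in _ --> X]mul1r; apply: cvgMr_tmp; apply: cvg_cutoff.
  by rewrite subr_eq0; apply/eqP => st; apply: ts.
have iJ n : integ (fun s => f s * Qc (e n) (fun t => g t * q t) s).
  by apply: L2_mul => //; exact: Qc_L2_of_L1.
have iK n : integ (fun s => (f s * q s) * Qc (e n) g s).
  (* [g] is only in L^2, so [Qc (e n) g] is placed in L^2 through the conjugate [g']. *)
  apply: L2_mul => //; rewrite (_ : Qc (e n) g = Pc (e n) g'); first exact: Pc_L2.
  by apply/funext => t; have [] := hg (e n) t (e0 n).
have mJ n : measurable_fun setT (J n).
  apply: (eq_measurable_fun (fun s => f s * Qc (e n) (fun t => g t * q t) s -
    (f s * q s) * Qc (e n) g s)); first by move=> s _; rewrite /J; ring.
  by apply: measurable_funB; exact: integ_meas.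
pose A := Int (fun t => `|g t * p t|); pose B := Int (fun t => `|g t * q t|).
have [|||_ _ lim2] := @Int_dct _ J (fun s => f s * (p s * Pc y g x - q s * Qc y g x))
    (fun s => A * `|f s * p s| + B * `|f s * q s|) mJ.
- by apply: integ_add; exact: integ_scale.
- move=> s n; rewrite JE normrM.
  have h := Int_norm_le (mgN n s) (iD s) (bD n s).
  have E : Int (D s) = `|p s| * A + `|q s| * B.
    rewrite (Int_add (integ_scale `|p s| igp) (integ_scale `|q s| iga)).
    by rewrite (Int_scale _ igp) (Int_scale _ iga).
  rewrite E in h; apply: (le_trans (ler_wpM2l (normr_ge0 (f s)) h)).
  by rewrite !normrM; move: `|f s| `|p s| `|q s| => X Y Z; lra.
- by move=> s; rewrite (_ : J ^~ s = fun n => f s * Int (fun t => w n (s - t) * (g t * N s t)));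
    [exact: cvgMl_tmp|apply/funext => n; exact: JE].
have lim3 : Int (J n) @[n --> \oo] -->
    - Int (fun t => f' t * (g t * q t)) - Int (fun t => g' t * (f t * q t)).
  have E n : Int (J n) = - Int (fun t => Pc (e n) f' t * (g t * q t)) -
      Int (fun t => Pc (e n) g' t * (f t * q t)).
    have -> : Int (J n) = Int (fun s => f s * Qc (e n) (fun t => g t * q t) s -
        (f s * q s) * Qc (e n) g s) by apply: Int_eq => s; rewrite /J; ring.
    rewrite (Int_sub (iJ n) (iK n)) (Qc_adj (e0 n) Lf igq); congr (- _ - _).
      by apply: Int_eq => t; have [<- _] := hf (e n) t (e0 n); exact: mulrC.
    by apply: Int_eq => t; have [<- _] := hg (e n) t (e0 n); exact: mulrC.
  rewrite (_ : (fun n => Int (J n)) = fun n => - Int (fun t => Pc (e n) f' t * (g t * q t)) -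
      Int (fun t => Pc (e n) g' t * (f t * q t))); last exact/funext.
  apply: cvgB; first apply: cvgN.
    by apply: L2_cvg0_pair => //; [move=> n; exact: Pc_L2|exact: Pc_cvg_L2].
  by apply: L2_cvg0_pair => //; [move=> n; exact: Pc_L2|exact: Pc_cvg_L2].
have key := cvg_seq_unique lim2 lim3.
have ifp' := integ_Pf x y0 (W_V (W_L2 Lf)); have ifq' := integ_Qf x y0 (W_L2 Lf).
have E1 : Int (fun s => f s * (p s * Pc y g x - q s * Qc y g x)) =
    Pc y g x * Pc y f x - Qc y g x * Qc y f x.
  move: (Pc y g x) (Qc y g x) => X Y.
  rewrite /Pc /Qc -(Int_scale X ifp') -(Int_scale Y ifq').
  rewrite -(Int_sub (integ_scale X ifp') (integ_scale Y ifq')).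
  by apply: Int_eq => s; rewrite /p /q; ring.
have j1 : integ (fun t => f' t * (g t * q t)) by exact: L2_mul.
have j2 : integ (fun t => g' t * (f t * q t)) by exact: L2_mul.
rewrite mulrC [in X in _ - X]mulrC -E1 key -opprD -(Int_add j1 j2); congr (- _).
by apply: Int_eq => t; rewrite /q; ring.
Qed.

(** For the pairs [(f, hilbert f)] and [(hilbert f, - f)], [conj_pair_mul] says that the conjugate
    Poisson integral of [f^2 - (hilbert f)^2] is [2 * (Pc y f x * Pc y (hilbert f) x)]; at common
    Lebesgue points [y] may tend to 0. *)
Lemma hilbert_sqr_diff f : L2 f ->
  {ae mu, forall x, Hlim (fun t => f t ^+ 2 - hilbert f t ^+ 2) x (2 * (f x * hilbert f x))}.
Proof.
move=> Lf; have [cf _ _] := hilbert_L2 Lf; have [_ Lh hf] := cf.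
have cg := conj_pair_opp cf.
have id : integ (fun t => f t ^+ 2 - hilbert f t ^+ 2) := integ_sub Lf.2 Lh.2.
have Wd := W_L1 id.
apply: aeS3 (ae_Lpt (W_L2 Lf)) (ae_Lpt (W_L2 Lh)) (ae_Lpt Wd) => x l1 l2 l3.
apply: Hlim_Lpt => //.
apply: (@cvg_right_ext _ (fun y => 2 * (Pc y f x * Pc y (hilbert f) x))).
  move=> y y0; have := conj_pair_mul x y0 cf cg.
  have [E1 E2] := hf y x y0; rewrite E1 E2.
  have -> : Qc y (fun t => f t * - f t + hilbert f t * hilbert f t) x =
      - Qc y (fun t => f t ^+ 2 - hilbert f t ^+ 2) x.
    rewrite /Qc -(Int_opp (integ_Qf x y0 Wd)); apply: Int_eq => t; ring.
  by rewrite opprK => <-; ring.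
apply: cvgMl_tmp; apply: cvgM; first exact: Pc_Lpt (W_L2 Lf) l1.
exact: Pc_Lpt (W_L2 Lh) l2.
Qed.

End Bilinear.

(** * The Hilbert transform on L^1 *)

Section Existence.
Context {R : realType}.
Local Notation mu := (@lebesgue_measure R).
Implicit Types (f g h k d : R -> R) (F G : R -> R -> R) (x y t a s u r z : R).

Let pi0 : 0 < pi :> R := pi_gt0 R.
Let piN0 : pi != 0 :> R := lt0r_neq0 pi0.
Ltac gpi := have := piN0; move: (pi : R) => p pN0.

(** * Pointwise inequalities between kernels *)

Lemma P_le a b x z (c : R) : 0 < a -> 0 < b -> 0 <= c -> a * (z ^+ 2 + b ^+ 2) <= c * b * (x ^+ 2 + a ^+ 2) ->
  P a x <= c * P b z.
Proof.
move=> a0 b0 c0 h; have A := den_gt0 x a0; have B := den_gt0 z b0.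
rewrite /P mulrA ler_pdivrMr ?mulr_gt0// mulrAC ler_pdivlMr ?mulr_gt0//.
by rewrite [leLHS]mulrCA [leRHS]mulrCA ler_pM2l.
Qed.

Lemma P_far a x z : 0 < a -> `|z| <= 2 * `|x| -> P a x <= 4 * P a z.
Proof.
move=> a0 h; apply: P_le => //.
have : z ^+ 2 <= 4 * x ^+ 2.
  rewrite -(real_normK (num_real z)) -(real_normK (num_real x)).
  by have := normr_ge0 z; nra.
by have := sqr_ge0 a; nra.
Qed.

(** [(x - s)^2 <= 2 (t - s)^2 + 2 (t - x)^2] and [|t - x| <= 2 a] give
    [(x - s)^2 + a^2 <= 9 ((t - s)^2 + a^2)]. *)
Lemma P_harnack a t x s : 0 < a -> `|t - x| <= 2 * a -> P a (t - s) <= 9 * P a (x - s).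
Proof.
move=> a0; rewrite ler_norml => h; apply: P_le => //.
have : (x - s) ^+ 2 <= 2 * (t - s) ^+ 2 + 8 * a ^+ 2.
  have := sqr_ge0 ((t - s) + (t - x)); rewrite (_ : x - s = (t - s) - (t - x)); last by ring.
  by nra.
by have := sqr_ge0 (t - s); nra.
Qed.

(** One of [|u - t|] and [|u - s|] is at least half of [|t - s|], and by [P_far] that kernel grows
    at most by the factor 1/4 to 1 needed: it is at most 4 times its value at [t - s]. The scales
    [a] and [b] are unrelated, as they must be when the scale varies with the source point. *)
Lemma P_triangle a b t s u : 0 < a -> 0 < b ->
  P a (u - t) * P b (u - s) <= 4 * (P a (t - s) * P b (u - s)) + 4 * (P a (u - t) * P b (t - s)).
Proof.
move=> a0 b0.
have h1 := P_ge0 (u - t) a0; have h2 := P_ge0 (u - s) b0.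
have h3 := P_ge0 (t - s) a0; have h4 := P_ge0 (t - s) b0.
have [h|h] := leP `|t - s| (2 * `|u - t|).
  by have := P_far a0 h; nra.
have h5 : `|t - s| <= 2 * `|u - s|.
  have : `|t - s| <= `|u - t| + `|u - s|.
    by rewrite (distrC u t) (le_trans _ (ler_normD _ _))// addrA subrK.
  by move: h; move: `|t - s| `|u - t| `|u - s| => A B C; lra.
by have := P_far b0 h5; nra.
Qed.

Lemma mul_triangle (e X Y Z T : R) : 0 <= e -> X * Y <= 4 * (Z * Y) + 4 * (X * T) ->
  X * (e * Y) <= 4 * (Z * (e * Y)) + 4 * (X * (e * T)).
Proof. by move=> e0 /(ler_wpM2l e0) h; move: h; lra. Qed.

Lemma mul_split (e X Y Z T : R) : 0 <= e -> X * Y <= 4 * Z + 4 * (X * T) ->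
  Y * (e * X) <= 4 * (e * Z) + 4 * (e * T * X).
Proof. by move=> e0 /(ler_wpM2l e0) h; move: h; lra. Qed.

Lemma P_sup a x : 0 < a -> P a x <= (pi * a)^-1.
Proof.
move=> a0; have A := den_gt0 x a0.
rewrite /P ler_pdivrMr ?mulr_gt0// mulrC ler_pdivlMr ?mulr_gt0//.
by rewrite mulrCA ler_pM2l// -expr2 lerDr sqr_ge0.
Qed.

(** Spreading a unit mass at scale [a] raises the height from [y] to [y + a]. At distance at least
    [a] the change is bounded uniformly in [y], which provides the majorant for the limit of [y] to
    0. *)
Lemma Q_diff_le a y z : 0 < a -> 0 < y -> a <= `|z| -> `|Q y z - Q (y + a) z| <= 2 * P a z.
Proof.
move=> a0 y0 az; have ya : 0 < y + a by exact: addr_gt0.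
have B := den_gt0 z y0; have C := den_gt0 z ya; have D := den_gt0 z a0.
have z0 : 0 < `|z| by exact: lt_le_trans az.
have -> : Q y z - Q (y + a) z =
    (a / pi) * (z * ((2 * y + a) / ((z ^+ 2 + y ^+ 2) * (z ^+ 2 + (y + a) ^+ 2)))).
  by rewrite /Q; gpi; field; rewrite pN0 !gt_eqF.
have -> : 2 * P a z = (a / pi) * (2 / (z ^+ 2 + a ^+ 2)).
  by rewrite /P; gpi; field; rewrite pN0 !gt_eqF.
rewrite normrM (ger0_norm (_ : 0 <= a / pi)) ?ler_pM2l ?divr_gt0//; last exact/ltW/divr_gt0.
rewrite normrM normrM normfV (ger0_norm (_ : 0 <= 2 * y + a)); last first.
  by rewrite addr_ge0 ?mulr_ge0 ?ltW.
rewrite (ger0_norm (_ : 0 <= (z ^+ 2 + y ^+ 2) * _)); last by rewrite mulr_ge0 ?ltW.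
rewrite mulrA ler_pdivrMr ?mulr_gt0// mulrAC ler_pdivlMr//.
rewrite -(real_normK (num_real z)) in B C D *.
move: `|z| z0 az B C D => w w0 aw B C D.
have e1 : w * (2 * y + a) <= w ^+ 2 + (y + a) ^+ 2.
  by have := sqr_ge0 (w - (y + a)); rewrite !expr2; nra.
have e2 : w ^+ 2 + a ^+ 2 <= 2 * (w ^+ 2 + y ^+ 2).
  by have := sqr_ge0 y; nra.
apply: (le_trans (ler_pM _ _ e1 e2)); [|exact: ltW|by lra].
by rewrite mulr_ge0// ?addr_ge0 ?mulr_ge0// ltW.
Qed.

(** * Mass spread by Poisson kernels of variable scale *)

Lemma meas2_sec F x : meas2 F -> measurable_fun setT (F x).
Proof.
move=> mF; exact: (measurableT_comp mF (pair1_measurable x)).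
Qed.

Lemma meas2_inv F : meas2 F -> (forall x t, 0 < F x t) -> meas2 (fun x t => (F x t)^-1).
Proof.
move=> mF F0; rewrite (_ : (fun x t => _) = fun x t => expR (- ln (F x t))).
  apply: (meas2_comp (f := fun v => expR (- ln v))) => //.
  apply: measurableT_comp; first exact: measurable_expR.
  by apply: measurableT_comp => //; exact: measurable_ln.
by apply/funext => x; apply/funext => t; rewrite expRN lnK// posrE.
Qed.

Lemma meas2_Pvar g d : measurable_fun setT g -> measurable_fun setT d -> (forall t, 0 < d t) ->
  meas2 (fun u t => g t * P (d t) (u - t)).
Proof.
move=> mg md d0; apply: meas2_mul; first exact: meas2_snd.
apply: meas2_mul; first exact: meas2_snd.
apply: meas2_inv => [|x t]; last by rewrite mulr_gt0// den_gt0.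
apply: (@meas2_mul _ (fun _ _ => pi)); first exact: measurable_cst.
apply: meas2_add; first exact: (meas2_comp (f := fun v => v ^+ 2)) meas2_diff.
by apply: meas2_snd; exact: measurable_funX.
Qed.

(** A Poisson integral whose scale follows the source point [t], hence not a convolution. *)
Definition spread d g u := Int (fun t => g t * P (d t) (u - t)).

Lemma spread_L1 d g : measurable_fun setT d -> (forall t, 0 < d t) -> integ g ->
  [/\ {ae mu, forall u, integ (fun t => g t * P (d t) (u - t))}, integ (spread d g) &
      Int (spread d g) = Int g].
Proof.
move=> md d0 ig; have mg := integ_meas ig.
pose F t u := g t * P (d t) (u - t).
have mF : meas2 F := meas2_swap (meas2_Pvar mg md d0).
have iF t : integ (F t) := integ_scale (g t) (integ_P_swap t (d0 t)).
have FG t : Int (fun u => `|F t u|) <= `|g t|.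
  rewrite (@Int_eq _ _ (fun u => `|g t| * P (d t) (u - t))).
    by rewrite (Int_scale `|g t| (integ_P_swap t (d0 t))) (Int_P_swap t (d0 t)) mulr1.
  by move=> u; rewrite /F normrM (ger0_norm (P_ge0 _ (d0 t))).
have [_ h1 h2 _ h3] := Int_fubini mF iF (integ_abs ig) FG.
have FI t : Int (F t) = g t.
  by rewrite /F (Int_scale (g t) (integ_P_swap t (d0 t))) (Int_P_swap t (d0 t)) mulr1.
split; [exact: h1|exact: h2|exact: etrans (esym h3) (Int_eq FI)].
Qed.

(** [B^2] is at most 8 times the spread of [g B]; since spreading preserves mass, [n2 B] is at most
    8 times the integral of [g B], the interaction of the mass with its spread. The lower bound [m]
    on the scales bounds the kernels, which makes all the double integrals converge. *)
Lemma spread_L2 d g (m C : R) : measurable_fun setT d -> 0 < m -> (forall t, m <= d t) ->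
  integ g -> (forall t, 0 <= g t) -> (forall t, g t * Pc (d t) g t <= C * g t) ->
  L2 (spread d g) /\ n2 (spread d g) <= 8 * C * Int g.
Proof.
move=> md m0 dm ig g0 gC; have mg := integ_meas ig; set B := spread d g.
have d0 t : 0 < d t by exact: lt_le_trans (dm t).
have k0 u t : 0 <= P (d t) (u - t) by exact: P_ge0.
have kb u t : P (d t) (u - t) <= (pi * m)^-1.
  apply: le_trans (P_sup _ (d0 t)) _.
  by rewrite lef_pV2 ?posrE ?mulr_gt0// ler_pM2l.
have mk : meas2 (fun u t => P (d t) (u - t)).
  rewrite (_ : (fun u t => _) = fun u t => 1 * P (d t) (u - t)).
    by apply: (@meas2_Pvar (fun=> 1)).
  by apply/funext => u; apply/funext => t; rewrite mul1r.
have mku u : measurable_fun setT (fun t => P (d t) (u - t)).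
  exact: meas2_sec mk.
have ik h u : integ h -> integ (fun t => h t * P (d t) (u - t)).
  move=> ih; apply: (integ_le _ (integ_scale (pi * m)^-1 (integ_abs ih))).
    by apply: measurable_funM => //; exact: integ_meas.
  by move=> t; rewrite normrM (ger0_norm (k0 _ _)) mulrC ler_wpM2r.
have [_ iB IB] := spread_L1 md d0 ig.
have mB := integ_meas iB.
have B0 u : 0 <= B u by apply: Int_ge0 => t; rewrite mulr_ge0.
have Bb u : B u <= (pi * m)^-1 * Int g.
  rewrite -(Int_scale _ ig); apply: Int_le; [exact: ik|exact: integ_scale|].
  by move=> t; rewrite mulrC ler_wpM2r.
have igB : integ (fun t => g t * B t).
  apply: (integ_le _ (integ_scale ((pi * m)^-1 * Int g) ig)).
    exact: measurable_funM.
  by move=> t; rewrite ger0_norm ?mulr_ge0// mulrC ler_wpM2r.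
have cI t : integ (fun s => P (d t) (t - s) * g s).
  by apply: integ_Pf => //; exact/W_V/W_L1.
(* By Fubini the integral of [g B] is that of [g s * Pc (d s) g s], to which [gC] applies. *)
have EgB : Int (fun t => g t * B t) <= C * Int g.
  pose F s t := g t * (g s * P (d s) (t - s)).
  have mF : meas2 F.
    by apply: meas2_mul; [exact: meas2_snd|exact: (meas2_swap (meas2_Pvar mg md d0))].
  have FE s : F s = fun t => g s * (P (d s) (s - t) * g t).
    by apply/funext => t; rewrite /F PC; move: (P _ _) => A; ring.
  have iF s : integ (F s) by rewrite FE; exact: integ_scale.
  have FI s : Int (F s) = g s * Pc (d s) g s by rewrite FE (Int_scale (g s) (cI s)).
  have FG s : Int (fun t => `|F s t|) <= C * g s.
    apply: le_trans (gC s); rewrite -FI; apply: Int_le => //; first exact/integ_abs.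
    by move=> t; rewrite ger0_norm//; apply: mulr_ge0 => //; apply: mulr_ge0.
  have [i1 _ _ _ h] := Int_fubini mF iF (integ_scale C ig) FG.
  have -> : Int (fun t => g t * B t) = Int (fun t => Int (F ^~ t)).
    by apply: Int_eq => t; rewrite /B /spread -(Int_scale (g t) (ik g t ig)).
  rewrite -h -(Int_scale C ig); apply: Int_le; [exact: i1|exact: integ_scale|].
  by move=> s; rewrite FI.
have [_ iS IS] := spread_L1 md d0 igB.
(* [B u ^+ 2] is a double integral over [s] and [t]. [P_triangle] splits it into two terms, and each
   is at most 4 times the spread of [g B] at [u]: one directly, the other after exchanging the
   integrals ([I1]). *)
have key u : B u ^+ 2 <= 8 * spread d (fun t => g t * B t) u.
  pose b s := g s * P (d s) (u - s).
  have ib : integ b := ik g u ig.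
  have b0 s : 0 <= b s by rewrite mulr_ge0.
  have ic t : integ (fun s => P (d t) (t - s) * b s) by apply: integ_Pf => //; exact/W_V/W_L1.
  pose F t s := g t * (P (d t) (t - s) * b s).
  have mF : meas2 F.
    apply: meas2_mul; first exact: meas2_fst.
    apply: meas2_mul; last by apply: meas2_snd; exact: integ_meas.
    rewrite (_ : (fun t s => _) = fun t s => P (d t) (s - t)); first exact: meas2_swap mk.
    by apply/funext => t; apply/funext => s; exact: PC.
  have iF t : integ (F t) := integ_scale (g t) (ic t).
  have FI t : Int (F t) = g t * Pc (d t) b t := Int_scale (g t) (ic t).
  have FG t : Int (fun s => `|F t s|) <= ((pi * m)^-1 * Int b) * g t.
    rewrite (@Int_eq _ _ (F t)) => [|s]; last first.
      by rewrite ger0_norm//; apply: mulr_ge0 => //; apply: mulr_ge0 => //; exact: P_ge0.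
    rewrite FI mulrC ler_wpM2r// -(Int_scale _ ib); apply: Int_le; [exact: ic|exact: integ_scale|].
    by move=> s; rewrite ler_wpM2r// PC.
  have [i1 _ _ _ e] := Int_fubini mF iF (integ_scale _ ig) FG.
  have E s : Int (F ^~ s) = (g s * B s) * P (d s) (u - s).
    rewrite (@Int_eq _ _ (fun t => b s * (g t * P (d t) (s - t)))); last first.
      by move=> t; rewrite /F PC; move: (P _ _) (b s) => X Y; ring.
    by rewrite (Int_scale (b s) (ik g s ig)) -/(spread d g s) -/B /b; ring.
  have I1 : Int (fun t => g t * Pc (d t) b t) = spread d (fun t => g t * B t) u.
    by rewrite /spread -(Int_eq E) -e; apply: Int_eq => t; rewrite FI.
  have i2 : integ (fun t => g t * Pc (d t) b t) := integ_eq FI i1.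
  have i3 := ik _ u igB.
  have pt t : P (d t) (u - t) * B u <= 4 * Pc (d t) b t + 4 * (P (d t) (u - t) * B t).
    have i4 := ik g t ig.
    have i5 : integ (fun s => P (d t) (u - t) * (g s * P (d s) (t - s))) := integ_scale _ i4.
    rewrite -(Int_scale (P (d t) (u - t)) ib) -(Int_scale (P (d t) (u - t)) i4).
    rewrite -(Int_scale 4 (ic t)) -(Int_scale 4 i5).
    rewrite -(Int_add (integ_scale 4 (ic t)) (integ_scale 4 i5)); apply: Int_le.
    - exact: integ_scale.
    - by apply: integ_add; exact: integ_scale.
    - by move=> s; apply: mul_triangle (g0 s) (P_triangle t s u (d0 t) (d0 s)).
  rewrite (_ : 8 * _ = 4 * spread d (fun t => g t * B t) u + 4 * spread d (fun t => g t * B t) u); last by ring.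
  rewrite -{1}I1 /spread -(Int_scale 4 i2) -(Int_scale 4 i3).
  rewrite -(Int_add (integ_scale 4 i2) (integ_scale 4 i3)) expr2 -(Int_scale (B u) ib).
  apply: Int_le; [exact: integ_scale|by apply: integ_add; exact: integ_scale|].
  by move=> t; apply: mul_split (g0 t) (pt t).
have iS8 := integ_scale 8 iS.
split.
  split => //; apply: (integ_le _ iS8); first exact: measurable_funX.
  by move=> u; rewrite ger0_norm ?sqr_ge0.
apply: (@le_trans _ _ (Int (fun u => 8 * spread d (fun t => g t * B t) u))).
  apply: Int_le => //; apply: (integ_le _ iS8); first exact: measurable_funX.
  by move=> u; rewrite ger0_norm ?sqr_ge0.
by rewrite (Int_scale 8 iS) IS -mulrA ler_wpM2l.
Qed.

End Existence.

(** * From spread mass to existence almost everywhere *)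

Section Existence2.
Context {R : realType}.
Local Notation mu := (@lebesgue_measure R).
Implicit Types (f g h k d : R -> R) (F G : R -> R -> R) (x y t a s u r z : R).

Let pi0 : 0 < pi :> R := pi_gt0 R.
Let piN0 : pi != 0 :> R := lt0r_neq0 pi0.

Lemma meas_pos_set d : measurable_fun setT d -> measurable [set t | 0 < d t].
Proof.
move=> md; rewrite (_ : [set t | _] = setT `&` d @^-1` `]0, +oo[).
  exact: md.
by apply/seteqP; split => t /=; rewrite in_itv/= andbT => // -[].
Qed.

(** Restrict the mass to the points where [d] is at least [1 / (n + 1)]: the bound of [spread_L2] is
    uniform in [n], and the spreads increase to that of [g]. [dn] alters the scale only where [gn]
    vanishes. *)
Lemma spread_L2_pos d g (C : R) : measurable_fun setT d -> (forall t, 0 < d t) -> 0 <= C ->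
  integ g -> (forall t, 0 <= g t) -> (forall t, g t * Pc (d t) g t <= C * g t) ->
  L2 (spread d g).
Proof.
move=> md d0 C0 ig g0 gC; have mg := integ_meas ig.
have [aei iB _] := spread_L1 md d0 ig.
pose e (n : nat) : R := n.+1%:R^-1.
have e0 n : 0 < e n by rewrite invr_gt0.
pose S n := [set t | e n <= d t].
have mS n : measurable (S n).
  rewrite (_ : S n = setT `&` d @^-1` `[e n, +oo[); first exact: md.
  by apply/seteqP; split => t /=; rewrite in_itv/= andbT => // -[].
pose gn n t := \1_(S n) t * g t.
pose dn n t := Num.max (d t) (e n).
have ign n : integ (gn n) := integ_on (mS n) ig.
have gn0 n t : 0 <= gn n t by apply: mulr_ge0 => //; exact: indic_ge0.
have gng n t : gn n t <= g t by rewrite ler_piMl// indic_le1.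
have mdn n : measurable_fun setT (dn n) by exact: measurable_maxr.
have edn n t : e n <= dn n t by rewrite le_max lexx orbT.
have gE n t u : gn n t * P (dn n t) u = gn n t * P (d t) u.
  rewrite /gn; have [h|h] := pselect (S n t).
    by rewrite /dn max_l.
  by rewrite indicE0// !mul0r.
have edE n t : gn n t * Pc (dn n t) (gn n) t <= C * gn n t.
  rewrite /gn; have [h|h] := pselect (S n t); last by rewrite indicE0// !mul0r mulr0.
  rewrite indicE1// !mul1r; apply: le_trans (gC t); rewrite ler_wpM2l//.
  have dE : dn n t = d t by rewrite /dn max_l.
  rewrite dE; apply: Int_le.
  - exact: (integ_Pf t (d0 t) (W_V (W_L1 (ign n)))).
  - exact: (integ_Pf t (d0 t) (W_V (W_L1 ig))).
  - by move=> s; rewrite ler_wpM2l ?P_ge0//; exact: gng.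
pose B n := spread (dn n) (gn n).
have sB n := spread_L2 (mdn n) (e0 n) (edn n) (ign n) (gn0 n) (edE n).
have BE n u : B n u = Int (fun t => gn n t * P (d t) (u - t)) by apply: Int_eq => t; exact: gE.
have dn0 n t : 0 < dn n t by exact: lt_le_trans (edn n t).
have iB' n u : integ (fun t => gn n t * P (d t) (u - t)).
  apply: (integ_le _ (integ_scale (pi * e n)^-1 (integ_abs (ign n)))).
    apply: measurable_funM; first exact: integ_meas.
    have := @meas2_sec _ _ u (meas2_Pvar (measurable_cst (1 : R)) md d0).
    by apply: eq_measurable_fun => t _; rewrite mul1r.
  move=> t; rewrite -gE normrM mulrC ler_wpM2r// ger0_norm ?P_ge0//.
  by apply: le_trans (P_sup _ (dn0 n t)) _; rewrite lef_pV2 ?posrE ?mulr_gt0// ler_pM2l.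
have B0 n u : 0 <= B n u.
  by apply: Int_ge0 => t; apply: mulr_ge0 => //; exact: P_ge0.
have ndB n u : B n u <= B n.+1 u.
  rewrite !BE; apply: Int_le => // t; rewrite ler_wpM2r ?P_ge0// /gn ler_wpM2r//.
  have [h|h] := pselect (S n t); last by rewrite (indicE0 h) indic_ge0.
  rewrite (indicE1 h) indicE1//; apply: le_trans h.
  by rewrite /e lef_pV2 ?posrE// ler_nat.
have nB n : n2 (B n) <= 8 * C * Int g.
  apply: (le_trans (sB n).2); apply: ler_wpM2l; first exact: mulr_ge0.
  exact: Int_le.
have [||G [iG G0 _ BG]] := Int_mono_bound (fun n => (sB n).1.2) _ _ nB.
- by move=> n u; exact: sqr_ge0.
- by move=> n u; rewrite lerXn2r ?nnegrE ?B0//; exact: ndB.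
split; first exact: integ_meas.
apply: (integ_ae_le _ iG); first by apply: measurable_funX; exact: integ_meas.
apply: aeS2 aei BG => u iu Gu.
have c1 : B n u @[n --> \oo] --> spread d g u.
  rewrite (_ : B ^~ u = fun n => Int (fun t => gn n t * P (d t) (u - t))); last exact/funext.
  have [||||_ //] := @Int_dct _ (fun n t => gn n t * P (d t) (u - t))
      (fun t => g t * P (d t) (u - t)) (fun t => g t * P (d t) (u - t)).
  - by move=> n; exact: integ_meas.
  - exact: iu.
  - move=> t n; rewrite ger0_norm; last by apply: mulr_ge0 => //; exact: P_ge0.
    by rewrite ler_wpM2r ?P_ge0//; exact: gng.
  - move=> t; apply: cvg_near_cst.
    have := near_infty_natSinv_lt (PosNum (d0 t)); apply: filterS => n /= h.
    by rewrite /gn indicE1 ?mul1r//=; exact: ltW.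
rewrite ger0_norm ?sqr_ge0// expr2; apply: cvgr_to_le (cvg_mul_seq c1 c1) _.
by apply: nearW => n; exact: Gu.
Qed.

(** The infimum of the distances is 1-Lipschitz, hence measurable; near minimisers stand in for a
    closest point. *)
Lemma dist_to_set (K : set R) : K !=set0 -> exists d : R -> R,
  [/\ measurable_fun setT d, forall t, 0 <= d t, forall t x, K x -> d t <= `|t - x| &
      forall t (e : R), 0 < e -> exists2 x, K x & `|t - x| < d t + e].
Proof.
move=> [k0 Kk0]; pose D t := [set `|t - x| | x in K]; pose d t := inf (D t).
have D0 t : D t !=set0 by exists `|t - k0|, k0.
have lbD t : has_lbound (D t) by exists 0 => _ [x _ <-].
have dle t x : K x -> d t <= `|t - x| by move=> Kx; apply: ge_inf => //; exists x.
have adh t (e : R) : 0 < e -> exists2 x, K x & `|t - x| < d t + e.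
  by move=> e0; have [_ [x Kx <-] h] := inf_adherent e0 (conj (D0 t) (lbD t)); exists x.
have lip t s : d t <= d s + `|t - s|.
  apply/ler_addgt0Pr => e e0; have [x Kx h] := adh s e e0.
  apply: (le_trans (dle t x Kx)); apply: (le_trans (ler_distD s t x)).
  by rewrite [leLHS]addrC addrAC lerD2r ltW.
exists d; split => // [|t]; last by apply: lb_le_inf => // _ [x _ <-].
apply: cont_meas => u; apply/cvgrPdist_le => e e0; apply/nbhs_ballP; exists e => //= s /ltW us.
rewrite ler_distl; have := lip u s; have := lip s u; rewrite distrC.
by move=> h1 h2; apply/andP; split; lra.
Qed.

(** By [PQ_conv], the conjugate Poisson integral at height [y] of a kernel of scale [d t] is the
    conjugate kernel at height [y + d t]. *)
Lemma Qc_spread d g y x : measurable_fun setT d -> (forall t, 0 < d t) -> integ g -> 0 < y ->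
  integ (fun t => Q (y + d t) (x - t) * g t) /\
  Qc y (spread d g) x = Int (fun t => Q (y + d t) (x - t) * g t).
Proof.
move=> md d0 ig y0; have mg := integ_meas ig.
pose F t u := Q y (x - u) * (g t * P (d t) (u - t)).
have mF : meas2 F.
  apply: meas2_mul; first by apply: meas2_snd; exact: meas_Qsub.
  exact: (meas2_swap (meas2_Pvar mg md d0)).
have iQP t : integ (fun u => P (d t) (t - u) * Q y (u - x)).
  by apply: L2_mul; [exact: L2_P|exact: L2_Q_swap].
have FE t : F t = fun u => (- g t) * (P (d t) (t - u) * Q y (u - x)).
  by apply/funext => u; rewrite /F (PC (d t) t u) (QC y u x); move: (P _ _) (Q _ _) => A B; ring.
have iF t : integ (F t) by rewrite FE; exact: integ_scale.
have FI t : Int (F t) = Q (y + d t) (x - t) * g t.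
  by rewrite FE (Int_scale _ (iQP t)) PQ_conv// QC addrC; move: (Q _ _) => A; ring.
have FG t : Int (fun u => `|F t u|) <= y^-1 * `|g t|.
  rewrite -[leRHS]mulr1 -(Int_P_swap t (d0 t)) -(Int_scale _ (integ_P_swap t (d0 t))).
  apply: Int_le; [exact: integ_abs|by apply: integ_scale; exact: integ_P_swap|].
  move=> u; rewrite /F normrM (normrM (g t)) (ger0_norm (P_ge0 _ (d0 t))) -mulrA.
  by rewrite ler_wpM2r ?Q_bound//; apply: mulr_ge0 => //; exact: P_ge0.
have [i1 ai _ _ h] := Int_fubini mF iF (integ_scale y^-1 (integ_abs ig)) FG.
split; first exact: integ_eq FI i1.
rewrite -(Int_eq FI) h; have [aei iB _] := spread_L1 md d0 ig.
apply: Int_ae.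
- by apply: measurable_funM; [exact: meas_Qsub|exact: integ_meas].
- exact: (measurable_Int (meas2_swap mF)).
- by apply: aeS aei => u i; rewrite /F (Int_scale (Q y (x - u)) i).
Qed.

Lemma Q_right0 a z : 0 <= a -> Q (y + a) z @[y --> 0^'+] --> Q a z.
Proof.
move=> a0; have [->|z0] := eqVneq z 0.
  rewrite (_ : (fun y => _) = fun=> Q a 0); first exact: cvg_cst.
  by apply/funext => y; rewrite /Q !mul0r.
apply/cvg_at_rightP => v [v0 vc]; apply: cvgMl_tmp; apply: cvg_inv_seq.
  by rewrite mulf_neq0// gt_eqF// ltr_pwDl ?sqr_ge0// lt_neqAle sqr_ge0 eq_sym sqrf_eq0 z0.
apply: cvgMl_tmp; apply: cvgD; first exact: cvg_cst.
have h : v n + a @[n --> \oo] --> a.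
  by rewrite -[X in _ --> X]add0r; apply: cvgD => //; exact: cvg_cst.
exact: (cvg_mul_seq h h).
Qed.

Lemma Pc_cont_x y f : 0 < y -> integ f -> forall v x, v @ \oo --> x ->
  Pc y f (v n) @[n --> \oo] --> Pc y f x.
Proof.
move=> y0 fi v x vx.
have [||||_ _ h] := @Int_dct _ (fun n t => P y (v n - t) * f t) (fun t => P y (x - t) * f t)
    (fun t => (pi * y)^-1 * `|f t|).
- by move=> n; apply: integ_meas; apply: integ_Pf => //; exact/W_V/W_L1.
- exact/integ_scale/integ_abs.
- by move=> t n; rewrite normrM ler_wpM2r// ger0_norm ?P_ge0// P_sup.
- move=> t; apply: cvgMr_tmp; apply: cvgMl_tmp; apply: cvg_inv_seq.
    by rewrite gt_eqF// mulr_gt0// den_gt0.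
  apply: cvgMl_tmp; apply: cvgD; last exact: cvg_cst.
  have h : v n - t @[n --> \oo] --> x - t by apply: cvgB => //; exact: cvg_cst.
  exact: (cvg_mul_seq h h).
exact: h.
Qed.

Lemma Qc_L2_right f : L2 f -> {ae mu, forall x, exists l : R, Qc y f x @[y --> 0^'+] --> l}.
Proof.
move=> Lf; have [[_ Lh _] _ _] := hilbert_L2 Lf.
by apply: aeS (ae_Lpt (W_L2 Lh)) => x lx; exists (hilbert f x); exact: Qc_hilbert.
Qed.

(* On [K] the Poisson maximal function of [f] is at most [n]; off [K] the mass of
   [f] is spread at the scale of the distance to [K]. *)
Lemma Hlim_exists_on f (n : nat) : integ f ->
  {ae mu, forall x, (forall y, 0 < y -> Pc y (fun t => `|f t|) x <= n%:R) ->
    exists l : R, Hlim f x l}.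
Proof.
move=> fi; have fa := integ_abs fi; have mf := integ_meas fi.
pose K := [set x | forall y, 0 < y -> Pc y (fun t => `|f t|) x <= n%:R].
have [K0|nK] := pselect (K !=set0); last first.
  by apply: aeT => x Kx; exfalso; apply: nK; exists x.
have [d [md d0 dK dadh]] := dist_to_set K0.
have dKE x : K x -> d x = 0.
  by move=> Kx; apply/eqP; rewrite eq_le d0 andbT -(normr0 R) -(subrr x); exact: dK.
(* [K] is closed, because Poisson integrals at a fixed height are continuous in [x]. *)
have dK0 x : d x = 0 -> K x.
  move=> dx y y0.
  pose e (m : nat) : R := m.+1%:R^-1.
  have /choice[v hv] (m : nat) : exists z, K z /\ `|x - z| < e m.
    have [|z Kz h] := dadh x (e m); first by rewrite invr_gt0.
    by exists z; rewrite dx add0r in h.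
  have vx : v @ \oo --> x.
    apply/cvgrPdist_lt => r r0; have := near_infty_natSinv_lt (PosNum r0).
    by apply: filterS => m /= hm; apply: lt_trans hm; have [] := hv m.
  apply: cvgr_to_le (Pc_cont_x y0 fa vx) _.
  by apply: nearW => m; apply: (hv m).1.
pose Om := [set t | 0 < d t].
have mOm : measurable Om by exact: meas_pos_set.
pose g t := \1_Om t * f t; pose b t := \1_(~` Om) t * f t.
(* The added indicator only makes the scale positive off [Om], where [g] vanishes. *)
pose D t := d t + \1_(~` Om) t.
have mD : measurable_fun setT D.
  by apply: measurable_funD => //; apply: measurable_indic; exact: measurableC.
have DE t : Om t -> D t = d t by move=> h; rewrite /D indicE0 ?addr0.
have D0 t : 0 < D t.
  have [h|h] := pselect (Om t); first by rewrite DE.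
  by rewrite /D indicE1// ltr_wpDl.
have ig : integ g := integ_on mOm fi.
have iga := integ_abs ig.
have gf t : `|g t| <= `|f t| by exact: norm_indicM.
(* Some point of [K] lies within [2 * d t] of [t]; the bound [n] that holds there is carried to [t]
   at the cost of the Harnack constant 9. *)
have gC t : `|g t| * Pc (D t) (fun t => `|g t|) t <= (9 * n%:R) * `|g t|.
  have [h|h] := pselect (Om t); last by rewrite /g indicE0// mul0r normr0 mul0r mulr0.
  rewrite mulrC ler_wpM2r// DE//.
  have [x Kx xt] := dadh t (d t) h.
  apply: le_trans (ler_wpM2l _ (Kx _ h)) => //.
  have i1 : integ (fun s => P (d t) (x - s) * `|f s|) := integ_Pf x h (W_V (W_L1 fa)).
  rewrite /Pc -(Int_scale 9 i1); apply: Int_le; [|exact: integ_scale|].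
    exact: (integ_Pf t h (W_V (W_L1 iga))).
  move=> s; rewrite mulrA; apply: ler_pM => //; first exact: P_ge0.
  by apply: P_harnack => //; rewrite mulr_natl mulr2n ltW.
have LB : L2 (spread D (fun t => `|g t|)).
  by apply: (spread_L2_pos mD D0 _ iga _ gC) => //; rewrite mulr_ge0.
have [aeB iB _] := spread_L1 mD D0 iga.
have [_ iA _] := spread_L1 mD D0 ig.
have LA : L2 (spread D g).
  split; first exact: integ_meas.
  apply: (integ_ae_le _ LB.2); first by apply: measurable_funX; exact: integ_meas.
  apply: aeS aeB => u iu; rewrite ger0_norm ?sqr_ge0//.
  rewrite -(real_normK (num_real (spread D g u))).
  have h : `|spread D g u| <= spread D (fun t => `|g t|) u.
    have mu_ : measurable_fun setT (fun t => g t * P (D t) (u - t)).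
      exact: (@meas2_sec _ _ u (meas2_Pvar (integ_meas ig) mD D0)).
    apply: Int_norm_le => // t; rewrite normrM.
    by rewrite (ger0_norm (P_ge0 _ (D0 t))).
  by rewrite lerXn2r// ?nnegrE// (le_trans _ h).
have ib : integ b by apply: integ_on => //; exact: measurableC.
(* Off [Om], that is on [K], almost every [|f x|] is a limit of Poisson integrals bounded by [n], so
   [b^2] is at most [n |f|]. *)
have Lb : L2 b.
  split; first exact: integ_meas.
  apply: (integ_ae_le _ (integ_scale n%:R fa)); first by apply: measurable_funX; exact: integ_meas.
  apply: aeS (ae_Lpt (W_L1 fa)) => x lx; rewrite ger0_norm ?sqr_ge0// /b.
  have [h|h] := pselect (Om x).
    by rewrite indicE0 ?mul0r ?expr0n/= ?mulr_ge0.
  rewrite indicE1// mul1r -(real_normK (num_real (f x))) expr2 ler_wpM2r//.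
  have Kx : K x by apply: dK0; apply/eqP; rewrite eq_le d0 andbT leNgt; apply/negP.
  apply: cvgr_to_le (Pc_Lpt (W_L1 fa) lx) _.
  by apply: filterS (nbhs_right_gt 0) => y y0; exact: Kx.
have [_ _ hb] := hilbert_L2 Lb.
have bg : f = fun t => 1 * b t + g t.
  apply/funext => t; rewrite /b /g; have [h|h] := pselect (Om t).
    by rewrite (indicE1 h) indicE0 ?mul0r ?mul1r ?mulr0 ?add0r.
  by rewrite (indicE0 h) indicE1// mul0r !mul1r addr0.
apply: aeS2 (aeS2 (fun x => @conj _ _) hb aeB)
  (aeS2 (fun x => @conj _ _) (ae_Lpt (W_L1 ig)) (Qc_L2_right LA)) => x [h1 h2] [h3 [l hl]] Kx.
(* The limit of the error made by spreading; [Q 0] is the singular kernel [1 / (pi z)]. As [x] is in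
   [K], every [t] in [Om] is at distance at least [D t] from it, so [Q_diff_le] dominates the error
   uniformly in the height. *)
pose l' := Int (fun t => (Q 0 (x - t) - Q (D t) (x - t)) * g t).
have lim : Qc y g x - Qc y (spread D g) x @[y --> 0^'+] --> l'.
  apply/cvg_at_rightP => v [v0 vc].
  have iq m : integ (fun t => Q (v m) (x - t) * g t) := integ_Qf x (v0 m) (W_L1 ig).
  have [iQ EQ] : (forall m, integ (fun t => Q (v m + D t) (x - t) * g t)) /\
      (forall m, Qc (v m) (spread D g) x = Int (fun t => Q (v m + D t) (x - t) * g t)).
    by split => m; have [] := Qc_spread x mD D0 ig (v0 m).
  rewrite (_ : (fun m => _) = fun m =>
    Int (fun t => (Q (v m) (x - t) - Q (v m + D t) (x - t)) * g t)); last first.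
    apply/funext => m; rewrite EQ -(Int_sub (iq m) (iQ m)); apply: Int_eq => t.
    by rewrite mulrBl.
  have qr a z : 0 <= a -> Q (v m + a) z @[m --> \oo] --> Q a z.
    by move=> a0; have /cvg_at_rightP := @Q_right0 a z a0; apply; split.
  have [||||_ _ //] := @Int_dct _ (fun m t => (Q (v m) (x - t) - Q (v m + D t) (x - t)) * g t)
    (fun t => (Q 0 (x - t) - Q (D t) (x - t)) * g t) (fun t => 2 * (`|g t| * P (D t) (x - t))).
  - move=> m; apply: integ_meas; apply: integ_eq (integ_sub (iq m) (iQ m)) => t.
    by rewrite mulrBl.
  - exact: integ_scale.
  - move=> t m; have [h|h] := pselect (Om t); last first.
      by rewrite /g indicE0// mul0r mulr0 normr0 mul0r mulr0.
    rewrite normrM [leRHS]mulrCA [leLHS]mulrC ler_wpM2l//; apply: Q_diff_le => //.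
    by rewrite DE// distrC; exact: dK.
  - move=> t; apply: cvgMr_tmp; apply: cvgB; last exact/qr/ltW.
    by have := qr 0 (x - t) (lexx _); under eq_fun do rewrite addr0.
have limg : Qc y g x @[y --> 0^'+] --> 1 * l' + l.
  by apply: cvg_right_ext (cvg_right_lin (c := 1) lim hl) => y _; rewrite mul1r subrK.
have Hg := Hlim_Lpt (W_L1 ig) h3 limg.
exists (1 * hilbert b x + (1 * l' + l)).
have H := @Hlim_add _ 1 b g x _ _ (W_L1 ib) (W_L1 ig) h1 Hg.
by rewrite -bg in H.
Qed.

(** At a Lebesgue point of [|f|] the Poisson integrals are at most [|f x| + 1] for small [y], and
    for [y >= r] the kernel is at most [1 / (pi r)]: almost every point satisfies the maximal bound
    for some [n]. *)
Lemma Hlim_exists f : integ f -> {ae mu, forall x, exists l : R, Hlim f x l}.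
Proof.
move=> fi; have fa := integ_abs fi; have Va := W_V (W_L1 fa).
have h := ae_foralln (fun n => Hlim_exists_on n fi).
apply: aeS2 h (ae_Lpt (W_L1 fa)) => x hx lx.
have /cvgrPdist_le/(_ _ ltr01) [r /= r0 hr] := Pc_Lpt (W_L1 fa) lx.
pose M := `|f x| + 1 + (pi * r)^-1 * Int (fun t => `|f t|).
have I0 : 0 <= Int (fun t => `|f t|) by apply: Int_ge0 => t; exact: normr_ge0.
have r1 : 0 <= (pi * r)^-1 by rewrite invr_ge0 mulr_ge0 ?ltW.
apply: (hx (Num.trunc M).+1) => y y0; apply: (@le_trans _ _ M); last first.
  by apply/ltW; rewrite truncnS_gt.
have [yr|ry] := ltP y r.
  have := hr y; rewrite /= sub0r normrN gtr0_norm// => /(_ yr y0).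
  rewrite ler_distlC => /andP[_ h1]; apply: (le_trans h1).
  by rewrite /M lerDl mulr_ge0.
apply: (@le_trans _ _ ((pi * r)^-1 * Int (fun t => `|f t|))).
  rewrite -(Int_scale _ fa); apply: Int_le; [exact: integ_Pf|exact: integ_scale|].
  move=> t; rewrite ler_wpM2r//; apply: le_trans (P_sup _ y0) _.
  by rewrite lef_pV2 ?posrE ?mulr_gt0// ler_pM2l.
by rewrite /M lerDr addr_ge0.
Qed.

Lemma hilbert_ae f : integ f -> {ae mu, forall x, Hlim f x (hilbert f x)}.
Proof. by move=> fi; apply: aeS (Hlim_exists fi) => x [l h]; rewrite (Hlim_hilbert h). Qed.

End Existence2.

(** * The logarithm *)

Section LogKernel.
Context {R : realType}.
Local Notation mu := (@lebesgue_measure R).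
Implicit Types (f g h k : R -> R) (F G : R -> R -> R) (x y t a b c s u r z : R).

Let pi0 : 0 < pi :> R := pi_gt0 R.
Let piN0 : pi != 0 :> R := lt0r_neq0 pi0.
Ltac gpi := have := piN0; move: (pi : R) => p pN0.

Lemma ae_neq a : {ae mu, forall x, x != a}.
Proof.
exists [set a]; split; [exact: measurable_set1|exact: lebesgue_measure_set1|].
by move=> t /= /negP; rewrite negbK => /eqP.
Qed.

Lemma hilbert_lin c f g : W f -> W g ->
  {ae mu, forall x, Hlim f x (hilbert f x)} -> {ae mu, forall x, Hlim g x (hilbert g x)} ->
  {ae mu, forall x, hilbert (fun t => c * f t + g t) x = c * hilbert f x + hilbert g x}.
Proof.
move=> Wf Wg hf hg; apply: aeS2 hf hg => x h1 h2.
by apply: Hlim_hilbert; exact: (Hlim_add Wf Wg h1 h2).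
Qed.

Lemma Hlim_ae f g x (l : R) : W f -> W g -> {ae mu, forall t, f t = g t} ->
  Hlim f x l -> Hlim g x l.
Proof.
move=> Wf Wg fg; apply: cvg_right_ext => y y0; rewrite !truncE//; apply: Int_ae.
- by apply: integ_meas; exact: integ_Tf.
- by apply: integ_meas; exact: integ_Tf.
- by apply: aeS fg => t ->.
Qed.

Lemma L2_hilbert f : L2 f -> L2 (hilbert f).
Proof. by move=> Lf; have [[]] := hilbert_L2 Lf. Qed.

(** Polarization of the isometry. *)
Lemma hilbert_inner f g : L2 f -> L2 g ->
  Int (fun x => hilbert f x * hilbert g x) = Int (fun x => f x * g x).
Proof.
move=> Lf Lg; have [[_ Lf' _] nf hf] := hilbert_L2 Lf; have [[_ Lg' _] ng hg] := hilbert_L2 Lg.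
have Lfg := L2_add (L2_scale 1 Lf) Lg; have [_ n _] := hilbert_L2 Lfg.
have E : n2 (hilbert (fun x => 1 * f x + g x)) = n2 (fun x => 1 * hilbert f x + hilbert g x).
  apply: Int_ae.
  - by apply: measurable_funX; exact: (L2_hilbert Lfg).1.
  - by apply: measurable_funX; exact: (L2_add (L2_scale 1 Lf') Lg').1.
  - by apply: aeS (hilbert_lin 1 (W_L2 Lf) (W_L2 Lg) hf hg) => x ->.
have S h k : n2 (fun x => 1 * h x + k x) = n2 (fun x => h x + k x).
  by apply: Int_eq => x; rewrite mul1r.
rewrite n S S (n2_add Lf Lg) (n2_add Lf' Lg') nf ng in E.
have two : 2 != 0 :> R by rewrite pnatr_eq0.
by move/addrI: E => /(mulfI two) ->.
Qed.

(** Apply [hilbert_inner] to [f] and [hilbert g]; the transform squares to -1. *)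
Lemma hilbert_adj f g : L2 f -> L2 g ->
  Int (fun x => f x * hilbert g x) = - Int (fun x => hilbert f x * g x).
Proof.
move=> Lf Lg; have [cg _ _] := hilbert_L2 Lg; have Lg' := L2_hilbert Lg.
rewrite -(hilbert_inner Lf Lg') -(Int_opp (L2_mul (L2_hilbert Lf) Lg)); apply: Int_ae.
- by apply: integ_meas; exact: (L2_mul (L2_hilbert Lf) (L2_hilbert Lg')).
- by apply: integ_meas; apply: integ_opp; exact: (L2_mul (L2_hilbert Lf) Lg).
- by apply: aeS (conj_pair_ae (conj_pair_opp cg)) => x /Hlim_hilbert ->; rewrite mulrN.
Qed.

Lemma L2_indic_itv a c : L2 (\1_`[a, c] : R -> R).
Proof.
split; first exact: measurable_indic.
have : integ (\1_`[a, c] : R -> R) by exact: integrable_indic_itv.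
by apply: integ_eq => x; rewrite indicE; case: (_ \in _) => /=; rewrite ?expr1n ?expr0n.
Qed.

Lemma n2_indic_itv a c : a < c -> n2 (\1_`[a, c] : R -> R) = c - a.
Proof.
move=> ac; have := FTC_itv ac (fun x => cvg_cst (1 : R)) (fun x => is_derive_id x 1).
move=> <-; apply: Int_eq => x; rewrite mulr1 indicE.
by case: (_ \in _) => /=; rewrite ?expr1n ?expr0n.
Qed.

Lemma Qc_indic a c y t : a < c -> 0 < y -> Qc y \1_`[a, c] t =
  (2 * pi)^-1 * (ln ((a - t) ^+ 2 + y ^+ 2) - ln ((c - t) ^+ 2 + y ^+ 2)).
Proof.
move=> ac y0; pose Phi s := - (2 * pi)^-1 * ln ((s - t) ^+ 2 + y ^+ 2) + 0 * 0.
have dPhi s : is_derive s 1 Phi (Q y (t - s)).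
  apply: (is_derive_eq (is_derive_lin (- (2 * pi)^-1) 0 (is_derive_ln_shift t s y0) (is_derive_cst (0 : R) s 1))).
  rewrite QC /Q; move: (den_gt0 (s - t) y0); move: (_ ^+ 2 + _) => A A0.
  by gpi; field; rewrite pN0 gt_eqF.
have cQ s : {for s, continuous (fun s => Q y (t - s))}.
  rewrite (_ : (fun s => _) = fun s => - Q y (s - t)); last by apply/funext => v; rewrite QC.
  by apply: cvgN; exact: cont_Q.
have := FTC_itv ac cQ dPhi; rewrite /Phi => E.
rewrite /Qc (@Int_eq _ _ (fun s => \1_`[a, c] s * Q y (t - s))); last by move=> s; rewrite mulrC.
by rewrite E; move: (ln _) (ln _) => A B; ring.
Qed.

Lemma hilbert_indic a c : a < c ->
  {ae mu, forall t, hilbert \1_`[a, c] t = pi^-1 * (ln `|t - a| - ln `|t - c|)}.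
Proof.
move=> ac; have Li := L2_indic_itv a c; have [[_ Lh _] _ _] := hilbert_L2 Li.
apply: aeS3 (ae_Lpt (W_L2 Lh)) (ae_neq a) (ae_neq c) => t lt ta tc.
pose e (n : nat) : R := n.+1%:R^-1.
have e0 n : 0 < e n by rewrite invr_gt0.
have ec : e @ \oo --> (0 : R) by exact: cvg_harmonic.
have c1 := cvg_right_seq (Qc_hilbert Li lt).
have lnc z : t != z -> ln ((z - t) ^+ 2 + e n ^+ 2) @[n --> \oo] --> 2 * ln `|t - z|.
  move=> tz; have z0 : 0 < `|t - z| by rewrite normr_gt0 subr_eq0.
  have -> : 2 * ln `|t - z| = ln ((z - t) ^+ 2).
    rewrite -(real_normK (num_real (z - t))) (distrC z t) expr2 lnM ?posrE//.
    by rewrite mulr_natl mulr2n.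
  apply: (@continuous_cvg _ _ _ _ _ (fun n => (z - t) ^+ 2 + e n ^+ 2) (@ln R)).
    by apply: continuous_ln; rewrite -(real_normK (num_real (z - t))) distrC exprn_gt0.
  rewrite -[X in _ --> X]addr0; apply: cvgD; first exact: cvg_cst.
  exact: cvg_sqr0.
have c2 : Qc (e n) \1_`[a, c] t @[n --> \oo] --> (2 * pi)^-1 * (2 * ln `|t - a| - 2 * ln `|t - c|).
  rewrite (_ : (fun n => _) = fun n =>
    (2 * pi)^-1 * (ln ((a - t) ^+ 2 + e n ^+ 2) - ln ((c - t) ^+ 2 + e n ^+ 2))).
    by apply: cvgMl_tmp; apply: cvgB; exact: lnc.
  by apply/funext => n; rewrite Qc_indic.
rewrite (cvg_seq_unique c1 c2); move: (ln _) (ln _) => A B.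
by gpi; field.
Qed.

Lemma meas_ln_dist b : measurable_fun setT (fun t => ln `|t - b|).
Proof.
apply: measurableT_comp; first exact: measurable_ln.
by apply: measurableT_comp => //; exact: measurable_funB.
Qed.

Lemma ln_bound u r : 1 <= u -> u <= r -> `|ln u| <= r.
Proof.
move=> u1 ur; rewrite ger0_norm ?ln_ge0//; have := le_ln1Dx (_ : -1 < u - 1).
by rewrite subrKC => h; apply: le_trans (h _) _; lra.
Qed.

(** The singularity is taken from a Hilbert transform: [ln |t - b|] is [ln |t - a|] minus [pi] times
    the transform of the indicator of [[a, b]], which is in L^2. The point [a] is more than 1 to the
    left of [[-n, n]], so [ln |t - a|] is bounded there. *)
Lemma integ_ln_itv (n : nat) b : integ (fun t => \1_`[- n%:R, n%:R] t * ln `|t - b|).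
Proof.
pose M : R := n%:R + `|b| + 1; pose a := - M - 1.
have n0 : 0 <= n%:R :> R by [].
have ab : a < b by have := ler_norm (- b); rewrite normrN /a /M; lra.
have L1 : L2 (fun t => \1_`[- n%:R, n%:R] t) by exact: L2_indic_itv.
have i1 : integ (fun t => \1_`[- n%:R, n%:R] t * hilbert \1_`[a, b] t).
  by apply: L2_mul => //; apply: L2_hilbert; exact: L2_indic_itv.
have i2 : integ (fun t => \1_`[- n%:R, n%:R] t * ln `|t - a|).
  have i3 : integ (\1_`[- n%:R, n%:R] : R -> R) by exact: integrable_indic_itv.
  apply: (integ_le _ (integ_scale (2 * M + 1) i3)).
    by apply: measurable_funM; [exact: measurable_indic|exact: meas_ln_dist].
  move=> t; rewrite normrM [leRHS]mulrC ger0_norm ?indic_ge0// ; have [h|h] := pselect (`[- n%:R, n%:R]%classic t).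
    rewrite indicE1// !mul1r; move: h; rewrite /= in_itv/= => /andP[h1 h2].
    have b0 := normr_ge0 b; have ta : 0 < t - a by rewrite /a /M; lra.
    by rewrite (gtr0_norm ta); apply: ln_bound; rewrite /a /M; lra.
  by rewrite indicE0// !mul0r.
apply: (integ_ae (integ_sub i2 (integ_scale pi i1))).
  by apply: measurable_funM; [exact: measurable_indic|exact: meas_ln_dist].
apply: aeS (hilbert_indic ab) => t ->; move: (ln _) (ln _) => A B.
by gpi; field.
Qed.

(** * The logarithm as a locally integrable function *)

Definition psi b x := ln (1 / `|x - b|).

(** At [x = b] both sides are 0 by the conventions for the inverse and the logarithm of 0. *)
Lemma psiE b x : psi b x = - ln `|x - b|.
Proof.
rewrite /psi div1r; have [->|xb] := eqVneq x b.
  by rewrite subrr normr0 invr0 ln0// oppr0.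
by rewrite lnV// posrE normr_gt0 subr_eq0.
Qed.

Lemma meas_psi b : measurable_fun setT (psi b).
Proof.
by rewrite (_ : psi b = fun x => - ln `|x - b|); [exact: measurable_funN (meas_ln_dist b)|apply/funext => x; exact: psiE].
Qed.

Lemma integ_psi_bounded b g (M r : R) : measurable_fun setT g -> (forall x, `|g x| <= M) ->
  (forall x, r < `|x| -> g x = 0) -> integ (fun x => g x * psi b x).
Proof.
move=> mg gM gr; pose n := (Num.trunc r).+1.
have rn : r < n%:R by exact: truncnS_gt.
apply: (integ_le _ (integ_scale M (integ_abs (integ_ln_itv n b)))) => [|x].
  by apply: measurable_funM => //; exact: meas_psi.
rewrite psiE normrM normrN; have [xr|rx] := leP `|x| r; last first.
  by rewrite gr// normr0 mul0r; apply: mulr_ge0 => //; apply: le_trans (gM x).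
rewrite ler_pM// indicE1 ?mul1r//= in_itv/=; rewrite -ler_norml.
by rewrite (le_trans xr)// ltW.
Qed.

Lemma psi_locally_integrable b : locally_integrable setT (psi b).
Proof.
apply: locally_integrable_balls; first exact: meas_psi.
move=> r; have h := @integ_psi_bounded b \1_(ball 0 r) 1 r.
have : integ (fun x => `|\1_(ball 0 r) x * psi b x|).
  apply/integ_abs/h => [|x|x rx].
  - by apply: measurable_indic; exact: measurable_ball.
  - by rewrite ger0_norm ?indic_ge0 ?indic_le1.
  - by rewrite indicE0// /ball/= sub0r normrN => /ltW; rewrite leNgt rx.
by apply: integ_eq => x; rewrite normrM ger0_norm ?indic_ge0.
Qed.

End LogKernel.

(** * Bounded mean oscillation, molecules and the functional *)

Section Functional.
Context {R : realType}.
Local Notation mu := (@lebesgue_measure R).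
Implicit Types (f g h k : R -> R) (F G : R -> R -> R) (x y t a b c s u v r z : R).

Let pi0 : 0 < pi :> R := pi_gt0 R.
Let piN0 : pi != 0 :> R := lt0r_neq0 pi0.
Ltac gpi := have := piN0; move: (pi : R) => p pN0.

Lemma Int_ae_le f g : integ f -> integ g -> {ae mu, forall x, f x <= g x} -> Int f <= Int g.
Proof.
move=> fi gi fg; rewrite -subr_ge0 -(Int_sub gi fi).
have d := integ_sub gi fi.
rewrite (@Int_ae _ _ (fun x => `|g x - f x|)).
- by apply: Int_ge0 => x; exact: normr_ge0.
- exact: integ_meas.
- by apply: integ_meas; exact: integ_abs.
- by apply: aeS fg => x h; rewrite ger0_norm// subr_ge0.
Qed.

Lemma ln_near1 r : 2^-1 <= r -> `|ln r| <= 2 * `|r - 1|.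
Proof.
move=> r2; have r0 : 0 < r by lra.
have lnle u : 0 < u -> ln u <= u - 1.
  by move=> u0; have := le_ln1Dx (_ : -1 < u - 1); rewrite subrKC; apply; lra.
have [r1|r1] := leP 1 r.
  rewrite ger0_norm ?ln_ge0// ger0_norm ?subr_ge0//; have := lnle r r0; lra.
rewrite (ler0_norm (ln_le0 (ltW r1))) -lnV ?posrE// ltr0_norm ?subr_lt0//.
apply: le_trans (lnle _ _) _; first by rewrite invr_gt0.
have ri : r^-1 <= 2 by rewrite invf_ple ?posrE.
have -> : r^-1 - 1 = r^-1 * (1 - r) by field; rewrite gt_eqF.
by rewrite opprB ler_wpM2r//; lra.
Qed.

Lemma ln_diff u v : 0 < u -> 0 < v -> v <= 2 * u -> `|ln u - ln v| <= 2 * `|u - v| / v.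
Proof.
move=> u0 v0 h; rewrite -ln_div ?posrE//.
have -> : 2 * `|u - v| / v = 2 * `|u / v - 1|.
  by rewrite -[X in 2 * X / _]mulr1 -mulrA; congr (2 * _);
    rewrite mulr1 -{2}(gtr0_norm v0) -normfV -normrM mulrBl divff ?gt_eqF.
by apply: ln_near1; rewrite ler_pdivlMr//; lra.
Qed.

Lemma integ_psi_itv b a c : integ (fun t => \1_`[a, c] t * psi b t).
Proof.
apply: (@integ_psi_bounded _ b _ 1 (`|a| + `|c|)) => [|t|t h].
- exact: measurable_indic.
- by rewrite ger0_norm ?indic_ge0 ?indic_le1.
- rewrite indicE0// /= in_itv/= => /andP[h1 h2]; move: h; apply/negP; rewrite -leNgt.
  have := ler_norm c; have := ler_norm (- a); rewrite normrN => h3 h4.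
  have := normr_ge0 a; have := normr_ge0 c => h5 h6.
  by rewrite ler_norml; apply/andP; split; lra.
Qed.

Lemma Int_indic_itv a c : a < c -> Int (\1_`[a, c] : R -> R) = c - a.
Proof.
move=> ac; rewrite -(n2_indic_itv ac); apply: Int_eq => x; rewrite indicE.
by case: (_ \in _) => /=; rewrite ?expr1n ?expr0n.
Qed.

(* Far from [b] the logarithm varies little on the interval. Near [b], up to a
   bounded term, [psi b] is [pi] times the Hilbert transform of the indicator of
   an interval of comparable length, whose L^2 norm is known. *)
Lemma psi_oscillation b a c : a < c -> exists c0 : R,
  Int (fun t => \1_`[a, c] t * `|psi b t - c0|) <= (2 * pi ^+ 2 + 3) * (c - a).
Proof.
move=> ac; pose l := c - a; have l0 : 0 < l by rewrite subr_gt0.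
have i1 : integ (\1_`[a, c] : R -> R) by exact: integrable_indic_itv.
have I1 : Int (\1_`[a, c] : R -> R) = l := Int_indic_itv ac.
have io c0 : integ (fun t => \1_`[a, c] t * `|psi b t - c0|).
  have : integ (fun t => `|\1_`[a, c] t * psi b t - c0 * \1_`[a, c] t|).
    by apply: integ_abs; apply: integ_sub; [exact: integ_psi_itv|exact: integ_scale].
  apply: integ_eq => t; rewrite (mulrC c0) -mulrBr normrM ger0_norm//; exact: indic_ge0.
have p2 : 0 <= pi ^+ 2 :> R by exact: sqr_ge0.
have [ab|ab] := leP `|a - b| (2 * l); last first.
  exists (- ln `|a - b|).
  apply: (@le_trans _ _ (Int (fun t => 2 * \1_`[a, c] t))); last first.
    by rewrite (Int_scale 2 i1) I1 ler_wpM2r ?(ltW l0)//; lra.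
  apply: Int_le; [exact: io|exact: integ_scale|move=> t].
  have [h|h] := pselect (`[a, c]%classic t); last by rewrite indicE0// mul0r mulr0.
  rewrite indicE1// mul1r mulr1 psiE -opprB normrN opprK addrC.
  move: h; rewrite /= in_itv/= => /andP[h1 h2].
  have d0 : 0 < `|a - b| by lra.
  have d1 : `|a - b| <= `|t - b| + l.
    rewrite (_ : a - b = (t - b) + (a - t)); last by ring.
    apply: (le_trans (ler_normD _ _)); rewrite lerD2l ler0_norm; rewrite /l; lra.
  have d2 : `| `|t - b| - `|a - b| | <= l.
    apply: (le_trans (ler_dist_dist _ _)); rewrite (_ : t - b - (a - b) = t - a); last by ring.
    by rewrite ger0_norm /l; lra.
  apply: le_trans (ln_diff _ _ _) _; [lra|by []|lra|].
  by rewrite ler_pdivrMr//; lra.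
(* For [t] in [[a, c]] the distance to [p] is between [2 l] and [7 l], so its logarithm is within 2
   of [ln (4 l)]; the rest of [psi b t] is [pi * H t]. *)
pose p := b - 4 * l; have pb : p < b by rewrite /p; lra.
exists (- ln (4 * l)).
pose H := hilbert (\1_`[p, b] : R -> R).
have LI := L2_indic_itv p b; have [[_ LH _] nH _] := hilbert_L2 LI.
(* [|pi H| + 2] is at most [(pi H)^2 / 2 + 5 / 2], and [n2 H] is the length [4 l] of [[p, b]]; this
   is where [2 pi^2 + 3] comes from. *)
apply: (@le_trans _ _ (Int (fun t => (pi ^+ 2 / 2) * H t ^+ 2 + (5 / 2) * \1_`[a, c] t))); last first.
  rewrite (Int_add (integ_scale (pi ^+ 2 / 2) LH.2) (integ_scale (5 / 2) i1)).
  rewrite (Int_scale _ LH.2) (Int_scale _ i1) I1 nH (n2_indic_itv pb).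
  by rewrite /p -/l; move: (pi ^+ 2) p2 => P2 P20; nra.
apply: Int_ae_le; [exact: io|by apply: integ_add; apply: integ_scale => //; exact: LH.2|].
apply: aeS (hilbert_indic pb) => t Ht.
have E1 : pi ^+ 2 / 2 * H t ^+ 2 = (pi * H t) ^+ 2 / 2 by ring.
rewrite E1; have [h|h] := pselect (`[a, c]%classic t); last first.
  by rewrite indicE0// mul0r mulr0 addr0 divr_ge0// sqr_ge0.
rewrite indicE1// mul1r mulr1; move: h; rewrite /= in_itv/= => /andP[h1 h2].
have E2 : pi * H t = ln `|t - p| - ln `|t - b|.
  by rewrite /H Ht mulrA divff// mul1r.
move: ab; rewrite ler_norml => /andP[h3 h4].
have tp : 0 < t - p by rewrite /p /l in h3 h4 l0 *; lra.
have E3 : psi b t - - ln (4 * l) = pi * H t - (ln (t - p) - ln (4 * l)).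
  by rewrite E2 psiE (gtr0_norm tp); move: (ln _) (ln _) (ln _) => A B C; ring.
have h5 : `|ln (t - p) - ln (4 * l)| <= 2.
  apply: le_trans (ln_diff _ _ _) _ => //; [by lra|by rewrite /p /l in h3 h4 l0 *; lra|].
  rewrite ler_pdivrMr; last by lra.
  rewrite ler_pM2l// ler_norml; apply/andP; split; rewrite /p /l in h3 h4 l0 *; lra.
rewrite E3; apply: (le_trans (ler_normB _ _)).
rewrite -(real_normK (num_real (pi * H t))).
by have := sqr_ge0 (`|pi * H t| - 1); move: `|pi * H t| h5 => A; nra.
Qed.

(** Passing from the constant [c0] to the mean at most doubles the oscillation. *)
Lemma psi_BMO b : BMO (psi b).
Proof.
split; first exact: psi_locally_integrable.
exists (2 * (2 * pi ^+ 2 + 3)) => a c ac; have [c0 hc] := psi_oscillation b ac.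
have l0 : 0 < c - a by rewrite subr_gt0.
have i1 : integ (\1_`[a, c] : R -> R) by exact: integrable_indic_itv.
have I1 := Int_indic_itv ac.
have isub r : integ (fun t => \1_`[a, c] t * (psi b t - r)).
  apply: integ_eq (integ_sub (integ_psi_itv b a c) (integ_scale r i1)) => t.
  by rewrite (mulrC r) -mulrBr.
have io r : integ (fun t => \1_`[a, c] t * `|psi b t - r|).
  apply: integ_eq (integ_abs (isub r)) => t.
  by rewrite normrM ger0_norm//; exact: indic_ge0.
set m := mean (psi b) a c.
have hm : `|m - c0| <= 2 * pi ^+ 2 + 3.
  have -> : m - c0 = (c - a)^-1 * Int (fun t => \1_`[a, c] t * (psi b t - c0)).
    rewrite (@Int_eq _ _ (fun t => \1_`[a, c] t * psi b t - c0 * \1_`[a, c] t)); last first.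
      by move=> t; rewrite (mulrC c0) -mulrBr.
    rewrite (Int_sub (integ_psi_itv b a c) (integ_scale c0 i1)) (Int_scale c0 i1) I1.
    by rewrite /m /mean Int_on; field; rewrite gt_eqF.
  rewrite normrM gtr0_norm ?invr_gt0// ler_pdivrMl// mulrC; apply: le_trans hc.
  apply: (le_trans (Int_norm (isub c0))); apply: Int_le; [exact/integ_abs|exact: io|].
  by move=> t; rewrite normrM ger0_norm//; exact: indic_ge0.
rewrite /mean Int_on ler_pdivrMl//.
apply: (@le_trans _ _ (Int (fun t => \1_`[a, c] t * `|psi b t - c0| + `|m - c0| * \1_`[a, c] t))).
  apply: Int_le; [exact: io|by apply: integ_add; [exact: io|exact: integ_scale]|].
  move=> t; rewrite (mulrC `|m - c0|) -mulrDr ler_wpM2l ?indic_ge0//.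
  by rewrite (distrC m); exact: ler_distD.
rewrite (Int_add (io c0) (integ_scale _ i1)) (Int_scale _ i1) I1.
have : `|m - c0| * (c - a) <= (2 * pi ^+ 2 + 3) * (c - a) by rewrite ler_pM2r.
by move: hc; move: (Int _) (2 * pi ^+ 2 + 3) `|m - c0| (c - a) => A B C X; lra.
Qed.

(** The arithmetic-geometric mean inequality for [|g|], with weight [la (1 + x^2)]. With [la] free
    no square roots are needed: the two L^2 norms can be made small before [la] is taken large. *)
Lemma L1_of_weight g (la : R) : 0 < la -> L2 g -> L2 (fun x => x * g x) ->
  integ g /\ Int (fun x => `|g x|) <= la * (n2 g + n2 (fun x => x * g x)) + la^-1 * pi.
Proof.
move=> la0 Lg Lxg.
have il : integ (fun x => la * (g x ^+ 2 + (x * g x) ^+ 2) + la^-1 * (1 + x ^+ 2)^-1).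
  apply: integ_add; first by apply: integ_scale; apply: integ_add; [exact: Lg.2|exact: Lxg.2].
  exact/integ_scale/integ_sqr1.
have h x : `|g x| <= la * (g x ^+ 2 + (x * g x) ^+ 2) + la^-1 * (1 + x ^+ 2)^-1.
  have := sqr1_gt0 x; rewrite exprMn -(real_normK (num_real (g x))).
  move: `|g x| (normr_ge0 (g x)) => G G0; rewrite -{1}(mul1r (G ^+ 2)) -mulrDl.
  move: (1 + x ^+ 2) => w w0; have W0 : 0 < la * w by exact: mulr_gt0.
  have -> : la * (w * G ^+ 2) + la^-1 * w^-1 = ((la * w * G) ^+ 2 + 1) / (la * w).
    by field; rewrite !gt_eqF.
  by rewrite ler_pdivlMr// mulrC; have := sqr_ge0 (la * w * G - 1); have := sqr_ge0 (la * w * G); nra.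
have ig : integ g by apply: (integ_le _ il) => //; exact: Lg.1.
split => //; apply: (le_trans (Int_le (integ_abs ig) il h)).
have i1 := integ_add Lg.2 Lxg.2.
rewrite (Int_add (integ_scale la i1) (integ_scale la^-1 integ_sqr1)).
by rewrite (Int_scale la i1) (Int_scale la^-1 integ_sqr1) Int_sqr1 (Int_add Lg.2 Lxg.2).
Qed.

(* For mean zero [k] the commutator of the Hilbert transform and
   multiplication by [x] vanishes. *)
Lemma hilbert_mulx k : L2 k -> L2 (fun t => t * k t) -> Int k = 0 ->
  {ae mu, forall x, hilbert (fun t => t * k t) x = x * hilbert k x}.
Proof.
move=> Lk Lxk k0; have [ik _] := L1_of_weight ltr01 Lk Lxk.
have [[_ Lh _] _ _] := hilbert_L2 Lk; have [[_ Lhx _] _ _] := hilbert_L2 Lxk.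
apply: aeS2 (ae_Lpt (W_L2 Lh)) (ae_Lpt (W_L2 Lhx)) => x lx lxx.
pose e (n : nat) : R := n.+1%:R^-1.
have e0 n : 0 < e n by rewrite invr_gt0.
have ec : e @ \oo --> (0 : R) by exact: cvg_harmonic.
pose w n u : R := u ^+ 2 / (u ^+ 2 + e n ^+ 2).
have c1 := cvg_right_seq (Qc_hilbert Lxk lxx); have c2 := cvg_right_seq (Qc_hilbert Lk lx).
have mw n : measurable_fun setT (fun t => w n (x - t)) := meas_cutoff x (e0 n).
have w01 n u : `|w n u| <= 1 := cutoff_le1 u (e0 n).
have mk := integ_meas ik.
have iw n : integ (fun t => w n (x - t) * k t).
  apply: (integ_le _ (integ_abs ik)); first exact: measurable_funM.
  by move=> t; rewrite normrM ler_piMl.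
have c3 : Int (fun t => w n (x - t) * k t) @[n --> \oo] --> Int k.
  apply: (@Int_dct_ae _ _ _ (fun t => `|k t|) _ _ _ _ _).2 => //.
  - by move=> n; exact: integ_meas.
  - exact: integ_abs.
  - by apply: aeT => t n; rewrite normrM ler_piMl.
  - apply: aeS (ae_neq x) => t tx; rewrite -[X in _ --> X]mul1r; apply: cvgMr_tmp.
    by apply: cvg_cutoff; rewrite subr_eq0 eq_sym.
(* Write [t = x - (x - t)]: the product of [x - t] with the kernel is the cutoff [w] divided by
   [pi]. *)
have E n : Qc (e n) (fun t => t * k t) x =
    x * Qc (e n) k x - pi^-1 * Int (fun t => w n (x - t) * k t).
  have iq := integ_Qf x (e0 n) (W_L2 Lk).
  rewrite /Qc -(Int_scale x iq) -(Int_scale pi^-1 (iw n)).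
  rewrite -(Int_sub (integ_scale x iq) (integ_scale pi^-1 (iw n))).
  apply: Int_eq => t; have := den_gt0 (x - t) (e0 n); rewrite /w /Q; move: (e n) => r d.
  by gpi; field; rewrite pN0 gt_eqF.
have c4 : Qc (e n) (fun t => t * k t) x @[n --> \oo] --> x * hilbert k x - pi^-1 * Int k.
  rewrite (_ : (fun n => _) = fun n => x * Qc (e n) k x - pi^-1 * Int (fun t => w n (x - t) * k t)).
    by apply: cvgB; exact: cvgMl_tmp.
  exact/funext.
by rewrite (cvg_seq_unique c1 c4) k0 mulr0 subr0.
Qed.

(** By the isometry and [hilbert_mulx], [hilbert k] and its product with [x] have the same L^2 norms
    as those of [k], so [L1_of_weight] applies to it. *)
Lemma hilbert_molecule k (la : R) : 0 < la -> L2 k -> L2 (fun t => t * k t) -> Int k = 0 ->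
  integ (hilbert k) /\
  Int (fun x => `|hilbert k x|) <= la * (n2 k + n2 (fun x => x * k x)) + la^-1 * pi.
Proof.
move=> la0 Lk Lxk k0; have [[_ Lh _] n1 _] := hilbert_L2 Lk.
have [[_ Lhx _] n2' _] := hilbert_L2 Lxk; have hm := hilbert_mulx Lk Lxk k0.
have mx : measurable_fun setT (fun x => x * hilbert k x).
  by apply: measurable_funM => //; exact: Lh.1.
have Lxh : L2 (fun x => x * hilbert k x) by exact: L2_ae Lhx mx hm.
have E : n2 (fun x => x * hilbert k x) = n2 (fun x => x * k x).
  rewrite -n2'; apply: Int_ae; [exact: measurable_funX|by apply: measurable_funX; exact: Lhx.1|].
  by apply: aeS hm => x ->.
by have := L1_of_weight la0 Lh Lxh; rewrite n1 E.
Qed.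

Lemma bounded_support_L2 h (M r : R) : measurable_fun setT h -> (forall x, `|h x| <= M) ->
  (forall x, r < `|x| -> h x = 0) -> [/\ integ h, L2 h & L2 (fun x => x * h x)].
Proof.
move=> mh hM hr; have LI := L2_indic_itv (- `|r|) `|r|.
have E x : \1_`[- `|r|, `|r|] x * h x = h x.
  have [h1|h1] := pselect (`[- `|r|, `|r|]%classic x); first by rewrite indicE1// mul1r.
  rewrite indicE0// mul0r hr//; apply: le_lt_trans (ler_norm r) _; rewrite ltNge.
  by apply/negP; rewrite ler_norml => h2; apply: h1; rewrite /= in_itv/=.
have Lh : L2 h.
  by have := L2_bound LI mh hM; congr L2; apply/funext => x; rewrite E.
split => //; first by apply: integ_eq E _; exact: L2_mul.
have mxh : measurable_fun setT (fun x => x * h x) by exact: measurable_funM.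
have xM x : `|x * h x| <= `|r| * M.
  have [xr|xr] := ltP r `|x|.
    by rewrite hr// mulr0 normr0 mulr_ge0// (le_trans _ (hM x)).
  by rewrite normrM ler_pM// (le_trans xr)// ler_norm.
have := L2_bound LI mxh xM; congr L2; apply/funext => x.
by rewrite mulrCA E.
Qed.

Lemma test_support h : compact (closure [set x | h x != 0]) ->
  exists r : R, forall x, r < `|x| -> h x = 0.
Proof.
move=> /compact_bounded [M [_ hM]]; exists (`|M| + 1) => x xr.
apply/eqP; apply: contraT => hx.
have := hM (`|M| + 1) _ x; rewrite (le_lt_trans (ler_norm _)) ?ltrDl// => /(_ isT).
have cx : closure [set x | h x != 0] x by apply: subset_closure; exact: hx.
by move=> /(_ cx) /=; rewrite leNgt xr.
Qed.

Definition L0 b h : R := - pi * Rintegral mu `]-oo, b] (hilbert h).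

(* Pair [h] with the Hilbert transform of the indicator of [-m, b] and let [m]
   tend to infinity. *)
Lemma L0_test b h : H1_test h -> L0 b h = Int (fun x => h x * psi b x).
Proof.
move=> [mh [M hM] ch h0]; have [r hr] := test_support ch.
have [ih Lh Lxh] := bounded_support_L2 mh hM hr.
have [iH _] := hilbert_molecule ltr01 Lh Lxh h0.
have ip := integ_psi_bounded b mh hM hr.
have iha := integ_abs ih.
(* [m j] exceeds both [2 |r|] and [|b|]: the interval [[- m j, b]] is nondegenerate, and [ln_diff]
   applies on the support of [h]. *)
pose c : R := 2 * `|r| + `|b| + 1; pose m (j : nat) : R := c + j%:R.
have r0 := normr_ge0 r; have b0 := normr_ge0 b.
have cm j : c <= m j by rewrite /m lerDl.
have m0 j : 0 < m j by apply: lt_le_trans (cm j); rewrite /c; lra.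
have mb j : - m j < b.
  by have := cm j; have := ler_norm (- b); rewrite normrN /c; lra.
(* The contribution of the far endpoint. Subtracting [ln (m j)] changes nothing because [h] has mean
   zero, and leaves a quantity of order [1 / m j] on the support. *)
pose X j := Int (fun t => h t * (ln `|t - - m j| - ln (m j))).
have bX j t : `|h t * (ln `|t - - m j| - ln (m j))| <= 2 * `|r| / m j * `|h t|.
  have [tr|tr] := ltP r `|t|; first by rewrite hr// mul0r normr0 mulr0.
  have tr' : `|t| <= `|r| by apply: le_trans tr _; exact: ler_norm.
  have [t1 t2] : - `|r| <= t /\ t <= `|r| by apply/andP; rewrite -ler_norml.
  rewrite normrM mulrC ler_wpM2r//.
  have tm : 0 < t - - m j by have := cm j; rewrite /c; lra.
  rewrite (gtr0_norm tm); apply: le_trans (ln_diff _ _ _) _ => //.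
    by have := cm j; rewrite /c; lra.
  by rewrite opprK addrK ler_wpM2r ?invr_ge0 ?(ltW (m0 j))// ler_wpM2l.
have iX j : integ (fun t => h t * (ln `|t - - m j| - ln (m j))).
  apply: (integ_le _ (integ_scale (2 * `|r| / m j) iha)) => //.
  by apply: measurable_funM => //; apply: measurable_funB => //; exact: meas_ln_dist.
have E j : Int (fun x => \1_`[- m j, b] x * hilbert h x) =
    - (pi^-1 * (X j + Int (fun x => h x * psi b x))).
  rewrite (hilbert_adj (L2_indic_itv _ _) Lh); congr (- _).
  have i1 := integ_add (iX j) ip; have i2 := integ_add i1 (integ_scale (ln (m j)) ih).
  have <- : Int (fun t => pi^-1 * (h t * (ln `|t - - m j| - ln (m j)) + h t * psi b t + ln (m j) * h t)) =
      pi^-1 * (X j + Int (fun x => h x * psi b x)).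
    rewrite (Int_scale pi^-1 i2) (Int_add i1 (integ_scale (ln (m j)) ih)) (Int_add (iX j) ip).
    by rewrite (Int_scale (ln (m j)) ih) h0 mulr0 addr0.
  apply: Int_ae.
  - apply: measurable_funM => //; apply: (L2_hilbert _).1; exact: L2_indic_itv.
  - by apply: integ_meas; exact: integ_scale.
  - apply: aeS (hilbert_indic (mb j)) => t ->; rewrite psiE.
    by move: (ln _) (ln _) (ln _) => A B C; ring.
have cX : X j @[j --> \oo] --> (0 : R).
  pose C := 2 * `|r| * Int (fun t => `|h t|).
  have C0 : 0 <= C by rewrite /C !mulr_ge0//; apply: Int_ge0 => t; exact: normr_ge0.
  have XC j : `|X j| <= C * j.+1%:R^-1.
    apply: (@le_trans _ _ (C * (m j)^-1)); last first.
      rewrite ler_wpM2l// lef_pV2 ?posrE// -natr1 /m addrC lerD2r /c.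
      by have := r0; have := b0; lra.
    have iC := integ_scale (2 * `|r| / m j) iha.
    apply: (le_trans (Int_norm_le (integ_meas (iX j)) iC (bX j))).
    by rewrite (Int_scale _ iha) /C mulrAC.
  have Cc : C * j.+1%:R^-1 @[j --> \oo] --> (0 : R).
    by rewrite -(mulr0 C); apply: cvgMl_tmp; exact: cvg_harmonic.
  apply: (@squeeze_cvgr _ _ _ _ (fun j => - (C * j.+1%:R^-1)) (fun j => C * j.+1%:R^-1)) => //.
    by apply: nearW => j; rewrite -ler_norml.
  by rewrite -oppr0; exact: cvgN.
have c1 : Int (fun x => \1_`[- m j, b] x * hilbert h x) @[j --> \oo] -->
    - (pi^-1 * (0 + Int (fun x => h x * psi b x))).
  rewrite (_ : (fun j => _) = fun j => - (pi^-1 * (X j + Int (fun x => h x * psi b x)))); last exact/funext.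
  by apply: cvgN; apply: cvgMl_tmp; apply: cvgD => //; exact: cvg_cst.
have c2 : Int (fun x => \1_`[- m j, b] x * hilbert h x) @[j --> \oo] -->
    Int (fun x => \1_`]-oo, b] x * hilbert h x).
  have [||||_ _ //] := @Int_dct _ (fun j x => \1_`[- m j, b] x * hilbert h x)
    (fun x => \1_`]-oo, b] x * hilbert h x) (fun x => `|hilbert h x|).
  - by move=> j; apply: measurable_funM; [exact: measurable_indic|exact: integ_meas].
  - exact: integ_abs.
  - by move=> x j; exact: norm_indicM.
  - move=> x; apply: cvgMr_tmp; apply: cvg_near_cst.
    have [xb|xb] := pselect (`]-oo, b]%classic x); last first.
      apply: nearW => j; rewrite (indicE0 xb) indicE0// => h1; apply: xb.
      by move: h1; rewrite /= !in_itv/= => /andP[].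
    exists (Num.trunc `|x|).+1 => // j /= hj.
    rewrite (indicE1 xb) indicE1//; move: xb; rewrite /= !in_itv/= => ->; rewrite andbT.
    have h1 : `|x| < j%:R by apply: lt_le_trans (truncnS_gt _) _; rewrite ler_nat.
    have := ler_norm (- x); rewrite normrN /m /c; lra.
by rewrite /L0 Int_on (cvg_seq_unique c2 c1) add0r mulrN -mulNr opprK mulrA divff// mul1r.
Qed.

End Functional.

(** * Density and duality *)

Section Duality.
Context {R : realType}.
Local Notation mu := (@lebesgue_measure R).
Implicit Types (f g h k : R -> R) (F G : R -> R -> R) (x y t a b c s u v r z : R).

Let pi0 : 0 < pi :> R := pi_gt0 R.
Let piN0 : pi != 0 :> R := lt0r_neq0 pi0.
Ltac gpi := have := piN0; move: (pi : R) => p pN0.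

Lemma H1P h : H1 h <-> integ h /\ integ (hilbert h).
Proof. by split=> -[h1 h2]; split; apply/Lfun1_integrable. Qed.

Lemma hilbert_lin_L1 c f g : integ f -> integ g ->
  {ae mu, forall x, hilbert (fun t => c * f t + g t) x = c * hilbert f x + hilbert g x}.
Proof. by move=> fi gi; apply: hilbert_lin; [exact: W_L1|exact: W_L1|exact: hilbert_ae|exact: hilbert_ae]. Qed.

Lemma H1_lin c f g : H1 f -> H1 g -> H1 (fun t => c * f t + g t).
Proof.
move=> /H1P [fi fh] /H1P [gi gh].
have i : integ (fun t => c * f t + g t) by apply: integ_add => //; exact: integ_scale.
apply/H1P; split; first exact: i.
apply: (integ_ae (integ_add (integ_scale c fh) gh) (meas_hilbert (W_L1 i))).
by apply: aeS (hilbert_lin_L1 c fi gi) => x ->.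
Qed.

Lemma test_molecule h : H1_test h ->
  [/\ L2 h, L2 (fun x => x * h x), Int h = 0 & H1 h].
Proof.
move=> [mh [M hM] ch h0]; have [r hr] := test_support ch.
have [ih Lh Lxh] := bounded_support_L2 mh hM hr.
by split => //; apply/H1P; split => //; have [] := hilbert_molecule ltr01 Lh Lxh h0.
Qed.

Lemma L0E b h : L0 b h = - pi * Int (fun x => \1_`]-oo, b] x * hilbert h x).
Proof. by rewrite /L0 Int_on. Qed.

(** Linearity rests on the almost everywhere existence of the transform on L^1; the constant is [pi]
    because [H1_norm] contains the L^1 norm of [hilbert h]. *)
Lemma L0_functional b : H1_BMO_functional (psi b) (L0 b).
Proof.
have mI : measurable (`]-oo, b]%classic : set R) by [].
split; [exact: psi_BMO| | |by move=> h; exact: L0_test].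
- move=> c h1 h2 H1 H2; have H3 := H1_lin c H1 H2.
  have [i1 j1] := (H1P _).1 H1; have [i2 j2] := (H1P _).1 H2; have [_ j3] := (H1P _).1 H3.
  have k1 := integ_on mI j1; have k2 := integ_on mI j2; have k3 := integ_on mI j3.
  rewrite !L0E.
  have -> : Int (fun x => \1_`]-oo, b] x * hilbert (fun t => c * h1 t + h2 t) x) =
      c * Int (fun x => \1_`]-oo, b] x * hilbert h1 x) + Int (fun x => \1_`]-oo, b] x * hilbert h2 x).
    rewrite -(Int_scale c k1) -(Int_add (integ_scale c k1) k2); apply: Int_ae.
    + exact: integ_meas.
    + by apply: integ_meas; apply: integ_add; [exact: integ_scale|exact: k2].
    + by apply: aeS (hilbert_lin_L1 c i1 i2) => x ->; rewrite mulrDr mulrCA.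
  by rewrite mulrDr mulrCA.
- exists pi => h /H1P [i j]; have k := integ_on mI j.
  rewrite L0E normrM normrN (gtr0_norm pi0); apply: ler_wpM2l; [exact: ltW|rewrite /H1_norm].
  apply: (@le_trans _ _ (Int (fun x => `|hilbert h x|))); last first.
    by rewrite lerDr; apply: Int_ge0 => x; exact: normr_ge0.
  apply: Int_norm_le; [exact: integ_meas|exact: integ_abs|].
  by move=> x; exact: norm_indicM.
Qed.

(** * Approximation by conjugate Poisson integrals *)

Lemma n2_hilbert_sub f g : L2 f -> L2 g ->
  n2 (fun x => hilbert f x - hilbert g x) = n2 (fun x => f x - g x).
Proof.
move=> Lf Lg; have [[_ Lf' _] _ hf] := hilbert_L2 Lf; have [[_ Lg' _] _ hg] := hilbert_L2 Lg.
have Lfg := L2_add (L2_scale (-1) Lg) Lf; have [_ n _] := hilbert_L2 Lfg.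
have E : n2 (hilbert (fun x => -1 * g x + f x)) = n2 (fun x => hilbert f x - hilbert g x).
  apply: Int_ae.
  - by apply: measurable_funX; exact: (L2_hilbert Lfg).1.
  - by apply: measurable_funX; exact: (L2_sub Lf' Lg').1.
  - by apply: aeS (hilbert_lin (-1) (W_L2 Lg) (W_L2 Lf) hg hf) => x ->; congr (_ ^+ 2); ring.
by rewrite -E n; apply: Int_eq => x; congr (_ ^+ 2); ring.
Qed.

(** The Poisson integral at height [e] of the transform is [Qc e (Qc s k)], that is
    [- Pc (e + s) k]; then [e] tends to 0. *)
Lemma hilbert_Qc s k : 0 < s -> integ k ->
  {ae mu, forall x, hilbert (Qc s k) x = - Pc s k x}.
Proof.
move=> s0 ik; have Lu := Qc_L2_of_L1 s0 ik; have [[_ Lh h] _ _] := hilbert_L2 Lu.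
apply: aeS (ae_Lpt (W_L2 Lh)) => x lx.
pose e (n : nat) : R := n.+1%:R^-1.
have e0 n : 0 < e n by rewrite invr_gt0.
have c1 := cvg_right_seq (Pc_Lpt (W_L2 Lh) lx).
have c2 : Pc (e n) (hilbert (Qc s k)) x @[n --> \oo] --> - Pc s k x.
  rewrite (_ : (fun n => _) = fun n => - Pc (s + e n) k x).
    by apply: cvgN; apply: Pc_cont => //; exact: W_L1.
  apply/funext => n; have [-> _] := h (e n) x (e0 n).
  by rewrite (Qc_Qc x (e0 n) s0 ik) addrC.
exact: cvg_seq_unique c1 c2.
Qed.

(* [f] is the Hilbert transform of [- hilbert f], and [Qc s k = Pc s (hilbert k)]. *)
Lemma Qc_dense f (d : R) : L2 f -> 0 < d -> exists k s (n : nat),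
  [/\ 0 < s, L2 k, integ k, forall x, n%:R < `|x| -> k x = 0 &
      n2 (fun x => f x - Qc s k x) <= d].
Proof.
move=> Lf d0; have [cf _ _] := hilbert_L2 Lf.
have cw := conj_pair_opp (conj_pair_opp (conj_pair_opp cf)).
pose w x := - hilbert f x; have Lw : L2 w := L2_opp (L2_hilbert Lf).
have hw : {ae mu, forall x, hilbert w x = f x}.
  by apply: aeS (conj_pair_ae cw) => x /Hlim_hilbert ->; rewrite opprK.
(* There are two errors, truncation and smoothing, and [n2_tri] doubles each. *)
have d4 : 0 < d / 4 by rewrite divr_gt0.
have /cvgrPdist_le /(_ _ d4) [n _ /(_ n (leqnn n)) /=] := L2_exhaust Lw.
rewrite sub0r normrN ger0_norm ?n2_ge0// => hn.
pose k x := \1_`[- n%:R, n%:R] x * w x.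
have Lk : L2 k by exact: L2_on.
have ik : integ k := L2_exhaust_integ n Lw.
have Lhk := L2_hilbert Lk.
have [ck _ _] := hilbert_L2 Lk; have [_ _ hk] := ck.
have e0 (m : nat) : 0 < m.+1%:R^-1 :> R by rewrite invr_gt0.
have /cvgrPdist_le /(_ _ d4) [m _ /(_ m (leqnn m)) /=] := Pc_cvg_L2 e0 cvg_harmonic Lhk.
rewrite sub0r normrN ger0_norm ?n2_ge0// => hm.
have s0 : 0 < m.+1%:R^-1 :> R by rewrite invr_gt0.
exists k, m.+1%:R^-1, n; split => //.
  move=> x nx; rewrite /k indicE0 ?mul0r//= in_itv/= -ler_norml.
  by apply/negP; rewrite -ltNge.
have E : n2 (fun x => f x - hilbert k x) = n2 (fun x => k x - w x).
  rewrite -(n2_hilbert_sub Lk Lw) n2_subC; apply: Int_ae.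
  - by apply: measurable_funX; exact: (L2_sub Lhk Lf).1.
  - by apply: measurable_funX; exact: (L2_sub Lhk (L2_hilbert Lw)).1.
  - by apply: aeS hw => x ->.
have Qk : Qc m.+1%:R^-1 k = Pc m.+1%:R^-1 (hilbert k).
  by apply/funext => x; have [] := hk _ x s0.
have Lp := Pc_L2 s0 Lhk.
rewrite Qk; have := n2_tri (L2_sub Lf Lhk) (L2_sub Lhk Lp).
rewrite E (n2_subC (hilbert k)).
rewrite (@Int_eq _ (fun x => (_ + _) ^+ 2) (fun x => (f x - Pc m.+1%:R^-1 (hilbert k) x) ^+ 2)); last first.
  by move=> x; congr (_ ^+ 2); ring.
move=> h1; apply: (le_trans h1).
have gen (A B : R) : A <= d / 4 -> B <= d / 4 -> 2 * A + 2 * B <= d by lra.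
exact: gen hn hm.
Qed.

(** Write [x = (x - t) + t] with [|t| <= n] on the support: the convolution is bounded and decays
    like [1 / x]. *)
Lemma conv_decay (K : R -> R) k (c : R) (n : nat) x : measurable_fun setT K ->
  (forall z, `|K z| <= c) -> (forall z, `|z * K z| <= 1) ->
  integ k -> (forall t, n%:R < `|t| -> k t = 0) ->
  `|Int (fun t => K (x - t) * k t)| <= c * Int (fun t => `|k t|) /\
  `|x * Int (fun t => K (x - t) * k t)| <= (1 + n%:R * c) * Int (fun t => `|k t|).
Proof.
move=> mK Kc zK ik kn; have ika := integ_abs ik.
have mKx : measurable_fun setT (fun t => K (x - t)).
  by apply: measurableT_comp => //; exact: meas_reflect.
have mKk : measurable_fun setT (fun t => K (x - t) * k t).
  by apply: measurable_funM => //; exact: integ_meas.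
have b1 t : `|K (x - t) * k t| <= c * `|k t| by rewrite normrM ler_wpM2r.
have i1 := integ_le mKk (integ_scale c ika) b1.
rewrite -(Int_scale c ika) -(Int_scale x i1) -(Int_scale (1 + n%:R * c) ika).
split; apply: Int_norm_le => //; try exact: integ_scale.
  exact: measurable_funM.
move=> t; rewrite mulrA normrM; have [tn|tn] := ltP n%:R `|t|.
  by rewrite kn// normr0 !mulr0.
rewrite ler_wpM2r// (_ : x * _ = (x - t) * K (x - t) + t * K (x - t)); last by ring.
apply: (le_trans (ler_normD _ _)); apply: lerD => //.
by rewrite normrM ler_pM.
Qed.

Lemma z_P_le s z : 0 < s -> `|z * P s z| <= 1.
Proof.
move=> s0; have D := den_gt0 z s0; have p2 := pi_ge2 R.
rewrite /P mulrA normrM normfV (gtr0_norm (_ : 0 < pi * _)) ?mulr_gt0//.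
rewrite ler_pdivrMr ?mulr_gt0// mul1r normrM (gtr0_norm s0).
apply: (@le_trans _ _ (z ^+ 2 + s ^+ 2)); last by rewrite ler_peMl ?ltW//; lra.
by rewrite -(real_normK (num_real z)); have := sqr_ge0 (`|z| - s); have := normr_ge0 z; nra.
Qed.

Lemma z_Q_le s z : 0 < s -> `|z * Q s z| <= 1.
Proof.
move=> s0; have D := den_gt0 z s0; have p2 := pi_ge2 R.
rewrite /Q mulrA -expr2 normrM normfV (gtr0_norm (_ : 0 < pi * _)) ?mulr_gt0//.
rewrite ler_pdivrMr ?mulr_gt0// mul1r ger0_norm ?sqr_ge0//.
apply: (@le_trans _ _ (z ^+ 2 + s ^+ 2)); first by rewrite lerDl sqr_ge0.
by rewrite ler_peMl ?ltW//; lra.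
Qed.

End Duality.

(** * Agreement of all admissible functionals on squares *)

Section Uniqueness.
Context {R : realType}.
Local Notation mu := (@lebesgue_measure R).
Implicit Types (f g h k : R -> R) (x y t a b c s u v r z : R).

Let pi0 : 0 < pi :> R := pi_gt0 R.

Lemma hilbert_sqr_diff_H1 f : L2 f ->
  H1 (fun x => f x ^+ 2 - hilbert f x ^+ 2) /\
  {ae mu, forall x, hilbert (fun t => f t ^+ 2 - hilbert f t ^+ 2) x = 2 * (f x * hilbert f x)}.
Proof.
move=> Lf; have Lh := L2_hilbert Lf.
have h : {ae mu, forall x, hilbert (fun t => f t ^+ 2 - hilbert f t ^+ 2) x = 2 * (f x * hilbert f x)}.
  by apply: aeS (hilbert_sqr_diff Lf) => x /Hlim_hilbert.
have i : integ (fun x => f x ^+ 2 - hilbert f x ^+ 2) := integ_sub Lf.2 Lh.2.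
split; last exact: h.
apply/H1P; split; first exact: i.
apply: (integ_ae (integ_scale 2 (L2_mul Lf Lh)) (meas_hilbert (W_L1 i))).
by apply: aeS h => x ->.
Qed.

(** What the difference of two admissible functionals satisfies. *)
Definition null_functional (D : (R -> R) -> R) (C : R) := [/\
  forall a (h1 h2 : R -> R), H1 h1 -> H1 h2 ->
    D (fun x => a * h1 x + h2 x) = a * D h1 + D h2,
  forall h, H1 h -> `|D h| <= C * H1_norm h &
  forall h, H1_test h -> D h = 0].

(** Cut [g] off to [[-n, n]] and restore the mean zero by a multiple of the indicator of [[0, 1]],
    which gives a test function [h n]. The error [k n] has mean zero and both its L^2 norms tend to
    0, so its H^1 norm is bounded by a quantity tending to [2 pi / la]; then [la] tends to
    infinity. *)
Lemma molecule_eq0 (D : (R -> R) -> R) (C : R) g (M : R) : null_functional D C ->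
  (forall x, `|g x| <= M) -> L2 g -> L2 (fun x => x * g x) -> Int g = 0 -> H1 g /\ D g = 0.
Proof.
move=> [Dlin Dbd Dtest] gM Lg Lxg g0.
have [ig _] := L1_of_weight ltr01 Lg Lxg; have [ihg _] := hilbert_molecule ltr01 Lg Lxg g0.
have Hg : H1 g by apply/H1P.
split => //; pose I (n : nat) : R -> R := \1_`[- n%:R, n%:R]; pose J : R -> R := \1_`[0, 1].
pose m n := Int (fun x => I n x * g x).
have mg := integ_meas ig.
have iI n : integ (fun x => I n x * g x) by exact: integ_on.
have iJ : integ J by exact: integrable_indic_itv.
have IJ : Int J = 1 by rewrite (Int_indic_itv ltr01) subr0.
have mc : m @ \oo --> (0 : R) by rewrite -g0; exact: Int_exhaust.
pose h n x := - m n * J x + I n x * g x.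
have mh n : measurable_fun setT (h n) by apply: integ_meas; apply: integ_add => //; exact: integ_scale.
have Th n : H1_test (h n).
  split => //.
  - exists (`|m n| + M) => x; apply: (le_trans (ler_normD _ _)); apply: lerD.
      by rewrite normrM normrN ler_piMr// ger0_norm ?indic_ge0 ?indic_le1.
    by apply: le_trans (gM x); exact: norm_indicM.
  - apply: (subclosed_compact (@closed_closure _ _) (@segment_compact _ (- n.+1%:R) n.+1%:R)).
    apply: (subset_trans (closure_subset _) (@itv_closed _ _ _ _)) => x /= hx.
    rewrite in_itv/=; have n0 : 0 <= n%:R :> R by [].
    have [h1|h1] := pselect (`[0, 1]%classic x).
      by move: h1; rewrite /= in_itv/= -natr1 => /andP[h1 h2]; apply/andP; split; lra.
    have [h2|h2] := pselect (`[- n%:R, n%:R]%classic x).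
      by move: h2; rewrite /= in_itv/= -natr1 => /andP[h3 h4]; apply/andP; split; lra.
    by exfalso; move: hx; rewrite /h /I /J !indicE0// mulr0 mul0r addr0 eqxx.
  - rewrite (Int_add (integ_scale (- m n) iJ) (iI n)) (Int_scale _ iJ) IJ mulr1.
    by rewrite addNr.
pose k n x := -1 * h n x + g x.
have Lh n : L2 (h n) by have [] := test_molecule (Th n).
have Lxh n : L2 (fun x => x * h n x) by have [] := test_molecule (Th n).
have Hh n : H1 (h n) by have [] := test_molecule (Th n).
have Dk n : D (k n) = D g by rewrite (Dlin (-1) _ _ (Hh n) Hg) (Dtest _ (Th n)) mulr0 add0r.
have Hk n : H1 (k n) := @H1_lin _ (-1) _ _ (Hh n) Hg.
have LJ : L2 J := L2_indic_itv 0 1.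
have LxJ : L2 (fun x => x * J x).
  have [] // := @bounded_support_L2 _ J 1 1 LJ.1 => [x|x x1].
    by rewrite ger0_norm ?indic_ge0 ?indic_le1.
  rewrite /J indicE0//= in_itv/= => /andP[h1 h2].
  by move: x1; rewrite ger0_norm// ltNge h2.
pose al n := n2 (fun x => I n x * g x - g x).
pose be n := n2 (fun x => I n x * (x * g x) - x * g x).
have LI n : L2 (fun x => I n x * g x - g x) by apply: L2_sub => //; exact: L2_on.
have LxI n : L2 (fun x => I n x * (x * g x) - x * g x) by apply: L2_sub => //; exact: L2_on.
have Lk n : L2 (k n) by apply: L2_add => //; exact: L2_scale.
have Lxk n : L2 (fun x => x * k n x).
  have := L2_add (L2_scale (-1) (Lxh n)) Lxg; congr L2; apply/funext => x.
  by rewrite /k; ring.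
have k0 n : Int (k n) = 0.
  have ih : integ (h n) by apply: integ_add => //; exact: integ_scale.
  have [_ _ _ h0] := Th n.
  by rewrite (Int_add (integ_scale (-1) ih) ig) (Int_scale (-1) ih) h0 g0 mulr0 addr0.
have nk n : n2 (k n) + n2 (fun x => x * k n x) <=
    2 * (m n ^+ 2 * (n2 J + n2 (fun x => x * J x))) + 2 * (al n + be n).
  have e1 : n2 (k n) <= 2 * (m n ^+ 2 * n2 J) + 2 * al n.
    rewrite -(n2_scale (m n) LJ) /al (n2_subC (fun x => I n x * g x)).
    apply: le_trans (n2_tri (L2_scale (m n) LJ) (L2_sub Lg (L2_on _ Lg))); last by [].
    by rewrite le_eqVlt; apply/orP; left; apply/eqP/Int_eq => x; congr (_ ^+ 2); rewrite /k /h /I; ring.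
  have e2 : n2 (fun x => x * k n x) <= 2 * (m n ^+ 2 * n2 (fun x => x * J x)) + 2 * be n.
    rewrite -(n2_scale (m n) LxJ) /be (n2_subC (fun x => I n x * (x * g x))).
    apply: le_trans (n2_tri (L2_scale (m n) LxJ) (L2_sub Lxg (L2_on _ Lxg))); last by [].
    by rewrite le_eqVlt; apply/orP; left; apply/eqP/Int_eq => x; congr (_ ^+ 2); rewrite /k /h /I; ring.
  by move: e1 e2; move: (n2 (k n)) (n2 (fun x => x * k n x)) (n2 J) (n2 (fun x => x * J x)) (al n) (be n) (m n ^+ 2) => *; lra.
pose B (la : R) n := `|C| * (2 * (la * (2 * (m n ^+ 2 * (n2 J + n2 (fun x => x * J x))) + 2 * (al n + be n)) + la^-1 * pi)).
have DB (la : R) n : 0 < la -> `|D g| <= B la n.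
  move=> la0; rewrite -(Dk n); apply: (le_trans (Dbd _ (Hk n))).
  have [_ e1] := L1_of_weight la0 (Lk n) (Lxk n).
  have [_ e2] := hilbert_molecule la0 (Lk n) (Lxk n) (k0 n).
  have e3 : H1_norm (k n) <= 2 * (la * (n2 (k n) + n2 (fun x => x * k n x)) + la^-1 * pi).
    by rewrite mulr_natl mulr2n; exact: lerD.
  have n0 : 0 <= H1_norm (k n).
    by apply: addr_ge0; apply: Int_ge0 => x; exact: normr_ge0.
  apply: (@le_trans _ _ (`|C| * H1_norm (k n))); first by rewrite ler_wpM2r// ler_norm.
  apply: ler_wpM2l => //; apply: (le_trans e3); rewrite ler_pM2l// lerD2r ler_pM2l//.
have Bc (la : R) : B la @ \oo --> `|C| * (2 * (la^-1 * pi)).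
  rewrite [X in _ --> X](_ : _ = `|C| * (2 * (la * (2 * (0 * (n2 J + n2 (fun x => x * J x))) + 2 * (0 + 0)) + la^-1 * pi))); last first.
    by move: (n2 J + _) (la^-1) => A L; ring.
  apply: cvgMl_tmp; apply: cvgMl_tmp; apply: cvgD; last exact: cvg_cst.
  apply: cvgMl_tmp; apply: cvgD; apply: cvgMl_tmp.
    by apply: cvgMr_tmp; exact: cvg_sqr0.
  by apply: cvgD; exact: L2_exhaust.
have Dla (la : R) : 0 < la -> `|D g| <= `|C| * (2 * (la^-1 * pi)).
  by move=> la0; apply: cvgr_to_ge (Bc la) _; apply: nearW => n; exact: DB.
apply/eqP; rewrite -normr_eq0 eq_le normr_ge0 andbT.
have c0 : `|C| * (2 * (n.+1%:R^-1 * pi)) @[n --> \oo] --> (0 : R).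
  rewrite [X in _ --> X](_ : _ = `|C| * (2 * (0 * pi))); last by rewrite mul0r !mulr0.
  by apply: cvgMl_tmp; apply: cvgMl_tmp; apply: cvgMr_tmp; exact: cvg_harmonic.
by apply: cvgr_to_ge c0 _; apply: nearW => n; exact: Dla.
Qed.

(** With [w = p - s], [p^2 - s^2 = 2 p w - w^2] and [2 p w <= e p^2 + e^-1 w^2]; the products are
    treated alike. One majorant thus serves a function and its Hilbert transform, the two halves of
    the H^1 norm. *)
Lemma sqr_diff_le (p q s t e : R) : 0 < e ->
  `|(p ^+ 2 - q ^+ 2) - (s ^+ 2 - t ^+ 2)| <=
    e * (p ^+ 2 + q ^+ 2) + (e^-1 + 1) * ((p - s) ^+ 2 + (q - t) ^+ 2) /\
  `|2 * (p * q) - 2 * (s * t)| <=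
    e * (p ^+ 2 + q ^+ 2) + (e^-1 + 1) * ((p - s) ^+ 2 + (q - t) ^+ 2).
Proof.
move=> e0; pose w := p - s; pose z := q - t.
have amgm (a v : R) : `|2 * (a * v)| <= e * a ^+ 2 + e^-1 * v ^+ 2.
  have h : 0 <= e^-1 by rewrite invr_ge0 ltW.
  have E : e * a ^+ 2 + e^-1 * v ^+ 2 = e^-1 * ((e * a) ^+ 2 + v ^+ 2).
    by field; rewrite gt_eqF.
  have E2 : 2 * (a * v) = e^-1 * (2 * ((e * a) * v)) by field; rewrite gt_eqF.
  rewrite E E2 normrM (ger0_norm h) ler_wpM2l// ler_norml.
  have := sqr_ge0 (e * a - v); have := sqr_ge0 (e * a + v).
  by move: (e * a) => A; rewrite !expr2; nra.
have h1 := amgm p w; have h2 := amgm q z; have h3 := amgm p z; have h4 := amgm q w.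
have h5 : `|2 * (w * z)| <= w ^+ 2 + z ^+ 2.
  rewrite ler_norml; have := sqr_ge0 (w - z); have := sqr_ge0 (w + z).
  by rewrite !expr2; nra.
have ws : s = p - w by rewrite /w; ring.
have zt : t = q - z by rewrite /z; ring.
rewrite -/w -/z ws zt; move: h1 h2 h3 h4 h5; clearbody w z.
rewrite !ler_norml => /andP[a1 b1] /andP[a2 b2] /andP[a3 b3] /andP[a4 b4] /andP[a5 b5].
have w2 := sqr_ge0 w; have z2 := sqr_ge0 z.
by split; apply/andP; split; rewrite !expr2 in a1 b1 a2 b2 a3 b3 a4 b4 a5 b5 w2 z2 *; lra.
Qed.

Lemma eps_sum (e A X : R) : 0 < e -> e <= 1 -> X <= e ^+ 2 ->
  e * (A + A) + (e^-1 + 1) * (X + X) <= e * (2 * A + 4).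
Proof.
move=> e0 e1 Xe; have L0 : 0 <= e^-1 + 1 by rewrite addr_ge0// invr_ge0 ltW.
have h : (e^-1 + 1) * X <= e + e.
  apply: le_trans (ler_wpM2l L0 Xe) _.
  rewrite (_ : (e^-1 + 1) * e ^+ 2 = e + e ^+ 2); last by field; rewrite gt_eqF.
  by rewrite lerD2l expr2 ler_piMl// ltW.
by move: (e^-1 + 1) h => L h; lra.
Qed.

Lemma P_bound s z : 0 < s -> `|P s z| <= s^-1.
Proof.
move=> s0; have p1 : 1 <= pi :> R by have := pi_ge2 R; lra.
have ps : 0 < pi * s by exact: mulr_gt0.
rewrite (ger0_norm (P_ge0 z s0)); apply: le_trans (P_sup z s0) _.
by rewrite lef_pV2 ?posrE// ler_peMl// ltW.
Qed.

(** [f] is approximated by [u = Qc s k], and [v = Pc s k] replaces [hilbert u], which equals [- v]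
    only almost everywhere, because [v] has bounds at every point. Both are bounded and decay like
    [1 / x], and [u^2 - v^2] has mean zero by the isometry, so [molecule_eq0] applies to it. *)
Lemma sqr_diff_eq0 (D : (R -> R) -> R) (C : R) f : null_functional D C -> L2 f ->
  D (fun x => f x ^+ 2 - hilbert f x ^+ 2) = 0.
Proof.
move=> nD Lf; have [Dlin Dbd Dtest] := nD; have Lh := L2_hilbert Lf.
have [HF hF] := hilbert_sqr_diff_H1 Lf; set F := (fun x => _ - _).
have iF : integ F := integ_sub Lf.2 Lh.2.
have [[_ _ _] nf _] := hilbert_L2 Lf.
have key (e : R) : 0 < e -> e <= 1 -> `|D F| <= `|C| * (2 * (e * (2 * n2 f + 4))).
  (* The tolerance [e ^+ 2] compensates the factor [e^-1] of [sqr_diff_le]. *)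
  move=> e0 e1; have e2 : 0 < e ^+ 2 by rewrite exprn_gt0.
  have [k [s [n [s0 Lk ik kn hd]]]] := Qc_dense Lf e2.
  pose u := Qc s k; pose v := Pc s k; pose g x := u x ^+ 2 - v x ^+ 2.
  have Lu : L2 u := Qc_L2_of_L1 s0 ik; have Lv : L2 v := Pc_L2 s0 Lk.
  have Lhu := L2_hilbert Lu; have [_ nu _] := hilbert_L2 Lu.
  have hu := hilbert_Qc s0 ik.
  have dQ x := conv_decay x (meas_Q s0) (fun z => Q_bound z s0) (fun z => z_Q_le z s0) ik kn.
  have dP x := conv_decay x (meas_P s0) (fun z => P_bound z s0) (fun z => z_P_le z s0) ik kn.
  pose c1 := s^-1 * Int (fun t => `|k t|); pose c2 := (1 + n%:R * s^-1) * Int (fun t => `|k t|).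
  have mx w : L2 w -> measurable_fun setT (fun x => x * w x).
    by move=> Lw; apply: measurable_funM => //; exact: Lw.1.
  have Lg : L2 g.
    have := L2_sub (L2_bound Lu Lu.1 (fun x => (dQ x).1)) (L2_bound Lv Lv.1 (fun x => (dP x).1)).
    by congr L2; apply/funext => x; rewrite /g !expr2.
  have Lxg : L2 (fun x => x * g x).
    have := L2_sub (L2_bound Lu (mx _ Lu) (fun x => (dQ x).2)) (L2_bound Lv (mx _ Lv) (fun x => (dP x).2)).
    by congr L2; apply/funext => x; rewrite /g; ring.
  have g0 : Int g = 0.
    rewrite (Int_sub Lu.2 Lv.2) -nu; apply/eqP; rewrite subr_eq0; apply/eqP; apply: Int_ae.
    - by apply: measurable_funX; exact: Lhu.1.
    - by apply: measurable_funX; exact: Lv.1.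
    - by apply: aeS hu => x ->; rewrite sqrrN.
  have gM x : `|g x| <= c1 ^+ 2 + c1 ^+ 2.
    apply: (le_trans (ler_normB _ _)); rewrite !normrX.
    have sq (a : R) : `|a| <= c1 -> `|a| ^+ 2 <= c1 ^+ 2.
      by move=> h; rewrite lerXn2r// nnegrE (le_trans _ h).
    by apply: lerD; apply: sq; [exact: (dQ x).1|exact: (dP x).1].
  have [Hg Dg] := molecule_eq0 nD gM Lg Lxg g0.
  have ig : integ g by have [] := (H1P g).1 Hg.
  pose w x := -1 * g x + F x.
  have Hw : H1 w := @H1_lin _ (-1) _ _ Hg HF.
  have -> : D F = D w by rewrite (Dlin (-1) _ _ Hg HF) Dg mulr0 add0r.
  have [iw ihw] := (H1P w).1 Hw.
  have [_ hG] := hilbert_sqr_diff_H1 Lu.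
  have gu : {ae mu, forall x, u x ^+ 2 - hilbert u x ^+ 2 = g x}.
    by apply: aeS hu => x ->; rewrite sqrrN.
  have iG : integ (fun x => u x ^+ 2 - hilbert u x ^+ 2) := integ_sub Lu.2 Lhu.2.
  have hg : {ae mu, forall x, hilbert g x = 2 * (u x * hilbert u x)}.
    apply: aeS (hilbert_sqr_diff Lu) => x hx; apply: Hlim_hilbert.
    exact: Hlim_ae (W_L1 iG) (W_L1 ig) gu hx.
  pose B x := e * (f x ^+ 2 + hilbert f x ^+ 2) +
    (e^-1 + 1) * ((f x - u x) ^+ 2 + (hilbert f x - hilbert u x) ^+ 2).
  have j1 := integ_add Lf.2 Lh.2; have j2 := integ_add (L2_sub Lf Lu).2 (L2_sub Lh Lhu).2.
  have iB : integ B := integ_add (integ_scale e j1) (integ_scale (e^-1 + 1) j2).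
  have IB : Int B <= e * (2 * n2 f + 4).
    rewrite (Int_add (integ_scale e j1) (integ_scale (e^-1 + 1) j2)).
    rewrite (Int_scale e j1) (Int_scale (e^-1 + 1) j2) (Int_add Lf.2 Lh.2).
    rewrite (Int_add (L2_sub Lf Lu).2 (L2_sub Lh Lhu).2) nf (n2_hilbert_sub Lf Lu).
    exact: eps_sum.
  have n1 : Int (fun x => `|w x|) <= Int B.
    apply: Int_ae_le => //; first exact: integ_abs.
    apply: aeS gu => x gx; rewrite /w -gx mulN1r addrC /F /B.
    exact: (sqr_diff_le _ _ _ _ e0).1.
  have n2' : Int (fun x => `|hilbert w x|) <= Int B.
    apply: Int_ae_le => //; first exact: integ_abs.
    apply: aeS3 (hilbert_lin_L1 (-1) ig iF) hg hF => x -> -> ->; rewrite mulN1r addrC /B.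
    exact: (sqr_diff_le _ _ _ _ e0).2.
  have N0 : 0 <= H1_norm w.
    by apply: addr_ge0; apply: Int_ge0 => x; exact: normr_ge0.
  apply: le_trans (Dbd _ Hw) _; apply: (@le_trans _ _ (`|C| * H1_norm w)).
    by rewrite ler_wpM2r// ler_norm.
  apply: ler_wpM2l => //; rewrite mulr_natl mulr2n; apply: lerD.
    exact: le_trans n1 IB.
  exact: le_trans n2' IB.
apply/eqP; rewrite -normr_eq0 eq_le normr_ge0 andbT.
have c0 : `|C| * (2 * (m.+1%:R^-1 * (2 * n2 f + 4))) @[m --> \oo] --> (0 : R).
  rewrite [X in _ --> X](_ : _ = `|C| * (2 * (0 * (2 * n2 f + 4)))); last by rewrite mul0r !mulr0.
  by apply: cvgMl_tmp; apply: cvgMl_tmp; apply: cvgMr_tmp; exact: cvg_harmonic.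
apply: cvgr_to_ge c0 _; apply: nearW => m; apply: key; first by rewrite invr_gt0.
by rewrite invf_le1// ler1n.
Qed.

(** [xget] returns an admissible functional because [L0 b] is one; the difference of the two is a
    [null_functional] with the sum of their constants. *)
Lemma pairing_L0 b f : L2 f ->
  H1_BMO_pairing (psi b) (fun x => f x ^+ 2 - hilbert f x ^+ 2) =
  L0 b (fun x => f x ^+ 2 - hilbert f x ^+ 2).
Proof.
move=> Lf; rewrite /H1_BMO_pairing.
have := xgetPex (fun=> 0 : R) (ex_intro _ (L0 b) (L0_functional b)).
have := L0_functional b; move: (xget _ _) (L0 b) => L K.
move=> [_ Klin [C2 Kbd] Kt] [_ Llin [C1 Lbd] Lt].
have nD : null_functional (fun h => L h - K h) (C1 + C2).
  split.
  - move=> a h1 h2 i1 i2; rewrite (Llin a _ _ i1 i2) (Klin a _ _ i1 i2).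
    by move: (L h1) (L h2) (K h1) (K h2) => *; ring.
  - move=> h Hh; rewrite mulrDl; apply: (le_trans (ler_normB _ _)).
    by apply: lerD; [exact: Lbd|exact: Kbd].
  - by move=> h Th; rewrite (Lt _ Th) (Kt _ Th) subrr.
by have /eqP := sqr_diff_eq0 nD Lf; rewrite subr_eq0 => /eqP.
Qed.

End Uniqueness.

Theorem theorem2 (R : realType) (f : R -> R) (b : R)
    (hf : f \in Lfun (@lebesgue_measure R) 2%:E) :
  H1 (fun x : R => f x ^+ 2 - hilbert f x ^+ 2) /\
  pi^-1 * H1_BMO_pairing (fun x : R => ln (1 / `|x - b|))
            (fun x : R => f x ^+ 2 - hilbert f x ^+ 2) =
  - 2 * Rintegral (@lebesgue_measure R) `]-oo, b]
          (fun x : R => f x * hilbert f x).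
Proof.
have Lf : L2 f.
  split; last exact: Lfun2_integrable_sqr.
  by move: hf; rewrite inE => /andP[]; rewrite inE.
have Lh := L2_hilbert Lf; have [HF hF] := hilbert_sqr_diff_H1 Lf; split; first exact: HF.
rewrite (pairing_L0 b Lf) L0E (Int_on _ (fun x => f x * hilbert f x)).
have mI : measurable (`]-oo, b]%classic : set R) by [].
have iP := integ_on mI (L2_mul Lf Lh).
have -> : Int (fun x => \1_`]-oo, b] x * hilbert (fun t => f t ^+ 2 - hilbert f t ^+ 2) x) =
    2 * Int (fun x => \1_`]-oo, b] x * (f x * hilbert f x)).
  rewrite -(Int_scale 2 iP); apply: Int_ae.
  - exact: (integ_meas (integ_on mI ((H1P _).1 HF).2)).
  - exact: (integ_meas (integ_scale 2 iP)).
  - by apply: aeS hF => x ->; ring.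
rewrite !mulNr mulrN mulrA mulVf ?mul1r// gt_eqF//; exact: pi_gt0.
Qed.
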